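(* Let $k$ be an algebraically closed field of characteristic $0$, and let $p < q$ be twin primes (that is, $p$ and $q = p+2$ are both prime). Then every Hopf algebra $H$ over $k$ of dimension $pq$ is semisimple.
   Context: A Hopf algebra is called semisimple if it is semisimple as an algebra. *)

(* Defs.v *)
From HB Require Import structures.
From mathcomp Require Import all_boot all_order all_algebra all_field.

Set Implicit Arguments.
Unset Strict Implicit.
Unset Printing Implicit Defensive.

Import GRing.Theory.
Import VectorInternalTheory.

Local Open Scope ring_scope.

(* The tensor product of two finite dimensional spaces, realised on coordinate
   matrices: the pure tensor of u and v is the outer product of the coordinate
   vectors v2r u and v2r v.  [tlift_tens] and [tlift_uniq] show that this is the
   tensor product, by its universal property. *)
Definition tensor (k : fieldType) (U V : vectType k) : Type :=
  'M[k]_(dim U, dim V).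

#[warning="-redundant-canonical-projection"]
HB.instance Definition _ (k : fieldType) (U V : vectType k) :=
  Vector.copy (tensor U V) 'M[k]_(dim U, dim V).

Definition tens (k : fieldType) (U V : vectType k) (u : U) (v : V) :
  tensor U V := (v2r u)^T *m v2r v.

(* The linear map out of the tensor product induced by b; b is meant to be
   bilinear, and only its values on pairs of basis vectors matter. *)
Definition tlift (k : fieldType) (U V W : vectType k) (b : U -> V -> W)
  (t : tensor U V) : W :=
  \sum_(i < dim U) \sum_(j < dim V)
    (t : 'M[k]_(dim U, dim V)) i j
      *: b (r2v (delta_mx 0 i)) (r2v (delta_mx 0 j)).

Section TensorTheory.

Variables (k : fieldType) (U V W : vectType k).

Lemma tlift_is_linear (b : U -> V -> W) : linear (tlift b).
Proof.
move=> a s t; rewrite /tlift scaler_sumr -big_split; apply: eq_bigr => i _ /=.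
rewrite scaler_sumr -big_split; apply: eq_bigr => j _ /=.
by rewrite !mxE scalerDl scalerA.
Qed.

HB.instance Definition _ (b : U -> V -> W) :=
  GRing.isLinear.Build k (tensor U V) W *:%R (tlift b) (tlift_is_linear b).

Lemma tens_bilinear : bilinear_for *:%R *:%R (@tens k U V).
Proof.
split=> [v a u u' | u a v v'] /=; rewrite /tens linearP.
  by rewrite linearP /= mulmxDl -scalemxAl.
by rewrite /= mulmxDr -scalemxAr.
Qed.

Lemma tensor_basis (t : tensor U V) :
  t = \sum_(i < dim U) \sum_(j < dim V)
        (t : 'M[k]_(dim U, dim V)) i j
          *: tens (r2v (delta_mx 0 i)) (r2v (delta_mx 0 j)).
Proof.
rewrite {1}[t](@matrix_sum_delta _ (dim U) (dim V)).
apply: eq_bigr => i _; apply: eq_bigr => j _; congr (_ *: _).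
by rewrite /tens !r2vK trmx_delta mul_delta_mx.
Qed.

Lemma tlift_tens (b : U -> V -> W) :
  bilinear_for *:%R *:%R b -> forall u v, tlift b (tens u v) = b u v.
Proof.
move=> [bl br] u v.
pose bL v : {linear U -> W} :=
  HB.pack (b^~ v) (GRing.isLinear.Build k U W *:%R _ (bl v)).
pose bR u : {linear V -> W} :=
  HB.pack (b u) (GRing.isLinear.Build k V W *:%R _ (br u)).
rewrite -[RHS]/(bL v u) -[in RHS](v2rK u) (row_sum_delta (v2r u)) !linear_sum.
apply: eq_bigr => i _; rewrite !linearZ -[RHS]/(_ *: bR _ v).
rewrite -[in RHS](v2rK v) (row_sum_delta (v2r v)) !linear_sum.
apply: eq_bigr => j _; rewrite !linearZ /= scalerA.
by rewrite /tens mxE big_ord1 mxE mulrC.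
Qed.

Lemma tlift_uniq (f : {linear tensor U V -> W}) :
  f =1 tlift (fun u v => f (tens u v)).
Proof.
move=> t; rewrite {1}[t]tensor_basis linear_sum; apply: eq_bigr => i _.
by rewrite linear_sum; apply: eq_bigr => j _; rewrite linearZ.
Qed.

End TensorTheory.

Section TensorMaps.

Variable k : fieldType.

Definition tmap (U U' V V' : vectType k) (f : U -> U') (g : V -> V') :
  tensor U V -> tensor U' V' := tlift (fun u v => tens (f u) (g v)).

Definition tassoc (U V W : vectType k) :
  tensor (tensor U V) W -> tensor U (tensor V W) :=
  tlift (fun s w => tlift (fun u v => tens u (tens v w)) s).

(* The product of the algebra A (x) B. *)
Definition tmul (A B : falgType k) (s t : tensor A B) : tensor A B :=
  tlift (fun a b => tlift (fun c d => tens (a * c) (b * d)) t) s.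

Lemma tmap_tens (U U' V V' : vectType k)
    (f : {linear U -> U'}) (g : {linear V -> V'}) u v :
  tmap f g (tens u v) = tens (f u) (g v).
Proof.
rewrite /tmap tlift_tens //; split=> [y a x x' | x a y y'] /=; rewrite linearP.
  exact: (tens_bilinear U' V').1.
exact: (tens_bilinear U' V').2.
Qed.

Lemma eq_tlift (U V W : vectType k) (b b' : U -> V -> W) :
  (forall u v, b u v = b' u v) -> tlift b =1 tlift b'.
Proof.
by move=> e t; apply: eq_bigr => i _; apply: eq_bigr => j _; rewrite e.
Qed.

Lemma tliftD (U V W : vectType k) a (b b' : U -> V -> W) t :
  tlift (fun u v => a *: b u v + b' u v) t = a *: tlift b t + tlift b' t.
Proof.
rewrite /tlift scaler_sumr -big_split; apply: eq_bigr => i _ /=.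
rewrite scaler_sumr -big_split; apply: eq_bigr => j _ /=.
by rewrite scalerDr !scalerA mulrC.
Qed.

Lemma tassoc_tens (U V W : vectType k) (u : U) (v : V) (w : W) :
  tassoc (tens (tens u v) w) = tens u (tens v w).
Proof.
have [lU rU] := tens_bilinear U (tensor V W).
have [lV rV] := tens_bilinear V W.
rewrite /tassoc tlift_tens; first rewrite tlift_tens //.
  by split=> [y a x x' | x a y y'] /=; rewrite ?lU // lV rU.
split=> [y a s s' | s a y y'] /=; first by rewrite linearP.
by rewrite -tliftD; apply: eq_tlift => x z; rewrite rV rU.
Qed.

Lemma tmul_tens (A B : falgType k) (a c : A) (b d : B) :
  tmul (tens a b) (tens c d) = tens (a * c) (b * d).
Proof.
have [l r] := tens_bilinear A B.
have lm (D : falgType k) e (x y z : D) : (e *: x + y) * z = e *: (x * z) + y * z.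
  by rewrite mulrDl scalerAl.
have rm (D : falgType k) e (x y z : D) : z * (e *: x + y) = e *: (z * x) + z * y.
  by rewrite mulrDr scalerAr.
rewrite /tmul tlift_tens; first rewrite tlift_tens //.
  by split=> [y e x x' | x e y y'] /=; rewrite rm ?l ?r.
split=> [y e x x' | x e y y'] /=; rewrite -tliftD; apply: eq_tlift => z w.
  by rewrite lm l.
by rewrite lm r.
Qed.

End TensorMaps.

HB.mixin Record Vector_isCoalgebra (k : fieldType) C of Vector k C := {
  comul : {linear C -> tensor C C};
  counit : {linear C -> k^o};
  comulA : forall x : C,
    tassoc (tmap comul idfun (comul x)) = tmap idfun comul (comul x);
  counit_comull : forall x : C, tlift (fun a b => counit a *: b) (comul x) = x;
  counit_comulr : forall x : C, tlift (fun a b => counit b *: a) (comul x) = x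
}.

#[short(type="coalgType")]
HB.structure Definition Coalgebra (k : fieldType) :=
  {C of Vector_isCoalgebra k C & Vector k C}.

HB.mixin Record Coalgebra_isBialgebra (k : fieldType) B
    of Falgebra k B & Coalgebra k B := {
  comul1 : comul (1 : B) = tens 1 1;
  comulM : forall x y : B, comul (x * y) = tmul (comul x) (comul y);
  counit1 : counit (1 : B) = 1;
  counitM : forall x y : B, counit (x * y) = counit x * counit y
}.

#[short(type="bialgType")]
HB.structure Definition Bialgebra (k : fieldType) :=
  {B of Coalgebra_isBialgebra k B & Falgebra k B & Coalgebra k B}.

HB.mixin Record Bialgebra_isHopfAlgebra (k : fieldType) H of Bialgebra k H := {
  antipode : {linear H -> H};
  antipodel : forall x : H,
    tlift (fun a b => antipode a * b) (comul x) = (counit x : k)%:A;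
  antipoder : forall x : H,
    tlift (fun a b => a * antipode b) (comul x) = (counit x : k)%:A
}.

#[short(type="hopfAlgType")]
HB.structure Definition HopfAlgebra (k : fieldType) :=
  {H of Bialgebra_isHopfAlgebra k H & Bialgebra k H}.

Definition left_ideal (k : fieldType) (A : falgType k) (I : {vspace A}) : Prop :=
  forall a x : A, x \in I -> a * x \in I.

(* The simple submodules of the left regular module. *)
Definition minimal_left_ideal (k : fieldType) (A : falgType k)
  (I : {vspace A}) : Prop :=
  [/\ left_ideal I, I != 0%VS &
    forall J : {vspace A}, left_ideal J -> (J <= I)%VS -> J = 0%VS \/ J = I].

(* The left regular module is a direct sum of simple modules. *)
Definition semisimple_algebra (k : fieldType) (A : falgType k) : Prop :=
  exists (n : nat) (I : 'I_n -> {vspace A}),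
    [/\ forall i, minimal_left_ideal (I i),
        directv (\sum_(i < n) I i) &
        (\sum_(i < n) I i)%VS = {:A}%VS].

(* Main.v *)
(** Let l be a nonzero left cointegral of H, g the distinguished grouplike
    element and al the modular character.  By Maschke's theorem H is semisimple
    as soon as a left integral L has nonzero counit, so suppose eps L = 0; then
    x |-> a S^2(x) and the product of S^2 with a character action all have
    trace 0.  The powers of g and of al act with uniform multiplicities, so the
    orders of g and al divide p (p + 2).  If al g = 1 and the product of the two
    orders is p (p + 2), an integral with nonzero counit can be written down.
    If both orders are 1 then S^4 = 1 by Radford's formula while S^2 has trace
    0, which is impossible in odd dimension.

    In the remaining cases there is a projection E of rank p or p + 2, given by
    the averages of the powers of g or al, commuting with U = S^2, and
    U^(2r) = 1 for a prime r in {p, p + 2}.  On the image of E the trace of U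
    vanishes and l gives a nondegenerate form b with b y x = b x (U^r y), which
    is symmetric on the 1-eigenspace of U^r and alternating on its
    (-1)-eigenspace, so the latter has even dimension.  The vanishing of a sum
    of r-th roots of unity makes the two dimensions congruent modulo r; since
    their sum is within 2 of r, this forces the 1-eigenspace to be a line and
    gives x != 0 with S^2 x = - x.  Together with the line, Radford's formula
    and the nondegeneracy of l this yields x = 0. *)

Require Import Defs.
From HB Require Import structures.
From Stdlib Require Import Classical.
From mathcomp Require Import all_boot all_order all_algebra all_field zify ring.

Set Implicit Arguments.
Unset Strict Implicit.
Unset Printing Implicit Defensive.

Import GRing.Theory.
Import VectorInternalTheory.

Local Open Scope ring_scope.

(** * Sweedler notation *)

(** Where b comes from: the Nakayama automorphism of the form l (x y) is h |-> S^2 (al -> h), which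
    is not an involution. Twisting l by a power of the antipode, and for nontrivial g also by a
    square root of g, turns this asymmetry into U^r. Both twists are halvings of an exponent modulo
    r, possible because r is odd.

    Where x comes from: U is the product of U^(r+1), of order dividing r, and the involution U^r.
    The difference of the dimensions of the two eigenspaces is - r, spread evenly over the r-th
    roots of unity, so each eigenvalue of U^(r+1) occurs once more where U^r = - 1. The eigenvalue 1
    of U^(r+1) therefore occurs there.

    Uniform multiplicities come from traces instead of freeness over a sub-Hopf algebra: x (x) y |->
    x1 (x) x2 y conjugates A (x) id to A (x) g, so every trace t of a power of g satisfies t^2 =
    (dim H) t. In terms of multiplicities, which are non-negative integers, this is a convolution
    identity on a cyclic group, and a maximum argument then makes them constant.

    Cointegrals are also built from traces: x |-> tr (y |-> f -> (x S^2 y)) is one for every f, and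
    not all of these vanish. *)

Notation "\sw_ ( a , b <- x ) E" := (tlift (fun a b => E) (comul x))
  (at level 36, E at level 36, a binder, b binder, x at level 50,
   format "\sw_ ( a ,  b  <-  x )  E").

(** * Closure properties of linearity and a tactic applying them *)

Section LinearClosure.

Variables (k : fieldType).

Lemma lin_id (U : lmodType k) : linear (fun x : U => x).
Proof. by []. Qed.

Lemma lin_app (U V W : lmodType k) (h : {linear V -> W}) (f : U -> V) :
  linear f -> linear (fun x => h (f x)).
Proof. by move=> lf a x y; rewrite lf linearP. Qed.

Lemma lin_comp (U V W : lmodType k) (h : V -> W) (f : U -> V) :
  linear h -> linear f -> linear (fun x => h (f x)).
Proof. by move=> lh lf a x y; rewrite lf lh. Qed.

Lemma lin_mull (U : lmodType k) (A : falgType k) (f : U -> A) (c : A) :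
  linear f -> linear (fun x => f x * c).
Proof. by move=> lf a x y; rewrite lf mulrDl scalerAl. Qed.

Lemma lin_mulr (U : lmodType k) (A : falgType k) (f : U -> A) (c : A) :
  linear f -> linear (fun x => c * f x).
Proof. by move=> lf a x y; rewrite lf mulrDr scalerAr. Qed.

Lemma lin_scalel (U V : lmodType k) (f : U -> k^o) (v : V) :
  linear f -> linear (fun x => (f x : k) *: v).
Proof. by move=> lf a x y; rewrite lf scalerDl scalerA. Qed.

Lemma lin_scaler (U V : lmodType k) (f : U -> V) (c : k) :
  linear f -> linear (fun x => c *: f x).
Proof. by move=> lf a x y; rewrite lf scalerDr !scalerA mulrC. Qed.

Lemma lin_add (U V : lmodType k) (f g : U -> V) :
  linear f -> linear g -> linear (fun x => f x + g x).
Proof. by move=> lf lg a x y; rewrite lf lg scalerDr addrACA. Qed.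

Lemma lin_opp (U V : lmodType k) (f : U -> V) :
  linear f -> linear (fun x => - f x).
Proof. by move=> lf a x y; rewrite lf opprD scalerN. Qed.

Lemma lin_sum (U V : lmodType k) (I : Type) (r : seq I) (P : pred I)
    (F : I -> U -> V) :
  (forall i, linear (F i)) -> linear (fun x => \sum_(i <- r | P i) F i x).
Proof.
move=> lF a x y; rewrite scaler_sumr -big_split.
by apply: eq_bigr => i _; rewrite lF.
Qed.

Lemma lin_tlift (X : lmodType k) (U V W : vectType k) (b : U -> V -> W)
    (f : X -> tensor U V) :
  linear f -> linear (fun x => tlift b (f x)).
Proof. by move=> lf a x y; rewrite lf linearP. Qed.

Lemma lin_tlift_body (X : lmodType k) (U V W : vectType k)
    (b : X -> U -> V -> W) (t : tensor U V) :
  (forall u v, linear (fun x => b x u v)) -> linear (fun x => tlift (b x) t).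
Proof.
by move=> lb a x y; rewrite -tliftD; apply: eq_tlift => u v; rewrite lb.
Qed.

Lemma lin_tensl (X : lmodType k) (U V : vectType k) (f : X -> U) (v : V) :
  linear f -> linear (fun x => tens (f x) v).
Proof. by move=> lf a x y; rewrite lf (tens_bilinear U V).1. Qed.

Lemma lin_tensr (X : lmodType k) (U V : vectType k) (f : X -> V) (u : U) :
  linear f -> linear (fun x => tens u (f x)).
Proof. by move=> lf a x y; rewrite lf (tens_bilinear U V).2. Qed.

Lemma lin_iter (U : lmodType k) (f : U -> U) n :
  linear f -> linear (iter n f).
Proof. by move=> lf a x y; elim: n => //= n ->; rewrite lf. Qed.

End LinearClosure.

(** A bilinear operation counts as linear in whichever argument contains the bound variable, the
    other being constant. The named operations come before the generic application pattern, which
    could also match them. *)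
Ltac lin_step :=
  lazymatch goal with
  | |- GRing.linear_for _ (fun x => x) => apply: lin_id
  | |- GRing.linear_for _ (fun x => tlift (@?b x) (@?f x)) =>
      lazymatch f with
      | fun _ => ?t => apply: (@lin_tlift_body _ _ _ _ _ b t) => ? ?; cbv beta
      | _ => lazymatch b with
             | fun _ => ?b' => apply: (@lin_tlift _ _ _ _ _ b' f)
             end
      end
  | |- GRing.linear_for _ (fun x => tens (@?f x) (@?g x)) =>
      lazymatch f with
      | fun _ => ?u => apply: (@lin_tensr _ _ _ _ g u)
      | _ => lazymatch g with fun _ => ?v => apply: (@lin_tensl _ _ _ _ f v) end
      end
  | |- GRing.linear_for _ (fun x => @GRing.mul _ (@?f x) (@?g x)) =>
      lazymatch f with
      | fun _ => ?u => apply: (@lin_mulr _ _ _ g u)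
      | _ => lazymatch g with fun _ => ?v => apply: (@lin_mull _ _ _ f v) end
      end
  | |- GRing.linear_for _ (fun x => @GRing.scale _ _ (@?f x) (@?g x)) =>
      lazymatch f with
      | fun _ => ?u => apply: (@lin_scaler _ _ _ g u)
      | _ => lazymatch g with fun _ => ?v => apply: (@lin_scalel _ _ _ f v) end
      end
  | |- GRing.linear_for _ (fun x => GRing.add (@?f x) (@?g x)) =>
      apply: (@lin_add _ _ _ f g)
  | |- GRing.linear_for _ (fun x => GRing.opp (@?f x)) => apply: (@lin_opp _ _ _ f)
  | |- GRing.linear_for _ (fun x => GRing.Linear.sort (@?h x) (@?f x)) =>
      lazymatch h with fun _ => ?h' => apply: (@lin_app _ _ _ _ h' f) end
  | |- GRing.linear_for _ (fun x => ?h (@?f x)) => apply: (@lin_comp _ _ _ _ h f)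
  | |- GRing.linear_for _ _ => apply: linearP
  end.

Ltac lin := do ?[by [] | assumption | lin_step | progress cbv beta].

Ltac bilin := split=> ?; cbv beta; lin.

(** * Computation with iterated coproducts *)

Section SweedlerCalculus.

Variables (k : fieldType).

Lemma scaleRE (a : k) (b : k^o) : a *: b = (a * b : k).
Proof. by []. Qed.

Lemma tensZl (U V : vectType k) (c : k) (u : U) (v : V) : tens (c *: u) v = c *: tens u v.
Proof. by rewrite /tens linearZ /= linearZ /= -scalemxAl. Qed.

Lemma tensZr (U V : vectType k) (c : k) (u : U) (v : V) : tens u (c *: v) = c *: tens u v.
Proof. by rewrite /tens linearZ /= -scalemxAr. Qed.

Lemma lin_tens (U V : vectType k) (u : U) : linear (@tens k U V u).
Proof. exact: (tens_bilinear U V).2. Qed.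

Lemma eq_sw (U V W : vectType k) (b b' : U -> V -> W) t :
  (forall u v, b u v = b' u v) -> tlift b t = tlift b' t.
Proof. by move=> e; apply: eq_tlift. Qed.

Lemma tlift_ext (U V W : vectType k) (f g : tensor U V -> W) :
  linear f -> linear g -> (forall u v, f (tens u v) = g (tens u v)) -> f =1 g.
Proof.
move=> lf lg e t.
pose F : {linear tensor U V -> W} := HB.pack f (GRing.isLinear.Build k _ _ _ _ lf).
pose G : {linear tensor U V -> W} := HB.pack g (GRing.isLinear.Build k _ _ _ _ lg).
by rewrite -[f t]/(F t) -[g t]/(G t) (tlift_uniq F) (tlift_uniq G); apply: eq_sw.
Qed.

Definition linpack (U V : lmodType k) (h : U -> V) (lh : linear h) : {linear U -> V} :=
  HB.pack h (GRing.isLinear.Build k _ _ _ _ lh).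

Lemma linZ (U V : lmodType k) (h : U -> V) : linear h -> forall c x, h (c *: x) = c *: h x.
Proof.
move=> lh c x; pose F : {linear U -> V} := HB.pack h (GRing.isLinear.Build k _ _ _ _ lh).
by rewrite -[h _]/(F _) linearZ.
Qed.

Lemma linear_tlift (U V W X : vectType k) (h : W -> X) (b : U -> V -> W) t :
  linear h -> h (tlift b t) = tlift (fun u v => h (b u v)) t.
Proof.
move=> lh; pose F : {linear W -> X} := HB.pack h (GRing.isLinear.Build k _ _ _ _ lh).
rewrite -[h _]/(F _) linear_sum; apply: eq_bigr => i _.
by rewrite linear_sum; apply: eq_bigr => j _; rewrite linearZ.
Qed.

Lemma tlift_exchange (U V U' V' W : vectType k) (t : tensor U V)
    (t' : tensor U' V') (b : U -> V -> U' -> V' -> W) :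
  tlift (fun u v => tlift (fun u' v' => b u v u' v') t') t =
  tlift (fun u' v' => tlift (fun u v => b u v u' v') t) t'.
Proof.
rewrite /tlift; under eq_bigr do under eq_bigr do rewrite scaler_sumr.
under eq_bigr do rewrite exchange_big.
rewrite exchange_big; apply: eq_bigr => i _ /=.
under eq_bigr do under eq_bigr do rewrite scaler_sumr.
under eq_bigr do rewrite exchange_big.
rewrite exchange_big /=; apply: eq_bigr => j _ /=.
rewrite scaler_sumr; apply: eq_bigr => a _; rewrite scaler_sumr.
by apply: eq_bigr => c _; rewrite !scalerA mulrC.
Qed.

Lemma tlift_id (U V : vectType k) (t : tensor U V) : tlift (@tens k U V) t = t.
Proof. by rewrite [RHS]tensor_basis. Qed.

Lemma tlift_basis (U V W : vectType k) (b : U -> V -> W) i (v : V) :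
  tlift b (tens (r2v (delta_mx 0 i)) v) =
  \sum_(j < dim V) v2r v 0 j *: b (r2v (delta_mx 0 i)) (r2v (delta_mx 0 j)).
Proof.
rewrite /tlift (bigD1 i) //= [X in _ + X]big1 ?addr0 => [|m nm].
  by apply: eq_bigr => j _; rewrite /tens mxE big_ord1 r2vK !mxE !eqxx mul1r.
rewrite big1 // => j _; rewrite /tens mxE big_ord1 r2vK !mxE eqxx /=.
by rewrite (negPf nm) mul0r scale0r.
Qed.

(* A map only has to be known on the basis in order to be evaluated on an
   iterated coproduct, so that no linearity is required here. *)
Lemma sw_coassoc (C : coalgType k) (W : vectType k) (x : C) (t : C -> C -> C -> W) :
  \sw_(a, b <- x) \sw_(c, d <- a) t c d b = \sw_(a, b <- x) \sw_(c, d <- b) t a c d.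
Proof.
(* [l] is the linear map on the threefold tensor product with the values of [t] on basis triples;
   the two iterated sums are its values on the two sides of [comulA]. *)
pose l := tlift (fun a (s : tensor C C) => tlift (t a) s).
have lE i s : l (tens (r2v (delta_mx 0 i)) s) = tlift (t (r2v (delta_mx 0 i))) s.
  rewrite /l tlift_basis -[s in RHS]v2rK [in RHS](row_sum_delta (v2r s)) !linear_sum /=.
  by apply: eq_bigr => j _; rewrite !linearZ.
have E := congr1 l (comulA x).
have lin_l : linear l by apply: linearP.
transitivity (l (tassoc (tmap comul idfun (comul x)))); last first.
  rewrite E /tmap linear_tlift //; apply: eq_bigr => i _; apply: eq_bigr => j _.
  by rewrite lE.
rewrite /tmap (@linear_tlift _ _ _ _ (fun s => l (tassoc s))); last by rewrite /tassoc; lin.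
apply: eq_bigr => i _; apply: eq_bigr => j _.
congr (_ *: _); rewrite /tassoc tlift_tens; last by bilin.
rewrite linear_tlift //; apply: eq_bigr => a _; apply: eq_bigr => b _.
rewrite lE tlift_basis (bigD1 j) //= r2vK !mxE !eqxx scale1r big1 ?addr0 //.
by move=> m nm; rewrite mxE (negPf nm) andbF scale0r.
Qed.

Section Coalgebra.
Variables (C : coalgType k) (V : vectType k).
Implicit Types (x : C).

Lemma sw_counitl x (f : C -> V) : linear f ->
  \sw_(a, b <- x) (counit a *: f b) = f x.
Proof.
move=> lf; rewrite -[in RHS](counit_comull x) linear_tlift //.
by apply: eq_sw => a b; rewrite linZ.
Qed.

Lemma sw_counitr x (f : C -> V) : linear f ->
  \sw_(a, b <- x) (counit b *: f a) = f x.
Proof.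
move=> lf; rewrite -[in RHS](counit_comulr x) linear_tlift //.
by apply: eq_sw => a b; rewrite linZ.
Qed.
End Coalgebra.

Lemma tlift_sum (U V W : vectType k) (I : finType) (b : I -> U -> V -> W) t :
  tlift (fun u v => \sum_i b i u v) t = \sum_i tlift (b i) t.
Proof.
rewrite /tlift [RHS]exchange_big; apply: eq_bigr => a _ /=.
rewrite [RHS]exchange_big; apply: eq_bigr => c _ /=.
by rewrite scaler_sumr.
Qed.

Lemma tliftZ (U V W : vectType k) (c : k) (b : U -> V -> W) t :
  tlift (fun u v => c *: b u v) t = c *: tlift b t.
Proof. by rewrite (@linear_tlift _ _ _ _ (fun w => c *: w)) //; lin. Qed.

Lemma tliftZr (U V : vectType k) (W : vectType k) (b : U -> V -> k^o) (w : W) t :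
  tlift (fun u v => (b u v : k) *: w) t = (tlift b t : k) *: w.
Proof. by rewrite (@linear_tlift _ _ _ _ (fun c : k^o => (c : k) *: w)) //; lin. Qed.

Lemma tliftMl (U V : vectType k) (A : falgType k) (b : U -> V -> A) c t :
  tlift (fun u v => c * b u v) t = c * tlift b t.
Proof. by rewrite (@linear_tlift _ _ _ _ (fun z => c * z)) //; lin. Qed.

Lemma tliftMr (U V : vectType k) (A : falgType k) (b : U -> V -> A) c t :
  tlift (fun u v => b u v * c) t = tlift b t * c.
Proof. by rewrite (@linear_tlift _ _ _ _ (fun z => z * c)) //; lin. Qed.

Section Hopf.
Variables (H : hopfAlgType k) (V : vectType k).
Implicit Types x y : H.

Lemma sw_mul x y (b : H -> H -> V) : bilinear_for *:%R *:%R b ->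
  \sw_(u, v <- x * y) b u v =
  \sw_(a, c <- x) \sw_(d, e <- y) b (a * d) (c * e).
Proof.
move=> bb; have lb : linear (tlift b) by apply: linearP.
rewrite comulM /tmul (@linear_tlift _ _ _ _ (tlift b)) //.
apply: eq_sw => a c; rewrite (@linear_tlift _ _ _ _ (tlift b)) //.
by apply: eq_sw => d e; rewrite tlift_tens.
Qed.

Lemma sw_one (b : H -> H -> V) : bilinear_for *:%R *:%R b ->
  \sw_(u, v <- 1) b u v = b 1 1.
Proof. by move=> bb; rewrite comul1 tlift_tens. Qed.

Lemma sw_antipodel x (f : H -> V) : linear f ->
  \sw_(a, b <- x) f (antipode a * b) = counit x *: f 1.
Proof.
move=> lf; rewrite -linear_tlift // antipodel.
pose F : {linear H -> V} := HB.pack f (GRing.isLinear.Build k _ _ _ _ lf).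
by rewrite -[f _]/(F _) linearZ.
Qed.

Lemma sw_antipoder x (f : H -> V) : linear f ->
  \sw_(a, b <- x) f (a * antipode b) = counit x *: f 1.
Proof.
move=> lf; rewrite -linear_tlift // antipoder.
pose F : {linear H -> V} := HB.pack f (GRing.isLinear.Build k _ _ _ _ lf).
by rewrite -[f _]/(F _) linearZ.
Qed.

End Hopf.
End SweedlerCalculus.

(** * The antipode reverses products and coproducts *)

Section Antipode.

Variables (k : fieldType) (H : hopfAlgType k).
Implicit Types x y : H.
Local Notation S := (@antipode k H).
Local Notation eps x := (@counit k H x : k).

Lemma antipode1 : S 1 = 1.
Proof. by have := antipodel (1 : H); rewrite sw_one ?mulr1 ?counit1 ?scale1r //; bilin. Qed.

Lemma counit_antipode x : counit (S x) = counit x.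
Proof.
have l : linear (fun y => counit (S y)) by lin.
rewrite -(sw_counitr x l).
have := congr1 (@counit k H) (antipodel x); rewrite linear_tlift; last by lin.
rewrite linearZ /= counit1 => e; rewrite -[RHS]mulr1 -[RHS]e.
by apply: eq_sw => a b; rewrite counitM mulrC.
Qed.

(** Both sides are convolution inverses of the multiplication. The common value is S(x1 y1) x2 y2
    S(y3) S(x3), contracted from the right for one side and from the left for the other. *)
Lemma antipodeM x y : S (x * y) = S y * S x.
Proof.
transitivity (\sw_(a, b <- x) \sw_(b1, b2 <- b) \sw_(c, d <- y) \sw_(d1, d2 <- d)
   (S (a * c) * (b1 * d1) * (S d2 * S b2))).
  have l : linear (fun u => S (u * y)) by lin.
  rewrite -[LHS](sw_counitr x l); apply: eq_sw => a b.
  have l2 : linear (fun u => S (a * u)) by lin.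
  rewrite -[X in eps b *: X](sw_counitr y l2).
  transitivity (\sw_(b1, b2 <- b) \sw_(c, d <- y) (eps d *: (S (a * c) * (b1 * S b2)))).
    rewrite tlift_exchange -tliftZ; apply: eq_sw => c d.
    rewrite tliftZ scalerA mulrC -scalerA; congr (_ *: _).
    by rewrite (@sw_antipoder _ _ _ b (fun z => S (a * c) * z)) ?mulr1 //; lin.
  apply: eq_sw => b1 b2; apply: eq_sw => c d.
  rewrite -[X in X *: _ = _]/(eps d) -(mulr1 b1).
  rewrite -(@sw_antipoder _ _ _ d (fun z => S (a * c) * (b1 * z * S b2))); last by lin.
  by apply: eq_sw => d1 d2; rewrite !mulrA ?mulr1.
rewrite -sw_coassoc.
transitivity (\sw_(a, b <- x) \sw_(c, d <- y) (eps a *: (eps c *: (S d * S b)))); last first.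
  have l : linear (fun u => S y * S u) by lin.
  rewrite -[RHS](sw_counitl x l); apply: eq_sw => a b.
  have l2 : linear (fun u => S u * S b) by lin.
  by rewrite tliftZ (sw_counitl y l2).
apply: eq_sw => a b.
under eq_sw => a1 a2 do rewrite -sw_coassoc.
rewrite tlift_exchange; apply: eq_sw => c d.
have l : linear (fun z => z * (S d * S b)) by lin.
have := @sw_antipodel _ _ _ (a * c) _ l.
rewrite sw_mul; last by bilin.
by rewrite counitM mul1r scalerA => ->.
Qed.

(** Both sides are convolution inverses of [comul]. The fivefold sum is the product of comul (S x1),
    x2 (x) x3 and S x5 (x) S x4, again contracted from either end. *)
Lemma comul_antipode x : comul (S x) = \sw_(a, b <- x) tens (S b) (S a).
Proof.
transitivity (\sw_(a, b <- x) \sw_(b1, b2 <- b) \sw_(c, d <- b2) \sw_(c1, c2 <- c)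
  \sw_(u, v <- S a) tens (u * b1 * S d) (v * c1 * S c2)).
  have l : linear (fun u => comul (S u)) by lin.
  rewrite -[LHS](sw_counitr x l); apply: eq_sw => a b.
  transitivity (\sw_(u, v <- S a) (eps b *: tens u v)).
    by rewrite tliftZ tlift_id.
  transitivity (\sw_(b1, b2 <- b) \sw_(u, v <- S a) tens (u * (b1 * S b2)) v).
    rewrite tlift_exchange; apply: eq_sw => u v.
    by rewrite (@sw_antipoder _ _ _ b (fun z => tens (u * z) v)) ?mulr1 //; lin.
  apply: eq_sw => b1 b2.
  have l2 : linear (fun z => \sw_(u, v <- S a) tens (u * (b1 * S z)) v) by lin.
  rewrite -[LHS](sw_counitl b2 l2); apply: eq_sw => c d.
  rewrite tlift_exchange -tliftZ; apply: eq_sw => u v.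
  have l3 : linear (fun z => tens (u * (b1 * S d)) (v * z)) by lin.
  have := @sw_antipoder _ _ _ c _ l3; rewrite mulr1 => <-.
  by apply: eq_sw => c1 c2; rewrite !mulrA.
transitivity (\sw_(p, e <- x) \sw_(a, f <- p) \sw_(b1, c1 <- f) \sw_(c2, d <- e)
  \sw_(u, v <- S a) tens (u * b1 * S d) (v * c1 * S c2)).
  rewrite sw_coassoc; apply: eq_sw => a b.
  rewrite sw_coassoc; apply: eq_sw => b1 b2.
  by rewrite sw_coassoc.
have l : linear (fun z => \sw_(a, b <- z) tens (S b) (S a)) by lin.
rewrite -[RHS](sw_counitl x l); apply: eq_sw => p e.
under eq_sw => a f do rewrite tlift_exchange.
rewrite tlift_exchange -tliftZ; apply: eq_sw => c2 d.
have := @sw_antipodel _ _ _ p (fun z => \sw_(u, v <- z) tens (u * S d) (v * S c2)).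
rewrite sw_one; last by bilin.
rewrite !mul1r => <-; last by lin.
apply: eq_sw => a f; rewrite sw_mul; last by bilin.
by rewrite tlift_exchange.
Qed.

Lemma sw_antipode (V : vectType k) x (b : H -> H -> V) : bilinear_for *:%R *:%R b ->
  \sw_(u, v <- S x) b u v = \sw_(u, v <- x) b (S v) (S u).
Proof.
move=> bb; rewrite comul_antipode (@linear_tlift _ _ _ _ _ (tlift b)); last exact: linearP.
by apply: eq_sw => u v; rewrite tlift_tens.
Qed.

Definition antipode2 (x : H) : H := S (S x).
Local Notation S2 := antipode2.

Lemma antipode2_is_linear : linear S2.
Proof. by rewrite /S2; lin. Qed.

HB.instance Definition _ :=
  GRing.isLinear.Build k H H *:%R antipode2 antipode2_is_linear.

Lemma antipode2M x y : S2 (x * y) = S2 x * S2 y.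
Proof. by rewrite /S2 !antipodeM. Qed.

Lemma antipode21 : S2 1 = 1.
Proof. by rewrite /S2 !antipode1. Qed.

Lemma counit_antipode2 x : counit (S2 x) = counit x.
Proof. by rewrite /S2 !counit_antipode. Qed.

Lemma sw_antipode2 (V : vectType k) x (b : H -> H -> V) : bilinear_for *:%R *:%R b ->
  \sw_(u, v <- S2 x) b u v = \sw_(u, v <- x) b (S2 u) (S2 v).
Proof.
move=> [bl br]; rewrite /S2 sw_antipode // sw_antipode //.
by split=> z a u v; rewrite /= linearP ?br ?(bl (S z)).
Qed.

End Antipode.

(** * Coordinates, convolution actions and cointegrals *)

Section Coordinates.

Variables (k : fieldType) (V : vectType k).

Definition vb (i : 'I_(dim V)) : V := r2v (delta_mx 0 i).
Definition cb (i : 'I_(dim V)) (x : V) : k^o := v2r x 0 i.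

Lemma cb_is_linear i : linear (cb i).
Proof. by move=> a x y; rewrite /cb linearP !mxE. Qed.

HB.instance Definition _ i :=
  GRing.isLinear.Build k V k^o *:%R (cb i) (cb_is_linear i).

Lemma cbZ i c x : cb i (c *: x) = (c * cb i x : k).
Proof. by rewrite /cb linearZ mxE. Qed.

Lemma vb_expand (W : lmodType k) (f : V -> W) x : linear f ->
  \sum_i (cb i x : k) *: f (vb i) = f x.
Proof.
move=> lf; pose F : {linear V -> W} := HB.pack f (GRing.isLinear.Build k _ _ _ _ lf).
rewrite -[RHS]/(F x) -[in RHS](v2rK x) (row_sum_delta (v2r x)) !linear_sum.
by apply: eq_bigr => i _; rewrite !linearZ.
Qed.

Lemma cb_inj x y : (forall i, cb i x = cb i y) -> x = y.
Proof.
by move=> e; rewrite -(vb_expand x (@lin_id k V)) -(vb_expand y (@lin_id k V));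
  apply: eq_bigr => i _; rewrite e.
Qed.

Definition emx (f : V -> V) : 'M[k]_(dim V) := \matrix_i v2r (f (vb i)).

Lemma emxE f x : linear f -> v2r (f x) = v2r x *m emx f.
Proof.
move=> lf; rewrite -(vb_expand x lf) linear_sum mulmx_sum_row.
by apply: eq_bigr => i _; rewrite linearZ rowK.
Qed.

Lemma emx_comp (f g : V -> V) : linear f -> emx (f \o g) = emx g *m emx f.
Proof. by move=> lf; apply/row_matrixP => i; rewrite row_mul !rowK /= emxE. Qed.

Lemma emx_id : emx id = 1%:M.
Proof. by apply/row_matrixP => i; rewrite rowK r2vK rowE mulmx1. Qed.

Lemma eq_emx f g : f =1 g -> emx f = emx g.
Proof. by move=> e; apply/matrixP => i j; rewrite !mxE e. Qed.

Lemma linear_cancel (f g : V -> V) : linear f -> linear g -> cancel g f -> cancel f g.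
Proof.
move=> lf lg gK x; apply: (can_inj v2rK).
have e : emx g *m emx f = 1%:M.
  by rewrite -emx_comp // -emx_id; apply: eq_emx => y /=; rewrite gK.
by rewrite emxE // emxE // -mulmxA (mulmx1C e) mulmx1.
Qed.

Section Form.

Variable b : V -> V -> k^o.
Hypothesis lb : bilinear_for *:%R *:%R b.
Hypothesis nd : forall y, (forall x, b x y = 0) -> y = 0.

(** The Gram matrix. A trivial right radical makes it invertible, which yields the triviality of the
    left radical and the representability of functionals on both sides. *)
Let G : 'M[k]_(dim V) := \matrix_(i, j) b (vb i) (vb j).

Let bE x y : b x y = (v2r x *m G *m (v2r y)^T) 0 0.
Proof.
have [bl br] := lb; rewrite -(vb_expand x (bl y)) -mulmxA mxE.
apply: eq_bigr => i _; congr (_ * _); rewrite -(vb_expand y (br (vb i))) mxE.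
by apply: eq_bigr => j _; rewrite !mxE mulrC.
Qed.

Let Gu : G \in unitmx.
Proof.
rewrite -unitmx_tr -row_free_unit -kermx_eq0; apply/eqP/row_matrixP => i.
rewrite row0 -[LHS](@r2vK k V) (_ : r2v _ = 0) ?linear0 //; apply: nd => x.
have z : row i (kermx G^T) *m G^T = 0 by apply/sub_kermxP; apply: row_sub.
have z2 : G *m (row i (kermx G^T))^T = 0.
  by apply: trmx_inj; rewrite trmx_mul trmxK z trmx0.
by rewrite bE r2vK -mulmxA z2 mulmx0 mxE.
Qed.

Lemma form_nondegl x : (forall y, b x y = 0) -> x = 0.
Proof.
move=> e; apply: (can_inj v2rK); rewrite linear0.
rewrite -[LHS](mulmxK Gu) (_ : _ *m G = 0) ?mul0mx //.
apply/rowP => j; have := e (vb j); rewrite bE r2vK trmx_delta -colE [LHS]mxE => ->.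
by rewrite mxE.
Qed.

Lemma form_repr (f : V -> k^o) : linear f -> exists y, forall x, f x = b x y.
Proof.
move=> lf; pose F : 'cV[k]_(dim V) := \col_i f (vb i).
exists (r2v (invmx G *m F)^T) => x; rewrite bE r2vK trmxK -mulmxA mulKVmx //.
by rewrite mxE -(vb_expand x lf); apply: eq_bigr => i _; rewrite mxE.
Qed.

Lemma form_reprl (f : V -> k^o) : linear f -> exists x, forall y, f y = b x y.
Proof.
move=> lf; pose F : 'rV[k]_(dim V) := \row_i f (vb i).
exists (r2v (F *m invmx G)) => y; rewrite bE r2vK mulmxKV //.
rewrite mxE -(vb_expand y lf); apply: eq_bigr => i _; rewrite !mxE.
exact: mulrC.
Qed.

End Form.

End Coordinates.

(** * Cointegrals and the Frobenius form they define *)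

Section Integrals.

Variables (k : fieldType) (H : hopfAlgType k).
Implicit Types x y : H.
Local Notation S := (@antipode k H).
Local Notation S2 := (@antipode2 k H).
Local Notation eps x := (@counit k H x : k).

(* The actions f -> x and x <- f of the dual algebra. *)
Definition hitl (f : H -> k^o) x : H := \sw_(a, b <- x) ((f b : k) *: a).
Definition hitr (f : H -> k^o) x : H := \sw_(a, b <- x) ((f a : k) *: b).

Lemma hitl_is_linear f : linear (hitl f).
Proof. by rewrite /hitl; lin. Qed.

Lemma hitr_is_linear f : linear (hitr f).
Proof. by rewrite /hitr; lin. Qed.

HB.instance Definition _ f := GRing.isLinear.Build k H H *:%R (hitl f) (hitl_is_linear f).
HB.instance Definition _ f := GRing.isLinear.Build k H H *:%R (hitr f) (hitr_is_linear f).

Lemma sw_hitl (W : vectType k) (f : {linear H -> k^o}) x (b : H -> H -> W) :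
  bilinear_for *:%R *:%R b ->
  \sw_(u, v <- hitl f x) b u v = \sw_(u, v <- x) b u (hitl f v).
Proof.
move=> [bl br]; rewrite {1}/hitl (@linear_tlift _ _ _ _ _ (fun z => \sw_(u, v <- z) b u v)); last by lin.
transitivity (\sw_(a, c <- x) \sw_(u, v <- a) ((f c : k) *: b u v)).
  by apply: eq_sw => a c; rewrite tliftZ !linearZ.
rewrite sw_coassoc; apply: eq_sw => a c.
rewrite (@linear_tlift _ _ _ _ _ (b a)) //.
by apply: eq_sw => d e; rewrite linZ.
Qed.

Lemma sw_hitr (W : vectType k) (f : {linear H -> k^o}) x (b : H -> H -> W) :
  bilinear_for *:%R *:%R b ->
  \sw_(u, v <- hitr f x) b u v = \sw_(u, v <- x) b (hitr f u) v.
Proof.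
move=> [bl br]; rewrite {1}/hitr (@linear_tlift _ _ _ _ _ (fun z => \sw_(u, v <- z) b u v)); last by lin.
transitivity (\sw_(a, c <- x) \sw_(u, v <- c) ((f a : k) *: b u v)).
  by apply: eq_sw => a c; rewrite tliftZ !linearZ.
rewrite -sw_coassoc; apply: eq_sw => a c.
rewrite (@linear_tlift _ _ _ _ _ (b ^~ c)) //.
by apply: eq_sw => d e; rewrite (linZ (bl c)).
Qed.

Lemma hitr_counit x : hitr counit x = x. Proof. exact: counit_comull. Qed.

Lemma counit_hitl (f : {linear H -> k^o}) x : counit (hitl f x) = f x.
Proof.
rewrite /hitl (linear_tlift _ _ (linearP _)) -[RHS](sw_counitl x (linearP f)).
by apply: eq_sw => a b; rewrite linearZ; apply: mulrC.
Qed.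

Lemma counit_hitr (f : {linear H -> k^o}) x : counit (hitr f x) = f x.
Proof.
rewrite /hitr (linear_tlift _ _ (linearP _)) -[RHS](sw_counitr x (linearP f)).
by apply: eq_sw => a b; rewrite linearZ; apply: mulrC.
Qed.

Definition left_cointegral (l : H -> k^o) := forall x, hitl l x = (l x : k) *: 1.

(* The trace of y |-> f -> (x S^2 y): a left cointegral for every f. *)
Definition trace_cointegral (f : {linear H -> k^o}) (x : H) : k^o :=
  \sum_i cb i (hitl f (x * S2 (vb i))).

Lemma trace_cointegral_is_linear f : linear (trace_cointegral f).
Proof. by apply: lin_sum => i; lin. Qed.

HB.instance Definition _ f :=
  GRing.isLinear.Build k H k^o *:%R (trace_cointegral f) (trace_cointegral_is_linear f).

(** Since [S] reverses the coproduct, the right side is x1 S(y2) y3 f(x2 S(y1)), where S(y2) y3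
    collapses to a counit. *)
Lemma hitl_mulS (f : {linear H -> k^o}) x y :
  hitl (fun z => f (z * S y)) x = \sw_(a, b <- y) (hitl f (x * S a) * b).
Proof.
transitivity (\sw_(u, v <- x) \sw_(a, b <- y) \sw_(c, d <- b) ((f (v * S a) : k) *: (u * (S c * d)))).
  apply: eq_sw => u v.
  rewrite -[LHS](@sw_counitr _ _ _ y (fun z => (f (v * S z) : k) *: u)); last by lin.
  apply: eq_sw => a b.
  rewrite (@sw_antipodel _ _ _ b (fun z => (f (v * S a) : k) *: (u * z))) ?mulr1 //; by lin.
rewrite tlift_exchange.
under eq_sw => a b do rewrite tlift_exchange.
rewrite -sw_coassoc; apply: eq_sw => a b.
rewrite /hitl -tliftMr sw_mul; last by bilin.
rewrite tlift_exchange; apply: eq_sw => u v.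
rewrite sw_antipode; last by bilin.
by apply: eq_sw => c d; rewrite -scalerAl mulrA.
Qed.

(** [hitl_mulS] at S v_i brings in the coproduct of v_i. After the trace is moved to another basis
    index, the surviving product is u S(v1) for adjacent legs u, v1 of one coproduct, so it reduces
    to a scalar. *)
Lemma trace_cointegralP f : left_cointegral (trace_cointegral f).
Proof.
move=> x.
transitivity (\sum_i hitl (fun z => cb i (hitl f (z * S2 (vb i)))) x).
  rewrite /hitl -tlift_sum; apply: eq_sw => a b.
  by rewrite /trace_cointegral scaler_suml.
transitivity (\sum_i \sw_(c, d <- vb i) (hitl (fun z => cb i (hitl f z)) (x * S2 d) * S c)).
  apply: eq_bigr => i _; rewrite (@hitl_mulS (cb i \o hitl f)).
  by rewrite sw_antipode //; bilin.
(* Expanding [d] in the basis [vb m] creates the new trace index; summing over [i] then contracts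
   [vb i] with the coordinates of [hitl f v]. *)
transitivity (\sum_m \sw_(u, v <- x * S2 (vb m))
   \sw_(c, d <- hitl f v) ((cb m d : k) *: (u * S c))).
  under eq_bigr => i _.
    under eq_sw => c d.
      rewrite -(@vb_expand _ _ _ (fun d => hitl (fun z => cb i (hitl f z)) (x * S2 d) * S c)); last by lin.
      over.
    rewrite tlift_sum.
    over.
  rewrite exchange_big; apply: eq_bigr => m _ /=.
  transitivity (\sum_i \sw_(u, v <- x * S2 (vb m))
    ((cb i (hitl f v) : k) *: \sw_(c, d <- vb i) ((cb m d : k) *: (u * S c)))).
    apply: eq_bigr => i _.
    under [RHS]eq_sw => u v do rewrite -tliftZ.
    rewrite tlift_exchange; apply: eq_sw => c d.
    rewrite /hitl -tliftMr -tliftZ; apply: eq_sw => u v.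
    by rewrite -scalerAl !scalerA mulrC.
  rewrite -tlift_sum; apply: eq_sw => u v.
  by rewrite (@vb_expand _ _ _ (fun z => \sw_(c, d <- z) ((cb m d : k) *: (u * S c)))) //; lin.
rewrite /trace_cointegral scaler_suml; apply: eq_bigr => m _.
under eq_sw => u v.
  rewrite sw_hitl; last by bilin.
  over.
rewrite -sw_coassoc.
under eq_sw => u v.
  under eq_sw => c d do rewrite -[X in X *: _]/(((cb m \o hitl f) v : k)).
  rewrite tliftZ (@sw_antipoder _ _ _ u (fun z => z)) ?mulr1; last by lin.
  over.
rewrite -[RHS](@sw_counitl _ _ _ _ (fun z => (cb m (hitl f z) : k) *: (1 : H))); last by lin.
by apply: eq_sw => u v; rewrite !scalerA mulrC.
Qed.

(** If all trace cointegrals vanished, so would the sum of [trace_cointegral (cb i)] at [S (vb i)].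
    The dual bases in that sum contract to the m-th coordinates of S(S(u) v), for u, v the legs of
    v_m, and by the antipode axiom the total is counit 1 = 1. *)
Lemma left_cointegral_exists :
  exists l : {linear H -> k^o}, left_cointegral l /\ exists x, l x != 0.
Proof.
have [/forallP z|] := boolP [forall i, [forall j, trace_cointegral (cb i) (vb j) == 0]]; last first.
  rewrite negb_forall => /existsP[i]; rewrite negb_forall => /existsP[j nz].
  by exists (trace_cointegral (cb i)); split; [apply: trace_cointegralP | exists (vb j)].
suff: (counit (1 : H) : k) = 0 by rewrite counit1 => /eqP; rewrite oner_eq0.
have z' i x : trace_cointegral (cb i) x = 0.
  rewrite -(vb_expand x (linearP _)) big1 // => j _.
  by have /forallP/(_ j)/eqP e := z i; rewrite /= e scaler0.
transitivity (\sum_i trace_cointegral (cb i) (S (vb i))); last by rewrite big1.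
under [RHS]eq_bigr => i _.
  rewrite /trace_cointegral.
  under eq_bigr => j _ do rewrite -antipodeM.
  over.
transitivity (\sum_m \sw_(u, v <- vb m) cb m (S (S u * v))).
  transitivity (\sum_(m < dim H) (eps (vb m) *: cb m (1 : H))).
    by rewrite -(vb_expand (1 : H) (linearP counit)); apply: eq_bigr => m _; apply: mulrC.
  apply: eq_bigr => m _.
  rewrite (@sw_antipodel _ _ _ (vb m) (fun z => cb m (S z))); last by lin.
  by rewrite antipode1.
symmetry.
transitivity (\sum_i \sum_j \sum_m (cb m (S (S (vb j) * vb i)) : k) *: cb j (hitl (cb i) (vb m))).
  apply: eq_bigr => i _; apply: eq_bigr => j _.
  by rewrite (@vb_expand _ _ _ (fun z => cb j (hitl (cb i) z))) //; lin.
under eq_bigr do rewrite exchange_big.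
rewrite exchange_big; apply: eq_bigr => m _ /=.
transitivity (\sum_i \sum_j \sw_(u, v <- vb m)
   ((cb i v : k) *: ((cb j u : k) *: cb m (S (S (vb j) * vb i))))).
  apply: eq_bigr => i _; apply: eq_bigr => j _.
  rewrite /hitl (linear_tlift _ _ (linearP _)) -tliftZ.
  apply: (@eq_sw k H H k^o) => u v.
  by rewrite linearZ /= !scaleRE mulrC mulrA.
under eq_bigr do rewrite -tlift_sum.
rewrite -tlift_sum; apply: (@eq_sw k H H k^o) => u v.
under eq_bigr => i _.
  under eq_bigr => j _ do rewrite scalerA mulrC -scalerA.
  rewrite (@vb_expand _ _ _ (fun z => (cb i v : k) *: cb m (S (S z * vb i)))); last by lin.
  over.
by rewrite (@vb_expand _ _ _ (fun z => cb m (S (S u * z)))) //; lin.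
Qed.

Section Cointegral.

Variable l : {linear H -> k^o}.
Hypothesis lP : left_cointegral l.

(** Replacing y1 by S(x1) x2 y1 produces x2 y1 l(x3 y2), which is [hitl l] of a product and hence a
    scalar. *)
Lemma cointegral_shift x y :
  \sw_(a, b <- x) ((l (b * y) : k) *: S a) = \sw_(c, d <- y) ((l (x * d) : k) *: c).
Proof.
symmetry.
transitivity (\sw_(c, d <- y) \sw_(a, b <- x) \sw_(b1, b2 <- b)
  ((l (b2 * d) : k) *: (S a * (b1 * c)))).
  apply: eq_sw => c d; rewrite -sw_coassoc.
  rewrite -[LHS](@sw_counitl _ _ _ x (fun z => (l (z * d) : k) *: c)); last by lin.
  apply: eq_sw => a b.
  rewrite -[c in LHS]mul1r -(@sw_antipodel _ _ _ a (fun z => (l (b * d) : k) *: (z * c))); last by lin.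
  by apply: eq_sw => a1 a2; rewrite mulrA.
rewrite tlift_exchange; apply: eq_sw => a b.
transitivity (S a * hitl l (b * y)); last by rewrite lP -scalerAr mulr1.
rewrite /hitl sw_mul; last by bilin.
rewrite tlift_exchange -tliftMl; apply: eq_sw => c d.
by rewrite -tliftMl; apply: eq_sw => b1 b2; rewrite scalerAr.
Qed.

Hypothesis l_neq0 : exists x, l x != 0.

(* The counit vanishes on the radical of the form l (x y), which is stable under
   every [hitr f]; and counit (hitr f y) = f y. *)
Lemma cointegral_nondeg y : (forall x, l (x * y) = 0) -> y = 0.
Proof.
have vanish z : (forall x, l (x * z) = 0) -> forall x, \sw_(c, d <- z) ((l (x * d) : k) *: c) = 0.
  move=> z0 x; rewrite -cointegral_shift.
  rewrite (@eq_sw _ _ _ _ _ (fun a b => 0 *: S a)) ?tliftZ ?scale0r // => a b.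
  by rewrite z0.
have eps0 z : (forall x, l (x * z) = 0) -> counit z = 0.
  (* The product of counit z and l x is l (x S(z1) z2); expanding z1 in the basis makes each term a
     coordinate of a vector that [vanish] kills. *)
  move=> z0; have [x nx] := l_neq0.
  have /eqP : (counit z : k) *: l x = 0.
    rewrite -[x]mulr1 -(@sw_antipodel _ _ _ z (fun w => l (x * w))); last by lin.
    under eq_sw => c d.
      rewrite -(@vb_expand _ _ _ (fun c => l (x * (S c * d)))); last by lin.
      over.
    rewrite tlift_sum big1 // => j _.
    have := congr1 (cb j) (vanish z z0 (x * S (vb j))).
    rewrite linear0 (linear_tlift _ _ (linearP _)) => e; rewrite -[RHS]e.
    by apply: (@eq_sw k H H k^o) => c d; rewrite linearZ /= !scaleRE mulrA mulrC.
  by rewrite scaler_eq0 (negPf nx) orbF => /eqP.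
move=> y0; apply: cb_inj => j; rewrite linear0.
rewrite -counit_hitr; apply: eps0 => x.
have := congr1 (cb j) (vanish y y0 x); rewrite linear0 => e; rewrite -[RHS]e.
rewrite /hitr -tliftMl !(linear_tlift _ _ (linearP _)).
by apply: (@eq_sw k H H k^o) => c d; rewrite -scalerAr !linearZ /= !scaleRE mulrC.
Qed.

Lemma cointegral_bilinear : bilinear_for *:%R *:%R (fun x y => l (x * y)).
Proof. by bilin. Qed.

Lemma cointegral_nondegl x : (forall y, l (x * y) = 0) -> x = 0.
Proof. exact: (form_nondegl cointegral_bilinear cointegral_nondeg). Qed.

Lemma cointegral_left_integral : exists L, forall x, l (x * L) = counit x.
Proof.
have [L LP] := form_repr cointegral_bilinear cointegral_nondeg (linearP (@counit k H)).
by exists L => x; rewrite LP.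
Qed.

Lemma cointegral_right_integral : exists t, forall x, l (t * x) = counit x.
Proof.
have [t tP] := form_reprl cointegral_bilinear cointegral_nondeg (linearP (@counit k H)).
by exists t => x; rewrite tP.
Qed.

(** Writing f = l(- a), the shift formula gives a1 l(x a2) = f(x) 1. For x = t with l(t -) the
    counit, the left side is a itself, so a is a scalar. *)
Lemma cointegral_uniq (f : {linear H -> k^o}) : left_cointegral f ->
  exists c : k, forall x, f x = c *: l x.
Proof.
move=> fP.
have [a aP] := form_repr cointegral_bilinear cointegral_nondeg (linearP f).
suff ea : a = (counit a : k) *: 1.
  by exists (counit a) => x; rewrite aP {1}ea -scalerAr mulr1 linearZ.
have H1 x : \sw_(c, d <- a) ((l (x * d) : k) *: c) = (l (x * a) : k) *: 1.
  rewrite -cointegral_shift -aP.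
  transitivity (S (hitl f x)); last by rewrite fP linearZ /= antipode1.
  rewrite /hitl (linear_tlift _ _ (linearP _)); apply: eq_sw => u v.
  by rewrite linearZ /= aP.
have [t tP] := cointegral_right_integral.
have := H1 t; rewrite -tP => <-.
by rewrite -[LHS](counit_comulr a); apply: eq_sw => c d; rewrite tP.
Qed.

Lemma left_integralP L : (forall x, l (x * L) = counit x) ->
  forall h, h * L = (counit h : k) *: L.
Proof.
move=> LP h; apply/eqP; rewrite -subr_eq0; apply/eqP; apply: cointegral_nondeg => x.
by rewrite mulrBr linearB mulrA LP -scalerAr linearZ /= LP counitM mulrC subrr.
Qed.

(** This expresses [S] by [l] and the coproduct of [L]; the traces of S^2 are computed from it. *)
Lemma sw_left_integral L x : (forall x, l (x * L) = counit x) ->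
  \sw_(a, b <- L) ((l (x * b) : k) *: a) = S x.
Proof.
move=> LP; rewrite -cointegral_shift.
rewrite -[RHS](@sw_counitr _ _ _ x S); last by lin.
by apply: eq_sw => a b; rewrite LP.
Qed.

End Cointegral.
End Integrals.

(** * Grouplike elements and characters *)

Section Grouplike.

Variables (k : fieldType) (H : hopfAlgType k).
Implicit Types x y : H.
Local Notation S := (@antipode k H).
Local Notation S2 := (@antipode2 k H).

Definition grouplike (g : H) := comul g = tens g g /\ counit g = 1.
Definition character (f : H -> k^o) :=
  (forall x y, f (x * y) = (f x : k) * f y) /\ f 1 = 1.

Lemma grouplike1 : grouplike 1.
Proof. by split; rewrite ?comul1 ?counit1. Qed.

Lemma sw_grouplike (V : vectType k) g (b : H -> H -> V) : grouplike g ->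
  bilinear_for *:%R *:%R b -> \sw_(u, v <- g) b u v = b g g.
Proof. by move=> [cg _] bb; rewrite cg tlift_tens. Qed.

Lemma grouplikeSl g : grouplike g -> S g * g = 1.
Proof.
move=> gg; have := antipodel g; rewrite sw_grouplike ?gg.2 ?scale1r //; bilin.
Qed.

Lemma grouplikeSr g : grouplike g -> g * S g = 1.
Proof.
move=> gg; have := antipoder g; rewrite sw_grouplike ?gg.2 ?scale1r //; bilin.
Qed.

Lemma grouplikeM g h : grouplike g -> grouplike h -> grouplike (g * h).
Proof.
move=> [cg eg] [ch eh]; split; first by rewrite comulM cg ch tmul_tens.
by rewrite counitM eg eh mulr1.
Qed.

Lemma grouplikeX g n : grouplike g -> grouplike (g ^+ n).
Proof.
move=> gg; elim: n => [|n IH]; first exact: grouplike1.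
by rewrite exprS; apply: grouplikeM.
Qed.

Lemma antipode2_grouplike g : grouplike g -> S2 g = g.
Proof.
move=> gg; rewrite -[LHS]mul1r -(grouplikeSr gg) -mulrA.
by rewrite -antipodeM grouplikeSl // antipode1 mulr1.
Qed.

Lemma hitl_grouplike (f : {linear H -> k^o}) g : grouplike g ->
  hitl f g = (f g : k) *: g.
Proof. by move=> gg; rewrite /hitl sw_grouplike //; bilin. Qed.

Lemma hitr_grouplike (f : {linear H -> k^o}) g : grouplike g ->
  hitr f g = (f g : k) *: g.
Proof. by move=> gg; rewrite /hitr sw_grouplike //; bilin. Qed.

Lemma hitlr (f f' : {linear H -> k^o}) x : hitl f (hitr f' x) = hitr f' (hitl f x).
Proof.
rewrite {1}/hitl {2}/hitr sw_hitr; last by bilin.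
rewrite sw_hitl; last by bilin.
transitivity (\sw_(a, b <- x) \sw_(c, d <- a) ((f' c : k) *: ((f b : k) *: d))).
  by apply: eq_sw => a b; rewrite /hitr -tliftZ; apply: eq_sw => c d; rewrite !scalerA mulrC.
rewrite sw_coassoc; apply: eq_sw => a b.
by rewrite /hitl -tliftZ.
Qed.

Section Character.

Variable f : {linear H -> k^o}.
Hypothesis fP : character f.

Lemma hitlM x y : hitl f (x * y) = hitl f x * hitl f y.
Proof.
rewrite {1}/hitl sw_mul; last by bilin.
rewrite {2}/hitl -tliftMr; apply: eq_sw => a b.
rewrite -tliftMl; apply: eq_sw => c d.
by rewrite fP.1 -scalerAl -scalerAr scalerA.
Qed.

Lemma hitrM x y : hitr f (x * y) = hitr f x * hitr f y.
Proof.
rewrite {1}/hitr sw_mul; last by bilin.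
rewrite {2}/hitr -tliftMr; apply: eq_sw => a b.
rewrite -tliftMl; apply: eq_sw => c d.
by rewrite fP.1 -scalerAl -scalerAr scalerA.
Qed.

Lemma hitl1 : hitl f 1 = 1.
Proof. by rewrite hitl_grouplike ?fP.2 ?scale1r //; apply: grouplike1. Qed.

(** The inverse of [f] under convolution, by [sw_charS] and [sw_charSl]. *)
Definition charS (x : H) : k^o := f (S x).

Lemma charS_is_linear : linear charS.
Proof. by rewrite /charS; lin. Qed.

HB.instance Definition _ := GRing.isLinear.Build k H k^o *:%R charS charS_is_linear.

Lemma character_charS : character charS.
Proof.
by split=> [x y|]; rewrite /charS ?antipodeM ?antipode1 ?fP.1 ?fP.2 // mulrC.
Qed.

Lemma sw_charS x : \sw_(a, b <- x) ((f a : k) *: f (S b)) = counit x.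
Proof.
have := congr1 f (antipoder x); rewrite (linear_tlift _ _ (linearP _)) linearZ /= fP.2.
by rewrite scaleRE mulr1 => <-; apply: (@eq_sw k H H k^o) => a b; rewrite fP.1.
Qed.

Lemma sw_charSl x : \sw_(a, b <- x) ((f (S a) : k) *: f b) = counit x.
Proof.
have := congr1 f (antipodel x); rewrite (linear_tlift _ _ (linearP _)) linearZ /= fP.2.
by rewrite scaleRE mulr1 => <-; apply: (@eq_sw k H H k^o) => a b; rewrite fP.1.
Qed.

(** [f] and its composite with S^2 are both convolution inverses of [charS]. *)
Lemma charSS x : f (S2 x) = f x.
Proof.
transitivity (\sw_(a, b <- x) \sw_(c, d <- b) ((f a : k) *: ((f (S c) : k) *: f (S2 d)))).
  rewrite -sw_coassoc.
  rewrite -[LHS](@sw_counitl _ _ _ x (fun z => f (S2 z))); last by lin.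
  apply: (@eq_sw k H H k^o) => a b.
  rewrite -sw_charS -[LHS]tliftZr; apply: (@eq_sw k H H k^o) => c d.
  by rewrite !scaleRE mulrA.
rewrite -[RHS](@sw_counitr _ _ _ x f (linearP _)).
apply: (@eq_sw k H H k^o) => a b; rewrite [LHS]tliftZ [RHS]scaleRE mulrC.
congr (_ * _).
have := counit_antipode b; rewrite -sw_charSl sw_antipode; last by bilin.
move=> <-; apply: (@eq_sw k H H k^o) => c d; exact: mulrC.
Qed.

Lemma hitl_antipode2 x : hitl f (S2 x) = S2 (hitl f x).
Proof.
rewrite /hitl sw_antipode2; last by bilin.
rewrite (linear_tlift _ _ (linearP _)); apply: eq_sw => a b.
by rewrite linearZ charSS.
Qed.

Lemma hitr_antipode2 x : hitr f (S2 x) = S2 (hitr f x).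
Proof.
rewrite /hitr sw_antipode2; last by bilin.
rewrite (linear_tlift _ _ (linearP _)); apply: eq_sw => a b.
by rewrite linearZ charSS.
Qed.

Lemma antipode_hitl x : S (hitl f x) = hitr charS (S x).
Proof.
rewrite /hitr sw_antipode; last by bilin.
rewrite (linear_tlift _ _ (linearP _)); apply: eq_sw => a b.
by rewrite linearZ /charS -/(S2 _) charSS.
Qed.

Lemma antipode_hitr_charS x : S (hitr charS x) = hitl f (S x).
Proof.
rewrite /hitl sw_antipode; last by bilin.
by rewrite (linear_tlift _ _ (linearP _)); apply: eq_sw => a b; rewrite linearZ.
Qed.

Lemma hitr_charSK x : hitr f (hitr charS x) = x.
Proof.
rewrite {1}/hitr sw_hitr; last by bilin.
rewrite -[RHS](@sw_counitl _ _ _ x idfun (linearP _)); apply: eq_sw => a b.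
congr (_ *: _); rewrite -(sw_charSl a) /hitr (linear_tlift _ _ (linearP _)).
by apply: (@eq_sw k H H k^o) => c d; rewrite linearZ.
Qed.

End Character.

End Grouplike.

(** * Radford's formula for the fourth power of the antipode *)

Section Radford.

Variables (k : fieldType) (H : hopfAlgType k).
Implicit Types x y h : H.
Local Notation S := (@antipode k H).
Local Notation S2 := (@antipode2 k H).
Local Notation eps x := (@counit k H x : k).

Variable l : {linear H -> k^o}.
Hypothesis lP : left_cointegral l.
Hypothesis l_neq0 : exists x, l x != 0.
Variable t : H.
Hypothesis tP : forall x, l (t * x) = counit x.

Let nd := cointegral_nondeg lP l_neq0.
Let ndl := cointegral_nondegl lP l_neq0.

Lemma cointegral_integral : l t = 1.
Proof. by rewrite -[t]mulr1 tP counit1. Qed.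

Lemma right_integralP h : t * h = eps h *: t.
Proof.
apply/eqP; rewrite -subr_eq0; apply/eqP; apply: ndl => x.
by rewrite mulrBl linearB /= -mulrA tP -scalerAl linearZ /= tP counitM subrr.
Qed.

Lemma sw_right_integral y : \sw_(a, b <- t) ((l (b * y) : k) *: S a) = y.
Proof.
rewrite cointegral_shift //.
rewrite -[RHS](@sw_counitr _ _ _ y idfun (linearP _)); apply: eq_sw => a b.
by rewrite tP.
Qed.

Lemma sw_right_integral_dual x : \sw_(a, b <- t) ((l (x * S a) : k) *: b) = x.
Proof.
apply/eqP; rewrite -subr_eq0; apply/eqP; apply: ndl => y.
rewrite mulrBl linearB /=; apply/eqP; rewrite subr_eq0; apply/eqP.
rewrite -[y in RHS]sw_right_integral -tliftMl -tliftMr !(linear_tlift _ _ (linearP _)).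
apply: (@eq_sw k H H k^o) => a b.
by rewrite -scalerAl -scalerAr !linearZ /= !scaleRE mulrC.
Qed.

(** [sw_right_integral] exhibits a right inverse of [S]; finite dimension makes it two-sided. *)
Lemma antipode_inverse : exists T : H -> H, [/\ linear T, cancel S T & cancel T S].
Proof.
exists (fun y => \sw_(a, b <- t) ((l (b * y) : k) *: a)).
set f := fun y => _; have lf : linear f by rewrite /f; lin.
have Sf : cancel f S.
  move=> y; rewrite /f (linear_tlift _ _ (linearP _)) -[RHS]sw_right_integral.
  by apply: eq_sw => a b; rewrite linearZ.
by split=> //; apply: linear_cancel (linearP _) lf Sf.
Qed.

Lemma antipode_inj : injective S.
Proof. by have [T [_ ST _]] := antipode_inverse; apply: can_inj ST. Qed.

Lemma antipode_surj y : exists x, y = S x.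
Proof. by have [T [_ _ TS]] := antipode_inverse; exists (T y). Qed.

(* The distinguished grouplike element; t is a right integral with l t = 1. *)
Definition dgrp : H := hitr l t.
Local Notation g := dgrp.

(** Each coordinate of [hitr l] is a left cointegral, hence a multiple of [l]; the multiple is found
    at [t], where l t = 1. *)
Lemma hitr_cointegral x : hitr l x = (l x : k) *: g.
Proof.
apply: cb_inj => j; rewrite linearZ.
pose f := (cb j \o hitr l) : {linear H -> k^o}.
suff fP : left_cointegral f.
  have [c cP] := cointegral_uniq lP l_neq0 fP.
  change (f x = (l x : k) *: f t).
  by rewrite !cP cointegral_integral !scaleRE mulr1 mulrC.
move=> z; rewrite /hitl.
transitivity (\sw_(u, v <- z) \sw_(v1, v2 <- v) ((cb j v2 : k) *: ((l v1 : k) *: u))).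
  apply: eq_sw => u v; rewrite /f /= /hitr (linear_tlift _ _ (linearP _)).
  rewrite -tliftZr; apply: eq_sw => v1 v2.
  by rewrite linearZ !scalerA mulrC.
rewrite -sw_coassoc.
transitivity (\sw_(a, b <- z) ((cb j b : k) *: ((l a : k) *: (1 : H)))).
  by apply: eq_sw => a b; rewrite tliftZ -lP.
rewrite /f /= /hitr (linear_tlift _ _ (linearP _)) -tliftZr.
by apply: eq_sw => a b; rewrite /= cbZ scalerA mulrC.
Qed.

Lemma dgrpP : grouplike g.
Proof.
split.
  have := congr1 comul (hitr_cointegral t); rewrite cointegral_integral scale1r => <-.
  rewrite -(tlift_id (comul (hitr l t))) sw_hitr; last exact: tens_bilinear.
  transitivity (\sw_(a, b <- t) ((l a : k) *: tens g b)).
    by apply: eq_sw => a b; rewrite hitr_cointegral; apply: tensZl.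
  rewrite {3}/dgrp /hitr (linear_tlift _ _ (@lin_tens _ H H g)).
  by apply: eq_sw => a b; symmetry; apply: tensZr.
by rewrite counit_hitr cointegral_integral.
Qed.

Let gg := dgrpP.

(** z |-> l(g S z) is a left cointegral because l(x1) x2 = l(x) g. Its ratio to [l] is found by
    expanding [g] with [sw_right_integral_dual]. *)
Lemma cointegral_antipode z : l (g * S z) = l z.
Proof.
have lf : linear (fun x => l (g * S x)) by lin.
pose f := linpack lf.
have fP : left_cointegral f.
  move=> x; apply: antipode_inj; rewrite linearZ /= antipode1.
  transitivity (\sw_(a, b <- S x) ((l (g * a) : k) *: b)).
    rewrite sw_antipode; last by bilin.
    by rewrite /hitl (linear_tlift _ _ (linearP _)); apply: eq_sw => a b; rewrite linearZ.
  have := congr1 ( *%R (S g)) (hitr_cointegral (g * S x)).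
  rewrite -scalerAr grouplikeSl // => <-.
  rewrite /hitr sw_mul; last by bilin.
  rewrite (sw_grouplike gg); last by bilin.
  rewrite -tliftMl; apply: eq_sw => a b.
  by rewrite -scalerAr mulrA grouplikeSl // mul1r.
have [c cP] := cointegral_uniq lP l_neq0 fP.
suff c1 : c = 1 by rewrite -[LHS]/(f z) cP c1 scale1r.
have e : c *: g = g.
  rewrite -[RHS]sw_right_integral_dual {1}/dgrp {1}/hitr -tliftZ; apply: eq_sw => a b.
  by rewrite scalerA -[l (_ * _)]/(f a) cP.
by have := congr1 counit e; rewrite linearZ /= gg.2 scaleRE mulr1.
Qed.

(* The modular character: h t = dchar h *: t. *)
Definition dchar (h : H) : k^o := l (h * t).
Local Notation al := dchar.

Lemma dchar_is_linear : linear dchar.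
Proof. by rewrite /dchar; lin. Qed.

HB.instance Definition _ := GRing.isLinear.Build k H k^o *:%R dchar dchar_is_linear.

Lemma mul_right_integral h : h * t = (al h : k) *: t.
Proof.
apply/eqP; rewrite -subr_eq0; apply/eqP; apply: ndl => x.
rewrite mulrBl linearB /= -mulrA right_integralP -scalerAr linearZ.
by rewrite -scalerAl linearZ /= tP /al !scaleRE mulrC subrr.
Qed.

Lemma dcharP : character al.
Proof.
split; last by rewrite /al mul1r cointegral_integral.
by move=> x y; rewrite {1}/al -mulrA mul_right_integral -scalerAr linearZ /= scaleRE mulrC.
Qed.

(* The Nakayama automorphism of the Frobenius form l (x y). *)
Definition nak h : H := S2 (hitl al h).

Lemma nakM x y : nak (x * y) = nak x * nak y.
Proof. by rewrite /nak hitlM ?antipode2M //; apply: dcharP. Qed.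

Lemma nak_grouplike a : grouplike a -> nak a = (al a : k) *: a.
Proof. by move=> ga; rewrite /nak hitl_grouplike // linearZ /= antipode2_grouplike. Qed.

(** With S(h1) h2 inserted before t1, the factors h2 t1 (x) h3 t2 form the coproduct of h2 t =
    al(h2) t. This slides h across the coproduct of t, and [l] is applied to the result. *)
Lemma mul_nakayama h x : l (h * x) = l (x * nak h).
Proof.
have H1 : \sw_(a, b <- t) ((l (x * S a) : k) *: (h * b)) =
          \sw_(a, b <- t) ((l (x * (S a * nak h)) : k) *: b).
  transitivity (\sw_(u, v <- h) \sw_(v1, v2 <- v) \sw_(a, b <- t)
      ((l (x * S (S u * (v1 * a))) : k) *: (v2 * b))).
    rewrite -sw_coassoc.
    rewrite -[LHS](@sw_counitl _ _ _ h (fun z => \sw_(a, b <- t) ((l (x * S a) : k) *: (z * b)))); last by lin.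
    apply: eq_sw => u v; rewrite [RHS]tlift_exchange -tliftZ; apply: eq_sw => a b.
    rewrite -[a in LHS]mul1r.
    rewrite -(@sw_antipodel _ _ _ u (fun z => (l (x * S (z * a)) : k) *: (v * b))); last by lin.
    by apply: eq_sw => u1 u2; rewrite mulrA.
  transitivity (\sw_(u, v <- h) ((al v : k) *: \sw_(a, b <- t) ((l (x * S (S u * a)) : k) *: b))).
    apply: eq_sw => u v.
    pose G z := \sw_(a, b <- z) ((l (x * S (S u * a)) : k) *: b).
    have lG : linear G by rewrite /G; lin.
    rewrite -[X in _ = _ *: X]/(G t) -(linZ lG) -mul_right_integral /G sw_mul //; bilin.
  pose F z := \sw_(a, b <- t) ((l (x * (S a * S2 z)) : k) *: b).
  have lF : linear F by rewrite /F; lin.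
  rewrite -[RHS]/(F (hitl al h)) /hitl (linear_tlift _ _ lF); apply: eq_sw => u v.
  rewrite (linZ lF); congr (_ *: _); apply: eq_sw => a b.
  by rewrite antipodeM.
have := congr1 l H1.
rewrite (eq_sw (b' := fun a b => h * ((l (x * S a) : k) *: b))); last first.
  by move=> a b; rewrite scalerAr.
rewrite tliftMl sw_right_integral_dual => ->.
rewrite -[nak h in RHS]mul1r -[1 in RHS]sw_right_integral -tliftMr -tliftMl.
rewrite !(linear_tlift _ _ (linearP _)); apply: (@eq_sw k H H k^o) => a b.
by rewrite mulr1 -scalerAl -scalerAr !linearZ /= !scaleRE mulrC.
Qed.

Lemma cointegral_grouplike a x : grouplike a -> l (a * x) = (al a : k) *: l (x * a).
Proof. by move=> ga; rewrite mul_nakayama nak_grouplike // -scalerAr linearZ. Qed.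

Lemma cointegral_antipode2 z : (al g : k) *: l (S2 z) = l z.
Proof.
rewrite -[RHS]cointegral_antipode -[in RHS]cointegral_antipode.
rewrite antipodeM cointegral_grouplike // -mulrA grouplikeSl // mulr1.
by [].
Qed.

(** Transporting [mul_nakayama] along l(g S z) = l z computes l(g S(z) S(h)) in two ways, whence
    S(h) g = g nak(S(nak h)) by nondegeneracy. Surjectivity of [S] then allows y = S h. *)
Theorem radford_S4 y : y * g = g * S2 (S2 (hitl al (hitr (charS al) y))).
Proof.
have [h ->] := antipode_surj y.
have ag : (al g : k) != 0.
  have := dcharP.1 g (S g); rewrite grouplikeSr // dcharP.2 => e.
  by apply: contra_eq_neq e => ->; rewrite mul0r oner_neq0.
apply: (scalerI ag); apply/eqP; rewrite -subr_eq0; apply/eqP; apply: nd => x.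
have [z ->] := antipode_surj x.
rewrite mulrBr linearB /=; apply/eqP; rewrite subr_eq0; apply/eqP.
have e : l (g * (S z * S h)) = l (g * (S (nak h) * S z)).
  by rewrite -!antipodeM !cointegral_antipode mul_nakayama.
rewrite cointegral_grouplike // mulrA [RHS]mul_nakayama nakM nak_grouplike // in e.
rewrite -scalerAr linearZ /= mulrA e -scalerAl; congr (l (_ * (_ *: (_ * _)))).
have cP := dcharP.
by rewrite /nak -[S (S2 _)]/(S2 (S _)) antipode_hitl // hitl_antipode2.
Qed.

End Radford.

(** * Matrices of finite order *)

Section CharacteristicZero.

Variable k : fieldType.
Hypothesis hk : [pchar k] =i pred0.

Lemma natr_char0 n : ((n%:R : k) == 0) = (n == 0%N).
Proof. exact: (proj1 (pcharf0P k) hk). Qed.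

Lemma natr_char0_inj m n : m%:R = n%:R :> k -> m = n.
Proof.
wlog le_mn : m n / (m <= n)%N => [th e|e].
  by case/orP: (leq_total m n) => le; [apply: th | symmetry; apply: th].
apply/eqP; rewrite eqn_leq le_mn -subn_eq0 -natr_char0 natrB //.
by rewrite e subrr eqxx.
Qed.

Lemma intr_char0 (m : int) : ((m%:~R : k) == 0) = (m == 0).
Proof.
case: m => n; first by rewrite -[X in X == 0]/(n%:R : k) natr_char0.
by rewrite NegzE mulrNz oppr_eq0 oppr_eq0 -[X in X == 0]/(n.+1%:R : k) natr_char0.
Qed.

(** In a rank factorization A = C R idempotency forces R C = 1, and tr (C R) = tr (R C). *)
Lemma mxtrace_idempotent n (A : 'M[k]_n) : A *m A = A -> \tr A = (\rank A)%:R.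
Proof.
move=> AA; rewrite -{1}(mulmx_base A) mxtrace_mulC.
suff -> : row_base A *m col_base A = 1%:M by rewrite mxtrace1.
have gen m (c : 'M[k]_(n, m)) (r : 'M_(m, n)) C D : r *m C = 1%:M -> D *m c = 1%:M ->
    c *m r *m (c *m r) = c *m r -> r *m c = 1%:M.
  move=> rC Dc /(congr1 (fun M => D *m M *m C)); rewrite !mulmxA Dc mul1mx rC => <-.
  by rewrite -[_ *m r *m C]mulmxA rC mulmx1.
have /row_freeP[C rC] := row_base_free A.
have /row_fullP[D cD] := col_base_full A.
by apply: gen rC cD _; rewrite mulmx_base.
Qed.

Lemma prim_sum n (z : k) c : n.-primitive_root z ->
  \sum_(i < n) z ^+ (i * c) = if (n %| c)%N then n%:R else 0.
Proof.
move=> pz; case: ifP => [nc | nc].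
  rewrite (eq_bigr (fun=> 1)) ?sumr_const ?card_ord // => i _.
  by apply/eqP; rewrite -(prim_order_dvd pz) dvdn_mull.
have zc1 : z ^+ c - 1 != 0 by rewrite subr_eq0 -(prim_order_dvd pz) nc.
apply: (mulfI zc1); under eq_bigr do rewrite mulnC exprM.
by rewrite -subrX1 mulr0 -exprM mulnC exprM (prim_expr_order pz) expr1n subrr.
Qed.

Lemma prim_inv n (z : k) : n.-primitive_root z -> n.-primitive_root z^-1.
Proof.
move=> pz; have n0 := prim_order_gt0 pz.
have e : z * z ^+ n.-1 = 1 by rewrite -exprS prednK // prim_expr_order.
have -> : z^-1 = z ^+ n.-1.
  have z0 : z != 0 by rewrite (prim_root_eq0 pz) -lt0n.
  by apply: (mulfI z0); rewrite e divff.
by rewrite prim_root_exp_coprime // coprimePn.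
Qed.

Lemma mxscalerAr N (c : k) (A B : 'M[k]_N) : c *: (A * B) = A * (c *: B).
Proof. exact: scalemxAr. Qed.

Lemma mxscalerAl N (c : k) (A B : 'M[k]_N) : c *: (A * B) = c *: A * B.
Proof. exact: scalemxAl. Qed.

(** * Spectral projections of a matrix of finite order *)

Section Eigenprojections.

Variables (N n : nat) (X : 'M[k]_N) (z : k).
Hypothesis pz : n.-primitive_root z.
Hypothesis Xn : X ^+ n = 1.

Let n0 : (0 < n)%N := prim_order_gt0 pz.
Let nk : n%:R != 0 :> k. Proof. by rewrite natr_char0 -lt0n. Qed.
Let zn : z ^+ n = 1 := prim_expr_order pz.
Let z0 : z != 0. Proof. by rewrite (prim_root_eq0 pz) -lt0n. Qed.

(* The projection onto the z^j-eigenspace of X. *)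
Definition eigproj (j : nat) : 'M[k]_N :=
  n%:R^-1 *: \sum_(i < n) z^-1 ^+ (i * j) *: X ^+ i.

Lemma eigproj_mulX j : X * eigproj j = z ^+ j *: eigproj j.
Proof.
rewrite /eigproj -mxscalerAr scalerA mulrC -scalerA; congr (_ *: _).
rewrite mulr_sumr scaler_sumr.
transitivity (\sum_(1 <= i < n.+1) z ^+ j *: (z^-1 ^+ (i * j) *: X ^+ i)).
  rewrite big_add1 big_mkord; apply: eq_bigr => i _.
  rewrite -mxscalerAr -exprS scalerA mulSn exprD mulrA -exprMn divff // expr1n mul1r //.
transitivity (\sum_(0 <= i < n) z ^+ j *: (z^-1 ^+ (i * j) *: X ^+ i)); last by rewrite big_mkord.
rewrite big_nat_recr //= [in RHS]big_ltn // addrC; congr (_ + _).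
by rewrite mul0n !expr0 Xn exprM exprVn zn invr1 expr1n.
Qed.

Lemma eigproj_mulXn i j : X ^+ i * eigproj j = z ^+ (i * j) *: eigproj j.
Proof.
elim: i => [|i IH]; first by rewrite mul0n !expr0 mul1r scale1r.
by rewrite exprSr -mulrA eigproj_mulX -mxscalerAr IH scalerA -exprD mulSn.
Qed.

Lemma eigproj_idem j : eigproj j * eigproj j = eigproj j.
Proof.
rewrite {1}/eigproj -mxscalerAl mulr_suml.
rewrite (eq_bigr (fun=> eigproj j)); last first.
  move=> i _; rewrite -mxscalerAl eigproj_mulXn scalerA -exprMn mulVf //.
  by rewrite expr1n scale1r.
by rewrite sumr_const card_ord -scaler_nat scalerA mulVf // scale1r.
Qed.

Lemma eigproj_sum i : X ^+ i = \sum_(j < n) z ^+ (i * j) *: eigproj j.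
Proof.
suff e : \sum_(j < n) eigproj j = 1.
  by rewrite -[LHS]mulr1 -e mulr_sumr; apply: eq_bigr => j _; rewrite eigproj_mulXn.
rewrite -scaler_sumr exchange_big /=.
rewrite (bigD1 (Ordinal n0)) //= [X in _ + X]big1 ?addr0 => [|m nm].
  under eq_bigr do rewrite mul0n expr0 scale1r.
  by rewrite sumr_const card_ord -scaler_nat scalerA mulVf // scale1r.
rewrite -scaler_suml; under eq_bigr do rewrite mulnC.
rewrite (prim_sum _ (prim_inv pz)) gtnNdvd ?scale0r //.
by rewrite lt0n; apply: contra nm => /eqP e; apply/eqP/val_inj.
Qed.

Lemma eigproj_comm Y j : Y * X = X * Y -> Y * eigproj j = eigproj j * Y.
Proof.
move=> YX; rewrite /eigproj -mxscalerAr -mxscalerAl mulr_sumr mulr_suml.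
congr (_ *: _); apply: eq_bigr => i _; rewrite -mxscalerAr -mxscalerAl; congr (_ *: _).
exact: commrX.
Qed.

End Eigenprojections.

End CharacteristicZero.

Lemma prim_root_exists (k : closedFieldType) (hk : [pchar k] =i pred0) n :
  (0 < n)%N -> exists z : k, n.-primitive_root z.
Proof.
move=> n0; pose P : {poly k} := 'X^n - 1.
have mP : P \is monic by rewrite monic_Xn_sub_1.
have [rs] := closed_field_poly_normal P; rewrite (eqP mP) scale1r => eP.
have sP : separable_poly P.
  (* The Bezout relation says that n^-1 X times the derivative n X^(n-1), minus X^n - 1, is 1. *)
  rewrite unlock; apply/Bezout_coprimepP; exists (- 1, n%:R^-1 *: 'X).
  rewrite /P derivB derivXn derivC subr0 /= -scaler_nat -scalerAr -scalerAl scalerA.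
  rewrite mulfV ?natr_char0 -?lt0n // scale1r -exprS prednK // mulN1r opprB subrK.
  exact: eqpxx.
have /cyclic.has_prim_root : all n.-unity_root rs.
  by apply/allP => x xr; rewrite /root_of_unity -/P eP root_prod_XsubC.
move=> /(_ n0) h; have : has n.-primitive_root rs.
  apply: h; first by rewrite -separable_prod_XsubC -eP.
  by rewrite -ltnS -(size_prod_XsubC rs id) -eP size_XnsubC.
by case/hasP => z _ pz; exists z.
Qed.

(** * Vanishing integral combinations of roots of unity of prime order *)

Section CharacteristicZero.

Variable k : fieldType.
Hypothesis hk : [pchar k] =i pred0.

(** The root [w] lies in [k], whereas minimal polynomials are computed in [algC]; the link is made
    by rational polynomials. The combination and 1 + X + ... + X^(p-1) are not coprime, since a
    Bezout relation cleared of denominators would be a nonzero integer vanishing in [k]. A common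
    root in [algC] has minimal polynomial of degree p - 1, so both, unless zero, are associated with
    it. *)
Lemma prime_root_sum (p : nat) (w : k) (a : nat -> int) :
  prime p -> p.-primitive_root w -> \sum_(i < p) (a i)%:~R * w ^+ i = 0 ->
  forall i, (i < p)%N -> a i = a 0.
Proof.
move=> pp pw aw.
pose Z (f : nat -> int) : {poly int} := \poly_(i < p) f i.
pose toQ : {poly int} -> {poly rat} := map_poly intr.
have evalZ (K : nzRingType) f (x : K) : (map_poly intr (Z f)).[x] = \sum_(i < p) (f i)%:~R * x ^+ i.
  rewrite /Z poly_def rmorph_sum horner_sum; apply: eq_bigr => i _.
  by rewrite /= map_polyZ map_polyXn hornerZ hornerXn.
have sizeZ f : (size (toQ (Z f)) <= p)%N.
  by rewrite size_map_inj_poly ?size_poly //; apply: intr_inj.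
have coefQ f i : (i < p)%N -> (toQ (Z f))`_i = (f i)%:~R.
  by move=> ip; rewrite coef_map coef_poly ip.
have pw1 : \sum_(i < p) w ^+ i = 0.
  under eq_bigr do rewrite -[_ ^+ _]/(w ^+ _) -[nat_of_ord _]muln1.
  by rewrite prim_sum // gtnNdvd ?prime_gt1.
have [cop | ncop] := boolP (coprimep (toQ (Z a)) (toQ (Z (fun=> 1)))).
  have /Bezout_coprimepP[[u v] /= /eqpf_eq[c c0 euv]] := cop.
  have [U [al al0 eU]] := rat_poly_scale u.
  have [V [be be0 eV]] := rat_poly_scale v.
  pose R := be *: (U * Z a) + al *: (V * Z (fun=> 1)).
  have RQ : toQ R = (al%:~R * be%:~R * c)%:P.
    have eU' : toQ U = al%:~R *: u by rewrite eU scalerA mulfV ?scale1r // intr_eq0.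
    have eV' : toQ V = be%:~R *: v by rewrite eV scalerA mulfV ?scale1r // intr_eq0.
    rewrite /R /toQ rmorphD /= !map_polyZ !rmorphM /= -/toQ eU' eV'.
    rewrite -!scalerAl !scalerA [be%:~R * _]mulrC -scalerDr euv scalerA.
    by rewrite -mul_polyC mulr1 !polyCM.
  have m0 : al%:~R * be%:~R * c != 0 by rewrite !mulf_neq0 // intr_eq0.
  have sR : (size R <= 1)%N.
    rewrite -(size_map_inj_poly (@intr_inj rat)) // -[map_poly _ _]/(toQ R) RQ.
    exact: size_polyC_leq1.
  have eR := size1_polyC sR.
  have R0 : R`_0 = 0.
    apply/eqP; rewrite -(intr_char0 hk); apply/eqP.
    have : (map_poly intr R).[w] = 0 :> k.
      rewrite /R rmorphD /= !map_polyZ !rmorphM /= hornerD !hornerZ !hornerM !evalZ aw.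
      rewrite (_ : \sum_(i < p) _ = 0) ?mulr0 ?add0r ?mulr0 // -[RHS]pw1.
      by apply: eq_bigr => i _; rewrite mul1r.
    by rewrite {1}eR map_polyC hornerC.
  by move: m0; rewrite -(inj_eq (@polyC_inj _)) -RQ eR R0 /toQ !rmorph0 eqxx.
pose d := gcdp (toQ (Z a)) (toQ (Z (fun=> 1))).
have [x dx] : exists x : algC, root (map_poly ratr d) x.
  by apply/closed_rootP; rewrite size_map_inj_poly ?rmorph0 //; apply: fmorph_inj.
have rx f : d %| toQ (Z f) -> root (map_poly ratr (toQ (Z f))) x.
  by case/dvdpP => f' ->; rewrite rmorphM /= rootM dx orbT.
have xp : p.-primitive_root x.
  have := rx (fun=> 1) (dvdp_gcdr _ _); rewrite /root.
  rewrite -map_poly_comp (eq_map_poly (ratr_int _)) evalZ.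
  under eq_bigr do rewrite mul1r.
  move=> /eqP s0.
  have [m xm] : {m | m.-primitive_root x & (m %| p)%N}.
    apply: prim_order_exists; first exact: prime_gt0.
    by apply/eqP; rewrite -subr_eq0 subrX1 s0 mulr0.
  move=> /(proj2 (primeP pp)) /pred2P[m1 | <- //].
  have := prim_expr_order xm; rewrite m1 expr1 => x1.
  move/eqP: s0; rewrite x1; under eq_bigr do rewrite expr1n.
  by rewrite sumr_const card_ord Num.Theory.pnatr_eq0 => /eqP p0; move: pp; rewrite p0.
have [Q [eQ mQ] dQ] := minCpolyP x.
have sQ : size Q = p.
  have := congr1 (size \o @polyseq _) eQ; rewrite /= size_map_inj_poly ?rmorph0 //; last exact: fmorph_inj.
  by rewrite (minCpoly_cyclotomic xp) size_cyclotomic totient_prime // prednK ?prime_gt0.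
have eqQ f : toQ (Z f) != 0 -> d %| toQ (Z f) -> Q %= toQ (Z f).
  move=> f0 /rx; rewrite dQ => Qf.
  by rewrite -dvdp_size_eqp // eqn_leq sQ sizeZ -sQ dvdp_leq.
have [a0 | na0] := eqVneq (toQ (Z a)) 0.
  move=> i ip; apply: (@intr_inj rat).
  by rewrite -!coefQ ?prime_gt0 // a0 !coef0.
have : toQ (Z a) %= toQ (Z (fun=> 1)).
  rewrite -(eqp_ltrans (eqQ _ na0 (dvdp_gcdl _ _))); apply: eqQ; last exact: dvdp_gcdr.
  apply/eqP => /(congr1 (fun P : {poly rat} => P`_0)); rewrite coefQ ?prime_gt0 // coef0.
  by move/eqP; rewrite oner_eq0.
case/eqpf_eq => c c0 e i ip; apply: (@intr_inj rat).
by rewrite -!coefQ ?prime_gt0 // e !coefZ !coefQ ?prime_gt0.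
Qed.

End CharacteristicZero.

(** * Uniform multiplicities from a quadratic trace identity *)

Section CharacteristicZero.

Variable k : fieldType.
Hypothesis hk : [pchar k] =i pred0.

Section Uniform.

Variables (N n : nat) (X : 'M[k]_N) (z : k).
Hypothesis pz : n.-primitive_root z.
Hypothesis Xn : X ^+ n = 1.
Hypothesis tr2 : forall i, \tr (X ^+ i) ^+ 2 = N%:R * \tr (X ^+ i).
Hypothesis nz : forall j, (j < n)%N -> eigproj n X z j != 0.

Let A j := eigproj n X z j.
Let m (j : nat) : nat := \rank (A j).

Let trX i : \tr (X ^+ i) = \sum_(j < n) z ^+ (i * j) * (m j)%:R.
Proof.
rewrite (eigproj_sum hk pz Xn) raddf_sum; apply: eq_bigr => j _ /=.
by rewrite mxtraceZ mxtrace_idempotent //; apply: (eigproj_idem hk pz Xn).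
Qed.

Let m_sum : (\sum_(j < n) m j)%N = N.
Proof.
apply: (natr_char0_inj hk); have := trX 0; rewrite expr0 mxtrace1 => ->.
by rewrite natr_sum; apply: eq_bigr => j _; rewrite mul0n expr0 mul1r.
Qed.

(* [tr2] says that the multiplicities satisfy m * m = N m for the convolution
   on Z/n. *)
Let m_conv c : (c < n)%N ->
  (\sum_(a < n) \sum_(b < n) (n %| (a + b + (n - c))) * (m a * m b) = N * m c)%N.
Proof.
move=> cn; have n0 : (0 < n)%N := prim_order_gt0 pz.
apply: (natr_char0_inj hk); apply: (mulfI (_ : n%:R != 0)); first by rewrite natr_char0 // -lt0n.
transitivity (\sum_(i < n) z ^+ (i * (n - c)) * \tr (X ^+ i) ^+ 2).
  under [RHS]eq_bigr => i _ do rewrite expr2 {1}trX trX mulr_suml mulr_sumr.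
  rewrite [RHS]exchange_big natr_sum mulr_sumr; apply: eq_bigr => a _ /=.
  under [RHS]eq_bigr => i _ do rewrite mulr_sumr mulr_sumr.
  rewrite [RHS]exchange_big natr_sum mulr_sumr; apply: eq_bigr => b _ /=.
  transitivity ((\sum_(i < n) z ^+ (i * (a + b + (n - c)))) * ((m a)%:R * (m b)%:R)).
    by rewrite prim_sum // natrM natrM; case: (n %| _)%N; rewrite ?mul1r ?mul0r ?mulr0.
  rewrite mulr_suml; apply: eq_bigr => i _.
  by rewrite !mulnDr !exprD; ring.
under eq_bigr do rewrite tr2.
transitivity (N%:R * \sum_(j < n) \sum_(i < n) z ^+ (i * (j + (n - c))) * (m j)%:R).
  rewrite [X in _ = _ * X]exchange_big mulr_sumr; apply: eq_bigr => i _ /=.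
  rewrite mulrCA trX mulr_sumr; congr (_ * _); apply: eq_bigr => j _.
  by rewrite mulnDr exprD; ring.
rewrite natrM mulrCA; congr (_ * _); rewrite (bigD1 (Ordinal cn)) //=.
rewrite [X in _ + X]big1 => [|j nj]; rewrite -mulr_suml prim_sum //.
  by rewrite addr0 subnKC ?dvdnn // ltnW.
case: ifP => [dj|_]; last by rewrite mul0r.
have jn := ltn_ord j; case/negP: nj; apply/eqP/val_inj => /=.
case/dvdnP: dj => q; case: q => [|[|q]]; nia.
Qed.

(* At a maximum of m the convolution identity is an average of values of m. *)
Let m_const c : (c < n)%N -> m c = m 0.
Proof.
move=> cn; have n0 : (0 < n)%N := prim_order_gt0 pz.
suff main c0 : (forall j : 'I_n, m j <= m c0)%N -> (c0 < n)%N -> forall j, (j < n)%N -> m j = m c0.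
  have [c0 _ c0max] := @arg_maxnP 'I_n (Ordinal n0) xpredT (fun j => m j) isT.
  by rewrite (main c0) ?(main c0 _ _ 0) // => j; apply: c0max.
move=> c0max c0n j jn.
(* [b a] is the residue of c0 - a modulo n. *)
pose b a := (if a <= c0 then c0 - a else c0 + (n - a))%N.
have bn (a : 'I_n) : (b a < n)%N by have := ltn_ord a; rewrite /b; case: ifP; lia.
have dvd_b (a i : 'I_n) : (n %| a + i + (n - c0))%N = (i == b a :> nat).
  have an := ltn_ord a; have iN := ltn_ord i; apply/idP/eqP => [/dvdnP[u eu]|->].
    by rewrite /b; case: ifP => ?; case: u eu => [|[|[|u]]] eu; rewrite ?mul0n ?mul1n ?mulSn in eu; lia.
  by apply/dvdnP; exists (if a <= c0 then 1 else 2)%N; rewrite /b; case: ifP; lia.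
have inner (a : 'I_n) : (\sum_(i < n) (n %| (a + i + (n - c0))) * (m a * m i) = m a * m (b a))%N.
  under eq_bigr do rewrite dvd_b.
  rewrite (bigD1 (Ordinal (bn a))) //= big1 => [|i ni]; first by rewrite eqxx mul1n addn0.
  by move: ni; rewrite -val_eqE /= => /negPf ->.
(* The truncated differences are exact because m is maximal at c0. All terms vanish with the sum,
   and [nz] makes every factor m a positive. *)
have e : (\sum_(a < n) m a * (m c0 - m (b a)) = 0)%N.
  under eq_bigr do rewrite mulnBr.
  rewrite sumnB => [|a _]; last by rewrite leq_mul2l (c0max (Ordinal (bn a))) orbT.
  rewrite -big_distrl /= m_sum -(m_conv c0n); apply/eqP; rewrite subn_eq0.
  by rewrite leq_eqVlt; apply/orP; left; apply/eqP; apply: eq_bigr => a _; rewrite inner.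
have e2 : forall a : 'I_n, m (b a) = m c0.
  move=> a; apply/eqP; rewrite eqn_leq (c0max (Ordinal (bn a))) /=.
  move/eqP: e; rewrite sum_nat_eq0 => /forallP/(_ a); rewrite muln_eq0 subn_eq0.
  by rewrite mxrank_eq0 (negPf (nz (ltn_ord a))).
rewrite -(e2 (Ordinal (bn (Ordinal jn)))) /=; congr m; rewrite /b.
by case: ifP; case: ifP; lia.
Qed.

(** By [tr2] every trace is 0 or N. Over the complex numbers absolute values would show that N
    occurs only for the identity; in a general field the multiplicities, as non-negative integers,
    take over that part. *)
Lemma trace_power_uniform : [/\ (n %| N)%N, forall j, (j < n)%N -> \rank (eigproj n X z j) = (N %/ n)%N
  & forall i, ~~ (n %| i)%N -> \tr (X ^+ i) = 0].
Proof.
have n0 : (0 < n)%N := prim_order_gt0 pz.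
have eN : (n * m 0 = N)%N.
  rewrite -m_sum -{1}(card_ord n) -sum_nat_const; apply: eq_bigr => j _.
  by rewrite m_const.
split; first by rewrite -eN dvdn_mulr.
  move=> j jn; rewrite -[LHS]/(m j) m_const //.
  by apply/esym/eqP; rewrite -(eqn_pmul2l n0) eN mulnC divnK // -eN dvdn_mulr.
move=> i ni; rewrite trX (eq_bigr (fun j : 'I_n => z ^+ (j * i) * (m 0)%:R)).
  by rewrite -mulr_suml prim_sum // (negPf ni) mul0r.
by move=> j _; rewrite m_const // mulnC.
Qed.

End Uniform.

End CharacteristicZero.

(** * Operators of order 2 r with vanishing trace and a twisted form *)

Section CharacteristicZero.

Variable k : fieldType.
Hypothesis hk : [pchar k] =i pred0.

Lemma idempotent_row m N (F : 'M[k]_N) (x : 'M_(m, N)) : F *m F = F -> (x <= F)%MS -> x *m F = x.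
Proof. by move=> FF /submxP[D ->]; rewrite -mulmxA FF. Qed.

Lemma two_neq0 : (2%:R : k) != 0.
Proof. by rewrite (natr_char0 hk). Qed.

Lemma opp_fixed_eq0 (V : lmodType k) (x : V) : x = - x -> x = 0.
Proof.
move=> e; have : x *+ 2 = 0 by rewrite mulr2n {2}e subrr.
by move/eqP; rewrite -scaler_nat scaler_eq0 (negPf two_neq0) => /eqP.
Qed.

(** The Gram matrix on a basis of the image is skew, so in odd size its determinant is its own
    opposite, hence zero; a kernel vector would lie in the radical. *)
Lemma skew_rank_even N (F B : 'M[k]_N) : F *m F = F ->
  (forall x y : 'rV_N, x *m F = x -> y *m F = y ->
     (y *m B *m x^T) 0 0 = - (x *m B *m y^T) 0 0) ->
  (forall x : 'rV_N, x *m F = x ->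
     (forall y : 'rV_N, y *m F = y -> (x *m B *m y^T) 0 0 = 0) -> x = 0) ->
  ~~ odd (\rank F).
Proof.
move=> FF skew nd; apply/negP => od.
pose R := row_base F; pose G := R *m B *m R^T.
have RF : R *m F = R by apply: idempotent_row; rewrite // eq_row_base.
have rowF i : row i R *m F = row i R by rewrite -row_mul RF.
have GE i j : G i j = (row i R *m B *m (row j R)^T) 0 0.
  by rewrite /G -!row_mul tr_row !mxE; apply: eq_bigr => l _; rewrite !mxE.
have GT : G^T = (-1) *: G.
  by apply/matrixP => i j; rewrite [LHS]mxE [RHS]mxE !GE mulN1r skew.
have dG : \det G = 0.
  have := det_tr G; rewrite GT detZ -signr_odd od expr1 mulN1r => e.
  by apply: (@opp_fixed_eq0 k^o).
have [v v0 vG] : exists2 v : 'rV_(\rank F), v != 0 & v *m G = 0.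
  apply/det0P/eqP; exact: dG.
have vR : v *m R = 0.
  apply: nd => [|y yF]; first by rewrite -mulmxA RF.
  have -> : y = y *m col_base F *m R by rewrite -mulmxA mulmx_base.
  have -> : v *m R *m B *m (y *m col_base F *m R)^T = v *m G *m (y *m col_base F)^T.
    by rewrite trmx_mul /G !mulmxA.
  by rewrite vG mul0mx mxE.
move/eqP: v0; apply.
have /row_freeP[C RC] := row_base_free F.
by rewrite -[v]mulmx1 -RC mulmxA vR mul0mx.
Qed.

Lemma mxtrace_eigproj_mul N n (X F : 'M[k]_N) (z : k) m :
  n.-primitive_root z -> X ^+ n = 1 -> F * F = F -> F * X = X * F ->
  \tr (X ^+ m * F) = \sum_(i < n) (\rank (eigproj n X z i * F)%R)%:R * z ^+ (m * i).
Proof.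
move=> pz Xn FF FX; rewrite (eigproj_sum hk pz Xn) mulr_suml raddf_sum.
apply: eq_bigr => i _ /=; rewrite -mxscalerAl mxtraceZ mulrC; congr (_ * _).
rewrite mxtrace_idempotent // -[_ *m _]/(_ * _) -mulrA [F * (_ * F)]mulrA (eigproj_comm n z i FX).
by rewrite -mulrA FF mulrA (eigproj_idem hk pz Xn).
Qed.

(** The size bound leaves c in {-1, 0, 1}; c = 0 would give 4 m = p + 2, which is odd, and c = 1
    would give 4 m = 2. *)
Lemma twin_odd_multiple (p t m a s : nat) (c : int) :
  p = (2 * t + 1)%N -> (3 <= p)%N -> s = (p + 2)%N -> s = (a + 2 * m)%N ->
  a%:Z - (2 * m)%:Z = p%:Z * c -> a = 1%N /\ c = -1.
Proof.
move=> -> h -> e1 e2.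
have [c1|c2] : c <= -2 \/ -2 < c by lia.
  nia.
have [c1|c3] : 1 < c \/ c <= 1 by lia.
  nia.
have : c = -1 \/ c = 0 \/ c = 1 by lia.
by case=> [|[]] ec; rewrite ec in e2 *; nia.
Qed.

(** The size bound forces c = 0, hence p = 4 m, while p is odd. *)
Lemma twin_small_multiple (p t m a s : nat) (c : int) :
  p = (2 * t + 1)%N -> (3 <= p)%N -> s = p%N -> s = (a + 2 * m)%N ->
  a%:Z - (2 * m)%:Z = (p + 2)%:Z * c -> False.
Proof.
move=> -> h -> e1 e2.
have [c1|c2] : c <= -1 \/ -1 < c by lia.
  nia.
have [c1|c3] : 0 < c \/ c <= 0 by lia.
  nia.
have ec : c = 0 by lia.
by rewrite ec in e2; nia.
Qed.

Section TwistedTrace.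

Variables (N r p : nat) (E U B : 'M[k]_N) (w : k).
Hypotheses (pr : prime r) (r_odd : odd r) (pw : r.-primitive_root w).
Hypotheses (EE : E * E = E) (EU : E * U = U * E) (Un : U ^+ (2 * r) = 1).
Hypothesis trUE : \tr (U * E) = 0.

Let T := U ^+ r.
Let form (x y : 'rV[k]_N) := (x *m B *m y^T) 0 0.
Hypothesis form_sym : forall x y, x *m E = x -> y *m E = y ->
  form y x = form x (y *m T).
Hypothesis form_nd : forall x, x *m E = x ->
  (forall y, y *m E = y -> form x y = 0) -> x = 0.

Let TT : T * T = 1. Proof. by rewrite /T -exprD addnn -mul2n. Qed.
Let ET : E * T = T * E. Proof. exact: commrX. Qed.

(** As r + 1 is even, the order of X divides r, and U = X T splits U into commuting factors of odd
    order and of order two. *)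
Let X := U ^+ r.+1.
Let Xr : X ^+ r = 1.
Proof.
have [m em] : exists m, r.+1 = (2 * m)%N by exists (r.+1)./2; lia.
by rewrite /X -exprM em mulnAC exprM Un expr1n.
Qed.
Let XT : X * T = U.
Proof. by rewrite /X /T -exprD addSn addnn -mul2n exprS Un mulr1. Qed.
Let EX : E * X = X * E. Proof. exact: commrX. Qed.
Let TX : T * X = X * T. Proof. by apply: commrX; apply/commr_sym/commrX. Qed.

(* F b projects onto the (-1)^b-eigenspace of T inside the image of E. *)
Let F (b : bool) : 'M[k]_N := 2%:R^-1 *: ((1 + (-1) ^+ b *: T) * E).

Let F_T b : F b * T = (-1) ^+ b *: F b.
Proof.
rewrite /F -mxscalerAl -mulrA ET mulrA scalerA mulrC -scalerA; congr (_ *: _).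
rewrite mulrDl mul1r -mxscalerAl TT mxscalerAl; congr (_ * _).
by rewrite scalerDr scalerA -expr2 sqrr_sign scale1r addrC.
Qed.

Let F_E b : F b * E = F b.
Proof. by rewrite /F -mxscalerAl -mulrA EE. Qed.

Let F_sum : F false + F true = E.
Proof.
rewrite /F -scalerDr -mulrDl expr0 expr1 scale1r scaleN1r addrACA subrr addr0.
by rewrite -mulr2n mulr_natl -scaler_nat scalerA mulVf ?two_neq0 // scale1r.
Qed.

Let FF b : F b * F b = F b.
Proof.
rewrite {2}/F -mxscalerAr mulrA mulrDr mulr1 -mxscalerAr F_T scalerA.
rewrite -expr2 sqrr_sign scale1r mulrDl F_E -mulr2n -scaler_nat scalerA.
by rewrite mulVf ?two_neq0 // scale1r.
Qed.

Let FX b : F b * X = X * F b.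
Proof.
rewrite /F -mxscalerAl -mxscalerAr; congr (_ *: _).
rewrite -mulrA EX !mulrA; congr (_ * E).
by rewrite mulrDl mulrDr mul1r mulr1 -mxscalerAl -mxscalerAr TX.
Qed.

Let d b i := \rank (eigproj r X w i * F b)%R.

Let rankF b : \rank (F b) = (\sum_(i < r) d b i)%N.
Proof.
apply: (natr_char0_inj hk); rewrite -mxtrace_idempotent; last exact: FF.
have := mxtrace_eigproj_mul 0 pw Xr (FF b) (FX b); rewrite expr0 mul1r => ->.
by rewrite natr_sum; apply: eq_bigr => i _; rewrite mul0n expr0 mulr1.
Qed.

Let rankE : \rank E = (\rank (F false) + \rank (F true))%N.
Proof.
apply: (natr_char0_inj hk); rewrite natrD -!mxtrace_idempotent -?mxtraceD ?F_sum //;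
  exact: FF.
Qed.

(* X = U^(r+1) has r-th roots of unity as eigenvalues and X T = U, so tr (U E) = 0
   is a vanishing integral combination of these roots. *)
Let d_const i : (i < r)%N -> (d false i)%:Z - (d true i)%:Z = (d false 0)%:Z - (d true 0)%:Z.
Proof.
move: i; apply: (prime_root_sum hk (a := fun i => (d false i)%:Z - (d true i)%:Z) pr pw).
have := trUE; rewrite -XT -mulrA -ET -F_sum mulrDl !F_T expr0 expr1 scale1r scaleN1r.
rewrite mulrDr mulrN raddfD raddfN /=.
have e b := mxtrace_eigproj_mul 1 pw Xr (FF b) (FX b).
rewrite -(expr1 X) !e -sumrB => s0; rewrite -[RHS]s0; apply: eq_bigr => i _.
by rewrite -/(d false i) -/(d true i) intrB mulrBl !mul1n.
Qed.

Let F_row b (x : 'rV_N) : x *m F b = x -> x *m E = x /\ x *m T = (-1) ^+ b *: x.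
Proof.
move=> xF; split.
  by rewrite -{1}xF -mulmxA -[F b *m E]/(F b * E) F_E.
by rewrite -{1}xF -mulmxA -[F b *m T]/(F b * T) F_T -scalemxAr xF.
Qed.

(** Using the twist twice multiplies the value by both eigenvalues of T, whose product is -1. *)
Let form0 (x y : 'rV_N) b : x *m F b = x -> y *m F (~~ b) = y -> form x y = 0.
Proof.
move=> /F_row[xE xT] /F_row[yE yT]; apply: (@opp_fixed_eq0 k^o).
have lZ c u v : form u (c *: v) = c * form u v.
  by rewrite /form linearZ /= -scalemxAr mxE.
have e1 := form_sym xE yE; have e2 := form_sym yE xE.
rewrite yT lZ in e1; rewrite xT lZ in e2.
rewrite {1}e2 e1 mulrA; case: b {xT yT e1 e2} => /=; rewrite ?expr1 ?expr0; ring.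
Qed.

Let rank_even : ~~ odd (\rank (F true)).
Proof.
have h := @skew_rank_even N (F true) B (FF true).
apply: h => [x y xF yF | x xF x0].
  have [xE _] := F_row xF; have [yE yT] := F_row yF.
  rewrite -[LHS]/(form y x) (form_sym xE yE) yT /form linearZ /= -scalemxAr mxE.
  by rewrite expr1 mulN1r.
have [xE _] := F_row xF; apply: (form_nd xE) => y yE.
have -> : y = y *m F false + y *m F true by rewrite -mulmxDr -[_ + _]/(F false + F true) F_sum.
have FFb b : F b *m F b = F b by apply: FF.
rewrite /form linearD /= mulmxDr mxE.
rewrite -[X in X + _]/(form x (y *m F false)) (form0 (b := true)) //=; last by rewrite -mulmxA FFb.
by rewrite add0r; apply: x0; rewrite -mulmxA FFb.
Qed.

Lemma twisted_trace : prime p -> odd p -> (r * \rank E = p * (p + 2))%N -> (r = p \/ r = p + 2)%N ->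
  [/\ r = p,
      forall x y : 'rV_N, x *m E = x -> y *m E = y -> x *m T = x -> y *m T = y ->
        x != 0 -> exists c : k, y = c *: x &
      exists x : 'rV_N, [/\ x != 0, x *m E = x & x *m U = - x]].
Proof.
move=> pp p_odd rE rp.
have p3 : (3 <= p)%N by have := prime_gt1 pp; lia.
pose c := (d false 0)%:Z - (d true 0)%:Z.
have ec : (\rank (F false))%:Z - (\rank (F true))%:Z = r%:Z * c.
  rewrite !rankF !(big_morph Posz PoszD (erefl (Posz 0))) -sumrB (eq_bigr (fun=> c)); last by move=> i _; apply: d_const.
  by rewrite sumr_const card_ord -mulr_natl natz.
have [m em] : exists m, \rank (F true) = (2 * m)%N by exists (\rank (F true))./2; have := rank_even; lia.
have eE := rankE.
(* The rank of [E] is the prime other than r. Only r = p survives, with eigenspaces of dimensions 1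
   and p + 1. *)
have [rp' [F1 cN]] : r = p /\ \rank (F false) = 1%N /\ c = -1.
  rewrite em in ec eE; have [t et] : exists t, p = (2 * t + 1)%N by exists p./2; lia.
  case: rp => er; rewrite er in rE ec *.
    have es : \rank E = (p + 2)%N by apply/eqP; rewrite -(eqn_pmul2l (prime_gt0 pp)) rE.
    by have [] := twin_odd_multiple et p3 es eE ec.
  have es : \rank E = p.
    by apply/eqP; rewrite -(@eqn_pmul2l (p + 2)) ?rE 1?mulnC // addn2.
  by case: (twin_small_multiple et p3 es eE ec).
have [r0 d0] : (0 < r)%N /\ d true 0 != 0%N by rewrite prime_gt0 //; split=> //; move: cN; rewrite /c; lia.
split=> //.
- have FE x : x *m E = x -> x *m T = x -> (x *m F false = x :> 'rV_N).
    move=> xE xT; rewrite -scalemxAr -[(_ + _) * E]/(_ *m _) mulmxA mulmxDr mulmx1.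
    rewrite expr0 scale1r xT mulmxDl xE -mulr2n -scaler_nat scalerA mulVf ?two_neq0 //.
    exact: scale1r.
  pose C := col_base (F false); pose R := row_base (F false).
  have eF : F false = C *m R by rewrite mulmx_base.
  move: C R eF; rewrite F1 => C R eF x y xE yE xT yT x0.
  have sc (v : 'rV_N) : v *m F false = v -> v = (v *m C) 0 0 *: R.
    by move=> vF; rewrite -mul_scalar_mx -mx11_scalar -mulmxA -eF vF.
  have ex := sc x (FE x xE xT); have ey := sc y (FE y yE yT).
  move: ((x *m C) 0 0) ((y *m C) 0 0) ex ey => a b ex ey.
  have a0 : a != 0 by apply: contra x0 => /eqP e; rewrite ex e scale0r.
  by exists (b / a); rewrite ex scalerA mulfVK.
(* Since [d true 0] is nonzero, the product of projections has a nonzero row; on it X = 1 and T = -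
   1, hence U = - 1. *)
- have [i ri] : exists i, row i (eigproj r X w 0 * F true)%R != 0.
    apply/existsP; rewrite -negb_forall; apply: contra d0 => /forallP e.
    by rewrite mxrank_eq0; apply/eqP/row_matrixP => i; rewrite row0; apply/eqP.
  exists (row i (eigproj r X w 0 * F true)%R).
  have e0 := eigproj_mulX pw Xr 0; rewrite expr0 scale1r in e0.
  have e1 := eigproj_comm r w 0 (erefl (X * X)); rewrite e0 in e1.
  split=> //.
    by rewrite -row_mul -[_ *m E]/(_ * F true * E) -mulrA F_E.
  rewrite -XT -row_mul -[_ *m _]/(_ * F true * (X * T)).
  rewrite -mulrA [F true * _]mulrA FX -[X * _ * T]mulrA F_T expr1 scaleN1r !mulrN.
  by rewrite mulrA -e1 linearN.
Qed.

End TwistedTrace.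

End CharacteristicZero.

(** * Traces of the antipode *)

Section Trace.

Variable (k : fieldType).

Definition ltr (V : vectType k) (f : V -> V) : k := \sum_i cb i (f (vb i)).

Lemma ltrE (V : vectType k) (f : V -> V) : ltr f = \tr (emx f).
Proof. by apply: eq_bigr => i _; rewrite mxE. Qed.

Lemma eq_ltr (V : vectType k) (f g : V -> V) : f =1 g -> ltr f = ltr g.
Proof. by move=> e; apply: eq_bigr => i _; rewrite e. Qed.

Lemma ltr_conj (V : vectType k) (f g P Q : V -> V) :
  linear g -> linear P -> linear Q -> cancel P Q ->
  (forall x, P (f x) = g (P x)) -> ltr f = ltr g.
Proof.
move=> lg lP lQ PQ e; rewrite !ltrE.
have e1 : emx f *m emx P = emx P *m emx g.
  by rewrite -!emx_comp //; apply: eq_emx => x /=; rewrite e.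
have PQ1 : emx P *m emx Q = 1%:M.
  by rewrite -emx_comp // -emx_id; apply: eq_emx => x /=; rewrite PQ.
by rewrite -[emx f]mulmx1 -PQ1 mulmxA e1 mxtrace_mulC mulmxA (mulmx1C PQ1) mul1mx.
Qed.

Lemma ltr_dual_basis (V : vectType k) (J : finType) (w : J -> V) (phi : J -> V -> k^o) (f : V -> V) :
  linear f -> (forall j, linear (phi j)) -> (forall x, x = \sum_j (phi j x : k) *: w j) ->
  ltr f = \sum_j phi j (f (w j)).
Proof.
move=> lf lphi e.
transitivity (\sum_i \sum_j ((phi j (vb i) : k) * cb i (f (w j)))).
  apply: eq_bigr => i _; rewrite {1}[vb i]e -[f _]/(linpack lf _) !linear_sum.
  by apply: eq_bigr => j _; rewrite !linearZ.
rewrite exchange_big; apply: eq_bigr => j _ /=.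
rewrite -(vb_expand (f (w j)) (lphi j)); apply: eq_bigr => i _.
by rewrite mulrC.
Qed.

Lemma ltr_id (V : vectType k) : ltr (@id V) = (dim V)%:R.
Proof. by rewrite ltrE emx_id mxtrace1. Qed.

Lemma tmap_tens_lin (U V : vectType k) (f : U -> U) (g : V -> V) u v :
  linear f -> linear g -> tmap f g (tens u v) = tens (f u) (g v).
Proof. by move=> lf lg; apply: (tmap_tens (linpack lf) (linpack lg)). Qed.

Lemma ltr_tmap (U V : vectType k) (f : U -> U) (g : V -> V) :
  linear f -> linear g -> ltr (tmap f g) = ltr f * ltr g.
Proof.
move=> lf lg.
pose phi (ij : 'I_(dim U) * 'I_(dim V)) (t : tensor U V) : k^o :=
  (t : 'M[k]_(dim U, dim V)) ij.1 ij.2.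
rewrite (@ltr_dual_basis _ _ (fun ij => tens (vb ij.1) (vb ij.2)) phi).
- rewrite /ltr mulr_suml; under [RHS]eq_bigr do rewrite mulr_sumr.
  rewrite pair_bigA; apply: eq_bigr => -[i j] _ /=.
  rewrite tmap_tens_lin // /phi /=.
  by rewrite /tens mxE big_ord1 mxE.
- by rewrite /tmap; apply: linearP.
- by move=> ij a s t; rewrite /phi !mxE.
- by move=> t; rewrite {1}[t]tensor_basis pair_bigA.
Qed.

Section Hopf.

Variable H : hopfAlgType k.
Implicit Types x y : H.
Local Notation S := (@antipode k H).
Local Notation S2 := (@antipode2 k H).
Local Notation eps x := (@counit k H x : k).
Local Notation N := (dim H).

(** By [sw_left_integral], S^2 x = l(x L2) S(L1), so the trace is l(a S(L1) L2). *)
Lemma ltr_left_mul_antipode2 (l : {linear H -> k^o}) (L : H) a :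
  left_cointegral l -> (forall x, l (x * L) = counit x) ->
  ltr (fun x => a * S2 x) = eps L * l a.
Proof.
move=> lP LP.
transitivity (\sw_(u, v <- L) l (a * S u * v)).
  transitivity (\sum_i \sw_(u, v <- L) ((cb i (a * S u) : k) *: l (vb i * v))).
    apply: eq_bigr => i _; rewrite /antipode2 -(sw_left_integral lP (vb i) LP).
    rewrite (linear_tlift _ _ (linearP _)) -tliftMl (linear_tlift _ _ (linearP _)).
    apply: (@eq_sw k H H k^o) => u v.
    by rewrite linearZ -scalerAr /= cbZ mulrC.
  rewrite -tlift_sum; apply: (@eq_sw k H H k^o) => u v.
  by rewrite (@vb_expand _ _ _ (fun z => l (z * v))) //; lin.
rewrite (eq_sw (b' := fun u v => l (a * (S u * v)))) => [|u v]; last by rewrite mulrA.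
by rewrite (@sw_antipodel _ _ _ L (fun z => l (a * z))) ?mulr1 //; lin.
Qed.

(** The computation for left multiplications, with [f] moved through [S] onto the first leg of L:
    the antipode axiom applies to [hitr (charS f) L], whose counit is f(S L). *)
Lemma ltr_hitl_antipode2 (l : {linear H -> k^o}) (L : H) (f : {linear H -> k^o}) :
  left_cointegral l -> (forall x, l (x * L) = counit x) -> character f ->
  ltr (fun x => hitl f (S2 x)) = (f (S L) : k) * l 1.
Proof.
move=> lP LP fP.
transitivity (\sw_(u, v <- L) l (S (hitr (charS f) u) * v)).
  transitivity (\sum_i \sw_(u, v <- L) ((cb i (S (hitr (charS f) u)) : k) *: l (vb i * v))).
    apply: eq_bigr => i _; rewrite -antipode_hitr_charS -(sw_left_integral lP (vb i) LP).
    have lh : linear (fun z => cb i (S (hitr (charS f) z))) by lin.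
    rewrite (linear_tlift _ _ lh); apply: (@eq_sw k H H k^o) => u v.
    by rewrite (linZ lh) !scaleRE mulrC.
  rewrite -tlift_sum; apply: (@eq_sw k H H k^o) => u v.
  by rewrite (@vb_expand _ _ _ (fun z => l (z * v))) //; lin.
rewrite -(@sw_hitr _ _ _ (charS f) L (fun u v => l (S u * v))); last by bilin.
rewrite (@sw_antipodel _ _ _ _ l (linearP _)) counit_hitr.
by [].
Qed.

(** Both sides evaluate [f] on the middle leg of the double coproduct. *)
Lemma sw_hitlr (W : vectType k) (f : {linear H -> k^o}) x (b : H -> H -> W) :
  bilinear_for *:%R *:%R b ->
  \sw_(u, v <- x) b (hitl f u) v = \sw_(u, v <- x) b u (hitr f v).
Proof.
move=> [bl br].
transitivity (\sw_(u, v <- x) \sw_(c, d <- u) ((f d : k) *: b c v)).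
  apply: eq_sw => u v; rewrite /hitl (@linear_tlift _ _ _ _ _ (b^~ v)) //.
  by apply: eq_sw => c d; rewrite (linZ (bl v)).
rewrite sw_coassoc; apply: eq_sw => u v.
by rewrite /hitr (@linear_tlift _ _ _ _ _ (b u)) //; apply: eq_sw => c d; rewrite linZ.
Qed.

(** The Galois map of H, with inverse [Psi]. Conjugation by it is the source of the quadratic trace
    identities. *)
Let Phi : tensor H H -> tensor H H := tlift (fun x y => \sw_(u, v <- x) tens u (v * y)).
Let Psi : tensor H H -> tensor H H := tlift (fun x y => \sw_(u, v <- x) tens u (S v * y)).

Let PhiE x y : Phi (tens x y) = \sw_(u, v <- x) tens u (v * y).
Proof. by rewrite /Phi tlift_tens //; bilin. Qed.

Let PsiE x y : Psi (tens x y) = \sw_(u, v <- x) tens u (S v * y).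
Proof. by rewrite /Psi tlift_tens //; bilin. Qed.

Let lPhi : linear Phi. Proof. exact: linearP. Qed.
Let lPsi : linear Psi. Proof. exact: linearP. Qed.

Let PhiK : cancel Phi Psi.
Proof.
apply: (tlift_ext (f := Psi \o Phi) (g := id)) => [||x y] //=.
  by move=> a s t /=; rewrite lPhi lPsi.
rewrite PhiE (linear_tlift _ _ lPsi).
transitivity (\sw_(u, v <- x) \sw_(c, d <- u) tens c (S d * v * y)).
  by apply: eq_sw => u v; rewrite PsiE; apply: eq_sw => c d; rewrite mulrA.
rewrite sw_coassoc -[RHS](@sw_counitr _ _ _ x (fun z => tens z y)); last by lin.
apply: eq_sw => u v.
by rewrite (@sw_antipodel _ _ _ v (fun z => tens u (z * y))) ?mul1r //; lin.
Qed.

(* With A x = hitr f (g x), Phi conjugates A (x) id to A (x) g. *)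
Lemma grouplike_trace (f : {linear H -> k^o}) g : grouplike g ->
  ltr (fun x => hitr f (g * x)) * ltr ( *%R g) = N%:R * ltr (fun x => hitr f (g * x)).
Proof.
move=> gg; pose A x := hitr f (g * x).
have lA : linear A by rewrite /A; lin.
have lg : linear ( *%R g) by apply: (@lin_mulr _ _ _ id).
have lid : linear (@id H) by [].
rewrite -[ltr (fun x => _)]/(ltr A) -!ltr_id [RHS]mulrC -!ltr_tmap //.
symmetry; apply: (ltr_conj (P := Phi) (Q := Psi)) => //; first by rewrite /tmap; apply: linearP.
apply: tlift_ext => [||x y].
- by move=> a s t; rewrite /tmap linearP lPhi.
- by move=> a s t; rewrite lPhi /tmap linearP.
have lt : linear (tmap A ( *%R g)) by rewrite /tmap; apply: linearP.
rewrite tmap_tens_lin //= !PhiE (linear_tlift _ _ lt).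
rewrite {1}/A sw_hitr; last by bilin.
rewrite sw_mul; last by bilin.
rewrite (sw_grouplike gg); last by bilin.
by apply: eq_sw => u v; rewrite tmap_tens_lin //= mulrA.
Qed.

(** [Phi] conjugates id (x) [hitr f] to [hitl (charS f)] (x) [hitr f]: on the two legs of x the
    inverse characters cancel. *)
Lemma character_trace_aux (f : {linear H -> k^o}) : character f ->
  ltr (hitl (charS f)) * ltr (hitr f) = N%:R * ltr (hitr f).
Proof.
move=> fP.
have ll : linear (hitl (charS f)) by apply: linearP.
have lr : linear (hitr f) by apply: linearP.
have lid : linear (@id H) by [].
rewrite -!ltr_id -!ltr_tmap //.
symmetry; apply: (ltr_conj (P := Phi) (Q := Psi)) => //; first by rewrite /tmap; apply: linearP.
apply: tlift_ext => [||x y].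
- by move=> a s t; rewrite /tmap linearP lPhi.
- by move=> a s t; rewrite lPhi /tmap linearP.
have lt : linear (tmap (hitl (charS f)) (hitr f)) by rewrite /tmap; apply: linearP.
rewrite !tmap_tens_lin // !PhiE (linear_tlift _ _ lt) /=.
under [RHS]eq_sw => u v do rewrite tmap_tens_lin //= hitrM //.
rewrite (@sw_hitlr _ _ _ (fun u v => tens u (hitr f v * hitr f y))); last by bilin.
by apply: eq_sw => u v; rewrite hitr_charSK.
Qed.

Lemma antipode_bij : exists T : H -> H, [/\ linear T, cancel S T & cancel T S].
Proof.
have [l [lP l0]] := left_cointegral_exists H.
have [t tP] := cointegral_right_integral lP l0.
exact: (antipode_inverse lP tP).
Qed.

Lemma ltr_hitl_charS (f : {linear H -> k^o}) : character f ->
  ltr (hitl (charS f)) = ltr (hitr f).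
Proof.
move=> fP; have [T [lT ST TS]] := antipode_bij.
apply: (ltr_conj (P := S) (Q := T)) => //; try exact: linearP.
move=> x; rewrite antipode_hitl; last exact: character_charS.
by apply: eq_sw => u v; congr (_ *: _); apply: charSS.
Qed.

Lemma hitr_trace (f : {linear H -> k^o}) : character f ->
  ltr (hitr f) ^+ 2 = N%:R * ltr (hitr f).
Proof. by move=> fP; rewrite expr2 -{1}ltr_hitl_charS // character_trace_aux. Qed.

Lemma hitl_trace (f : {linear H -> k^o}) : character f ->
  ltr (hitl f) ^+ 2 = N%:R * ltr (hitl f).
Proof.
move=> fP; have cP := character_charS fP.
have e : ltr (hitl f) = ltr (hitr (charS f)).
  rewrite -ltr_hitl_charS //; apply: eq_ltr => x; apply: eq_sw => u v.
  by congr (_ *: _); symmetry; apply: charSS.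
by rewrite e hitr_trace.
Qed.

Section Powers.

Variable f : {linear H -> k^o}.

(* The n-th convolution power of the character f. *)
Definition cpow n (x : H) : k^o := counit (iter n (hitl f) x).

Lemma iter_hitl_linear n : linear (iter n (hitl f)).
Proof. by apply: lin_iter; apply: linearP. Qed.

Lemma iter_hitr_linear n : linear (iter n (hitr f)).
Proof. by apply: lin_iter; apply: linearP. Qed.

Lemma cpow_is_linear n : linear (cpow n).
Proof. by move=> a x y; rewrite /cpow iter_hitl_linear linearP. Qed.

HB.instance Definition _ n := GRing.isLinear.Build k H k^o *:%R (cpow n) (cpow_is_linear n).

Lemma hitl_cpow n x : hitl (cpow n) x = iter n (hitl f) x.
Proof.
have key : forall (W : vectType k) (b : H -> H -> W), bilinear_for *:%R *:%R b ->
    \sw_(u, v <- iter n (hitl f) x) b u v = \sw_(u, v <- x) b u (iter n (hitl f) v).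
  move=> W b bb; elim: n b bb => //= n IH b bb.
  rewrite sw_hitl // (IH (fun u v => b u (hitl f v))) //.
  case: bb => bl br; split=> [y|y]; first exact: bl.
  by apply: lin_comp; [apply: br | apply: linearP].
rewrite /hitl -[RHS]counit_comulr key //.
have lid := @lin_id k H; bilin.
Qed.

Lemma hitr_cpow n x : hitr (cpow n) x = iter n (hitr f) x.
Proof.
have key : forall (W : vectType k) (b : H -> H -> W), bilinear_for *:%R *:%R b ->
    \sw_(u, v <- iter n (hitr f) x) b u v = \sw_(u, v <- x) b (iter n (hitr f) u) v.
  move=> W b bb; elim: n b bb => //= n IH b bb.
  rewrite sw_hitr // (IH (fun u v => b (hitr f u) v)) //.
  case: bb => bl br; split=> [y|y]; last exact: br.
  by apply: (@lin_comp _ _ _ _ (b^~ y)); [apply: bl | apply: linearP].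
have e y m : counit (iter m (hitr f) y) = cpow m y.
  elim: m y => [|m IH] y //.
  transitivity (counit (iter m (hitr f) (hitl f y))); last by rewrite IH /cpow iterSr.
  rewrite iterS counit_hitr -counit_hitl; apply: congr1.
  by elim: m {IH} => //= m <-; apply: hitlr.
rewrite /hitr -[RHS]counit_comull key; last by bilin.
by apply: eq_sw => u v; rewrite e.
Qed.

Lemma character_cpow n : character f -> character (cpow n).
Proof.
move=> fP; rewrite /cpow; split=> [x y|].
  elim: n x y => [|n IH] x y; first exact: counitM.
  by rewrite !iterSr hitlM.
elim: n => [|n IH]; first exact: counit1.
by rewrite iterSr hitl1.
Qed.

End Powers.

End Hopf.

End Trace.

(** * Linear independence of eigenfunctions *)

Section Independence.

Variable k : fieldType.

(* The independence of eigenvectors for distinct eigenvalues, with an operator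
   allowed to depend on the pair to be separated. *)
Lemma eigenfunctions_free (T : Type) (u : nat -> T -> k) (n : nat) (c : nat -> k) :
  (forall i j, (i < j < n)%N -> exists (phi : T -> T) (chi : nat -> k),
     (forall l x, (l < n)%N -> u l (phi x) = chi l * u l x) /\ chi i != chi j) ->
  (forall i, (i < n)%N -> exists x, u i x != 0) ->
  (forall x, \sum_(i < n) c i * u i x = 0) -> forall i, (i < n)%N -> c i = 0.
Proof.
elim: n c => // n IH c sep nz s0.
have c0 j : (j < n)%N -> c j = 0.
  move=> jn; have [|phi [chi [chiP nchi]]] := sep j n; first by rewrite jn ltnSn.
  have : c j * (chi j - chi n) = 0.
    apply: (IH (fun i => c i * (chi i - chi n))) jn => [i j' ij'|i lt_in|x].
    - have [|phi' [chi' [chiP' n']]] := sep i j'; first by lia.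
      by exists phi', chi'; split=> // l x ln; apply: chiP'; lia.
    - by apply: nz; lia.
    have := s0 (phi x); rewrite big_ord_recr /= chiP // => e1.
    have := s0 x; rewrite big_ord_recr /= => e2.
    transitivity (\sum_(i < n) (c i * u i (phi x) - chi n * (c i * u i x))).
      by apply: eq_bigr => i _; rewrite chiP ?ltnS 1?ltnW //; ring.
    rewrite sumrB -mulr_sumr; apply/eqP; rewrite subr_eq0; apply/eqP.
    move/eqP: e1; rewrite addr_eq0 => /eqP ->; move/eqP: e2; rewrite addr_eq0 => /eqP ->.
    by ring.
  by move/eqP; rewrite mulf_eq0 subr_eq0 (negPf nchi) orbF => /eqP.
have cn : c n = 0.
  have [x ux] := nz n (ltnSn n); have := s0 x; rewrite big_ord_recr big1 /= ?add0r => [|i _].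
    by move/eqP; rewrite mulf_eq0 (negPf ux) orbF => /eqP.
  by rewrite c0 ?mul0r.
by move=> i; rewrite ltnS leq_eqVlt => /predU1P[-> // | /c0].
Qed.

Lemma linear_dependence (V : vectType k) (v : nat -> V) :
  exists2 c : nat -> k, (exists2 i, (i < (dim V).+1)%N & c i != 0) &
    \sum_(i < (dim V).+1) c i *: v i = 0.
Proof.
pose A : 'M[k]_((dim V).+1, dim V) := \matrix_(i < (dim V).+1) v2r (v i).
have kA : kermx A != 0.
  by rewrite kermx_eq0 /row_free neq_ltn (leq_ltn_trans (rank_leq_col A)).
have [i ri] : exists i, row i (kermx A) != 0.
  apply/existsP; rewrite -negb_forall; apply: contra kA => /forallP e.
  by apply/eqP/row_matrixP => i; rewrite row0; apply/eqP.
pose w := row i (kermx A).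
have wA : w *m A = 0 by apply/sub_kermxP; apply: row_sub.
have [j wj] : exists j, w 0 j != 0.
  apply/existsP; rewrite -negb_forall; apply: contra ri => /forallP e.
  by apply/eqP/rowP => j; rewrite [RHS]mxE; apply/eqP.
exists (fun m => w 0 (inord m)); first by exists j; rewrite ?inord_val.
apply: (can_inj v2rK); rewrite linear0 linear_sum -[RHS]wA mulmx_sum_row.
by apply: eq_bigr => m _; rewrite linearZ rowK inord_val.
Qed.

End Independence.

(** * Orders of grouplike elements and characters *)

Section Orders.

Variable (k : fieldType).
Hypothesis hk : [pchar k] =i pred0.
Variable H : hopfAlgType k.
Implicit Types x y : H.
Local Notation N := (dim H).

Lemma emx_iter (V : vectType k) (f : V -> V) n : linear f -> emx (iter n f) = emx f ^+ n.
Proof.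
move=> lf; elim: n => [|n IH]; first by rewrite emx_id.
rewrite exprSr -IH -[_ * _]/(emx (iter n f) *m emx f) -emx_comp //.
Qed.

Lemma emx_inj (V : vectType k) (f g : V -> V) : linear f -> linear g -> emx f = emx g -> f =1 g.
Proof. by move=> lf lg e x; apply: (can_inj v2rK); rewrite !emxE // e. Qed.

Lemma ltr_iter (V : vectType k) (f : V -> V) n : linear f -> ltr (iter n f) = \tr (emx f ^+ n).
Proof. by move=> lf; rewrite ltrE emx_iter. Qed.

Lemma eigproj_apply (V : vectType k) (f : V -> V) n (z : k) j (x : V) : linear f ->
  v2r x *m eigproj n (emx f) z j = v2r (n%:R^-1 *: \sum_(i < n) z^-1 ^+ (i * j) *: iter i f x).
Proof.
move=> lf; rewrite /eigproj -scalemxAr linearZ; congr (_ *: _).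
rewrite mulmx_sumr linear_sum; apply: eq_bigr => i _.
by rewrite -scalemxAr linearZ -emx_iter // -emxE //; apply: lin_iter.
Qed.

(** The powers of g are viewed as functions on the dual space; precomposition with [hitl (cb m)]
    multiplies evaluation at g^l by the m-th coordinate of g^l, which separates distinct powers. *)
Lemma grouplike_free (g : H) n (c : nat -> k) : grouplike g ->
  (forall i j, (i < j < n)%N -> g ^+ i != g ^+ j) ->
  \sum_(i < n) c i *: g ^+ i = 0 -> forall i, (i < n)%N -> c i = 0.
Proof.
move=> gg dist s0.
apply: (@eigenfunctions_free _ {linear H -> k^o} (fun i f => f (g ^+ i))) => [i j ij|i _|f].
- have [m nm] : exists m, cb m (g ^+ i) != cb m (g ^+ j).
    apply/existsP; rewrite -negb_forall; apply: contra (dist i j ij) => /forallP e.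
    by apply/eqP/cb_inj => m; apply/eqP.
  have lh (f : {linear H -> k^o}) : linear (fun x => f (hitl (cb m) x)) by lin.
  exists (fun f => linpack (lh f)), (fun l => cb m (g ^+ l)); split=> // l f _ /=.
  by rewrite hitl_grouplike ?linearZ //; apply: grouplikeX.
- by exists counit; have [_ ->] := grouplikeX i gg; rewrite oner_neq0.
have := congr1 f s0; rewrite linear0 linear_sum => e; rewrite -[RHS]e.
by apply: eq_bigr => i _; rewrite linearZ.
Qed.

Lemma character_free (f : {linear H -> k^o}) n (c : nat -> k) : character f ->
  (forall i j, (i < j < n)%N -> exists x, cpow f i x != cpow f j x) ->
  (forall x, \sum_(i < n) c i * cpow f i x = 0) -> forall i, (i < n)%N -> c i = 0.
Proof.
move=> fP dist s0; apply: eigenfunctions_free s0 => [i j ij|i _].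
  have [h nh] := dist i j ij; exists (fun x => x * h), (fun l => cpow f l h); split=> // l x _.
  by rewrite (character_cpow l fP).1 mulrC.
by exists 1; rewrite (character_cpow i fP).2 oner_neq0.
Qed.

(** Distinct powers are independent, so dim H + 1 of them cannot all be distinct. *)
Lemma grouplike_order (g : H) : grouplike g ->
  exists2 n, (0 < n)%N & g ^+ n = 1 /\ forall i, (0 < i < n)%N -> g ^+ i != 1.
Proof.
move=> gg; have ex : exists n, (0 < n)%N && (g ^+ n == 1).
  have [c [i iN ci] s0] := linear_dependence (fun i => g ^+ i).
  have [/existsP[n nP] | nex] := boolP [exists n : 'I_N.+1, (0 < n)%N && (g ^+ n == 1)].
    by exists n.
  case/eqP: ci; apply: (grouplike_free gg _ s0) => // a b /andP[ab bN].
  apply: contra nex => /eqP e; apply/existsP.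
  have dN : (b - a < N.+1)%N := leq_ltn_trans (leq_subr a b) bN.
  exists (Ordinal dN) => /=; rewrite subn_gt0 ab /=; apply/eqP.
  have gaa : grouplike (g ^+ a) by apply: grouplikeX.
  by rewrite -[LHS]mul1r -(grouplikeSl gaa) -mulrA -exprD subnKC 1?ltnW // -e.
case: (ex_minnP ex) => n /andP[n0 /eqP gn] nmin; exists n => //; split=> // i /andP[i0 lin].
by apply/negP => /eqP gi; have := nmin i; rewrite i0 gi eqxx leqNgt lin => /(_ isT).
Qed.

Lemma hitl_charSK (f : {linear H -> k^o}) x : character f -> hitl (charS f) (hitl f x) = x.
Proof.
move=> fP; rewrite {1}/hitl sw_hitl; last by bilin.
rewrite -[RHS](@sw_counitr _ _ _ x idfun (linearP _)); apply: eq_sw => a b.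
congr (_ *: _); rewrite -(sw_charSl fP b) /hitl (linear_tlift _ _ (linearP _)).
by apply: (@eq_sw k H H k^o) => c d; rewrite linearZ; apply: mulrC.
Qed.

Lemma cpow_sep (f : {linear H -> k^o}) n : character f ->
  (forall i, (0 < i < n)%N -> exists x, iter i (hitl f) x != x) ->
  forall i j, (i < j < n)%N -> exists x, cpow f i x != cpow f j x.
Proof.
move=> fP nid i j /andP[ij jn].
have [|x nx] := nid (j - i)%N; first by rewrite subn_gt0 ij (leq_ltn_trans (leq_subr i j) jn).
have [m nm] : exists m, cpow f i (vb m) != cpow f j (vb m).
  apply/existsP; rewrite -negb_forall; apply: contra nx => /forallP e.
  have inj : injective (iter i (hitl f)).
    elim: i {ij e nid} => [|i IH] y y' //=.
    by move=> /(congr1 (hitl (charS f))); rewrite !hitl_charSK // => /IH.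
  apply/eqP/inj; rewrite -iterD subnKC 1?ltnW // -!hitl_cpow.
  apply: eq_sw => a b; congr (_ *: _).
  rewrite -[LHS](vb_expand _ (linearP _)) -[RHS](vb_expand _ (linearP _)).
  by apply: eq_bigr => m _; rewrite /= (eqP (e m)).
by exists (vb m).
Qed.

(** The order of [f] is measured on the operator [hitl f], so that matrix results apply. Powers
    below the order are distinct by [cpow_sep], hence independent, and the dimension bounds their
    number. *)
Lemma character_order (f : {linear H -> k^o}) : character f ->
  exists2 n, (0 < n)%N & (forall x, iter n (hitl f) x = x) /\
     forall i, (0 < i < n)%N -> exists x, iter i (hitl f) x != x.
Proof.
move=> fP; pose X := emx (hitl f).
have XP n : reflect (forall x, iter n (hitl f) x = x) (X ^+ n == 1).
  rewrite -emx_iter; last exact: linearP.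
  apply: (iffP eqP) => [e x | e]; last by rewrite -[1]/(1%:M) -emx_id; apply: eq_emx.
  apply: (@emx_inj _ _ id); rewrite ?emx_id ?e //.
  by apply: lin_iter; apply: linearP.
have nXP n : X ^+ n != 1 -> exists x, iter n (hitl f) x != x.
  move=> nX; have [m nm] : exists m, iter n (hitl f) (vb m) != vb m.
    apply/existsP; rewrite -negb_forall; apply: contra nX => /forallP e.
    apply/XP => x; have li : linear (iter n (hitl f)) by apply: lin_iter; apply: linearP.
    rewrite -[LHS](vb_expand x li) -[RHS](vb_expand x (@lin_id k H)).
    by apply: eq_bigr => m _; rewrite (eqP (e m)).
  by exists (vb m).
have ex : exists n, (0 < n)%N && (X ^+ n == 1).
  have [c [i iN ci] s0] := linear_dependence (fun i => (\row_m cpow f i (vb m)) : 'rV[k]_N).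
  move: iN s0; rewrite /dim /= mul1n => iN s0.
  have [/existsP[n nP] | nex] := boolP [exists n : 'I_N.+1, (0 < n)%N && (X ^+ n == 1)].
    by exists n.
  case/eqP: ci; apply: (character_free fP _ _ iN) => [|x]; last first.
    have lc m : linear (cpow f m) by apply: linearP.
    under eq_bigr => m _ do rewrite -(vb_expand x (lc m)) mulr_sumr.
    rewrite exchange_big big1 // => m _ /=.
    have := congr1 (fun v : 'rV_N => v 0 m) s0; rewrite summxE mxE => e.
    rewrite -[RHS](mulr0 (cb m x)) -[X in _ = _ * X]e mulr_sumr.
    by apply: eq_bigr => a _; rewrite !mxE mulrCA.
  apply: (cpow_sep fP) => a /andP[a0 aN]; apply: nXP.
  apply: contra nex => Xa; apply/existsP; exists (Ordinal aN); rewrite a0; exact: Xa.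
case: (ex_minnP ex) => n /andP[n0 /XP gn] nmin; exists n => //; split=> // i /andP[i0 lin].
apply: nXP; apply/negP => gi; have := nmin i; rewrite i0 gi leqNgt lin => /(_ isT).
by [].
Qed.

Section UniformTraces.

Variables (n : nat) (z : k).
Hypothesis pz : n.-primitive_root z.

Lemma eigproj_eq0 (M : H -> H) j x : linear M -> eigproj n (emx M) z j = 0 ->
  \sum_(i < n) z^-1 ^+ (i * j) *: iter i M x = 0.
Proof.
move=> lM e; have := eigproj_apply n z j x lM.
have n0 : n%:R != 0 :> k by rewrite natr_char0 // -lt0n (prim_order_gt0 pz).
rewrite e mulmx0 => /esym e0; apply/eqP; rewrite -(inj_eq (scalerI (invr_neq0 n0))) scaler0.
by apply/eqP/(can_inj v2rK); rewrite e0 linear0.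
Qed.

(** A vanishing eigenprojection, applied to 1, would be a relation between distinct powers of g; the
    quadratic identity is [grouplike_trace] for the counit. *)
Lemma grouplike_uniform (g : H) : grouplike g -> g ^+ n = 1 ->
  (forall i, (0 < i < n)%N -> g ^+ i != 1) ->
  [/\ (n %| N)%N,
      forall j, (j < n)%N -> \rank (eigproj n (emx ( *%R g)) z j) = (N %/ n)%N &
      forall i, ~~ (n %| i)%N -> ltr ( *%R (g ^+ i)) = 0].
Proof.
move=> gg gn gi.
have lg a : linear ( *%R (a : H)) by apply: (@lin_mulr _ _ _ id).
have itg i x : iter i ( *%R g) x = g ^+ i * x.
  by elim: i => [|i IH] /=; rewrite ?mul1r // IH exprS mulrA.
have ltrg i : ltr ( *%R (g ^+ i)) = \tr (emx ( *%R g) ^+ i).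
  by rewrite -ltr_iter //; apply: eq_ltr => x; rewrite itg.
have [] := @trace_power_uniform _ hk N n (emx ( *%R g)) z pz; last first.
- by move=> d r t; split=> // i ni; rewrite ltrg t.
- move=> j jn; apply/negP => /eqP /(eigproj_eq0 1 (lg g)) s0.
  have : (fun i => z^-1 ^+ (i * j)) 0%N = 0.
    apply: (@grouplike_free g n (fun i => z^-1 ^+ (i * j)) gg); last exact: prim_order_gt0 pz.
    - move=> a b /andP[ab bn]; apply/negP => /eqP e.
      have := gi (b - a)%N; rewrite subn_gt0 ab (leq_ltn_trans (leq_subr a b) bn) => /(_ isT)/eqP.
      case; have gaa : grouplike (g ^+ a) by apply: grouplikeX.
      by rewrite -[LHS]mul1r -(grouplikeSl gaa) -mulrA -exprD subnKC 1?ltnW // -e.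
    - by rewrite -[RHS]s0; apply: eq_bigr => i _; rewrite itg mulr1.
  by move=> /eqP; rewrite mul0n expr0 oner_eq0.
- move=> i; rewrite -ltrg expr2.
  have := grouplike_trace counit (grouplikeX i gg).
  by rewrite (eq_ltr (g := *%R (g ^+ i))) // => x; rewrite hitr_counit.
- rewrite -emx_iter // -[1]/(1%:M) -emx_id; apply: eq_emx => x.
  by rewrite itg gn mul1r.
Qed.

(** [M] stands for [hitl f] or [hitr f]; the counit turns a vanishing eigenprojection into a
    relation between powers of [f]. *)
Lemma character_uniform (f : {linear H -> k^o}) (M : H -> H) : character f -> linear M ->
  (forall i x, counit (iter i M x) = cpow f i x) ->
  (forall i, ltr (iter i M) ^+ 2 = N%:R * ltr (iter i M)) ->
  (forall x, iter n M x = x) ->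
  (forall i, (0 < i < n)%N -> exists x, iter i (hitl f) x != x) ->
  [/\ (n %| N)%N,
      forall j, (j < n)%N -> \rank (eigproj n (emx M) z j) = (N %/ n)%N &
      forall i, ~~ (n %| i)%N -> ltr (iter i M) = 0].
Proof.
move=> fP lM eM trM Mn nid.
have [] := @trace_power_uniform _ hk N n (emx M) z pz; last first.
- by move=> d r t; split=> // i ni; rewrite ltr_iter // t.
- move=> j jn; apply/negP => /eqP e0.
  have : (fun i => z^-1 ^+ (i * j)) 0%N = 0.
    apply: (@character_free f n (fun i => z^-1 ^+ (i * j)) fP); last exact: prim_order_gt0 pz.
      exact: cpow_sep.
    move=> x; have := congr1 counit (eigproj_eq0 x lM e0); rewrite linear0 linear_sum => e; rewrite -[RHS]e.
    by apply: eq_bigr => i _; rewrite linearZ /= eM.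
  by move=> /eqP; rewrite mul0n expr0 oner_eq0.
- by move=> i; rewrite -ltr_iter.
- rewrite -emx_iter // -[1]/(1%:M) -emx_id; apply: eq_emx => x.
  by rewrite Mn.
Qed.

End UniformTraces.

Lemma iter_hitr_id (f : {linear H -> k^o}) n : (forall x, iter n (hitl f) x = x) ->
  forall x, iter n (hitr f) x = x.
Proof.
move=> e x; rewrite -hitr_cpow -[RHS]hitr_counit; apply: eq_sw => a b.
by rewrite /cpow e.
Qed.

Lemma counit_iter_hitr (f : {linear H -> k^o}) i x : counit (iter i (hitr f) x) = cpow f i x.
Proof. by rewrite -hitr_cpow counit_hitr. Qed.

Lemma ltr_iter_hitl (f : {linear H -> k^o}) i : character f ->
  ltr (iter i (hitl f)) ^+ 2 = N%:R * ltr (iter i (hitl f)).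
Proof.
move=> fP; rewrite -(eq_ltr (hitl_cpow f i)); apply: hitl_trace; exact: character_cpow.
Qed.

Lemma ltr_iter_hitr (f : {linear H -> k^o}) i : character f ->
  ltr (iter i (hitr f)) ^+ 2 = N%:R * ltr (iter i (hitr f)).
Proof.
move=> fP; rewrite -(eq_ltr (hitr_cpow f i)); apply: hitr_trace; exact: character_cpow.
Qed.

End Orders.

(** * Maschke's theorem *)

Section Maschke.

Variables (k : fieldType) (H : hopfAlgType k).
Implicit Types (x y h : H) (I J : {vspace H}).
Local Notation S := (@antipode k H).
Local Notation eps x := (@counit k H x : k).

Variable L : H.
Hypothesis LP : forall h, h * L = eps h *: L.
Hypothesis eL : eps L != 0.

(* The coproduct of L with S on its second leg is a Casimir element; averaging a
   projection over it gives a module projection. *)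
Lemma integral_casimir (W : vectType k) (b : H -> H -> W) h : bilinear_for *:%R *:%R b ->
  \sw_(c, d <- L) b (h * c) (S d) = \sw_(c, d <- L) b c (S d * h).
Proof.
move=> [bl br].
have lbr x : linear (b x) by exact: br.
have lbl y : linear (b^~ y) by exact: bl.
transitivity (\sw_(u, v <- h) \sw_(u1, u2 <- u) \sw_(c, d <- L) b (u1 * c) (S (u2 * d) * v)).
  rewrite sw_coassoc.
  rewrite -[LHS](@sw_counitr _ _ _ h (fun z => \sw_(c, d <- L) b (z * c) (S d))); last first.
    by apply: lin_tlift_body => c d a y y'; rewrite mulrDl -scalerAl (lbl (S d)).
  apply: eq_sw => u v; rewrite [RHS]tlift_exchange -tliftZ; apply: eq_sw => c d.
  have l2 : linear (fun z => b (u * c) (S d * z)).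
    by move=> a y y'; rewrite mulrDr -scalerAr lbr.
  have := sw_antipodel v l2; rewrite mulr1 => <-.
  by apply: eq_sw => v1 v2; rewrite antipodeM mulrA.
rewrite -[RHS](@sw_counitl _ _ _ h (fun z => \sw_(c, d <- L) b c (S d * z))); last first.
  by apply: lin_tlift_body => c d a y y'; rewrite mulrDr -scalerAr lbr.
apply: eq_sw => u v.
pose G z := \sw_(c, d <- z) b c (S d * v).
have bG : bilinear_for *:%R *:%R (fun c d => b c (S d * v)).
  split=> y; first exact: lbl.
  by move=> a z z'; rewrite /= linearP mulrDl -scalerAl lbr.
have lG : linear G by apply: lin_tlift; apply: linearP.
rewrite -[X in _ = _ *: X]/(G L) -(linZ lG) -LP /G sw_mul //.
Qed.

Lemma left_ideal_complement I J : left_ideal I -> left_ideal J -> (I <= J)%VS ->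
  exists C, [/\ left_ideal C, (I + C)%VS = J & (I :&: C)%VS = 0%VS].
Proof.
move=> lI lJ IJ.
(* The averaged projection onto [I]: it fixes [I] because L1 S(L2) = eps L, and commutes with left
   multiplications by [integral_casimir]. Its kernel in [J] is the complement. *)
pose pr x := (eps L)^-1 *: \sw_(c, d <- L) (c * projv I (S d * x)).
have lpr : linear pr by rewrite /pr; lin.
pose f := linfun (linpack lpr).
have fE x : f x = pr x by rewrite lfunE.
have prI x : pr x \in I.
  rewrite /pr /tlift memvZ // memv_suml // => i _; apply: memv_suml => j _.
  by rewrite memvZ // lI // memv_proj.
have pr_id x : x \in I -> pr x = x.
  move=> xI; rewrite /pr.
  under eq_sw => c d do rewrite projv_id ?lI // mulrA.
  rewrite (@sw_antipoder _ _ _ L (fun z => z * x)); last by lin.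
  by rewrite mul1r scalerA mulVf // scale1r.
have prM h x : pr (h * x) = h * pr x.
  rewrite /pr -scalerAr -tliftMl; congr (_ *: _).
  under [RHS]eq_sw => c d do rewrite mulrA.
  rewrite (@integral_casimir _ (fun c s => c * projv I (s * x))); last by bilin.
  by apply: eq_sw => c d; rewrite mulrA.
exists (lker f :&: J)%VS; split.
- move=> h x; rewrite !memv_cap !memv_ker !fE => /andP[/eqP x0 xJ].
  by rewrite prM x0 mulr0 eqxx lJ.
- apply/eqP; rewrite eqEsubv subv_add IJ capvSr /=; apply/subvP => x xJ.
  rewrite -[x](subrK (pr x)) addrC memv_add // memv_cap memv_ker fE.
  have xI := subvP IJ _ (prI x).
  have -> : pr (x - pr x) = pr x - pr (pr x).
    by rewrite -[pr (x - _)]/(linpack lpr _) linearB.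
  by rewrite (pr_id _ (prI x)) subrr eqxx memvB.
apply/eqP; rewrite -subv0; apply/subvP => x; rewrite memv_cap memv_cap memv_ker fE memv0.
by case/andP=> xI /andP[]; rewrite pr_id.
Qed.

Lemma minimal_left_ideal_exists J : left_ideal J -> J != 0%VS ->
  exists2 M, minimal_left_ideal M & (M <= J)%VS.
Proof.
move: {2}(\dim J) (leqnn (\dim J)) => n; elim: n J => [|n IH] J.
  by rewrite leqn0 dimv_eq0 => /eqP ->; rewrite eqxx.
move=> dJ lJ J0.
(* Minimality quantifies over all left ideals inside [J], hence the appeal to excluded middle. *)
have [mJ | nmJ] := classic (minimal_left_ideal J); first by exists J.
have [K [lK KJ K0 nKJ]] : exists K, [/\ left_ideal K, (K <= J)%VS, K != 0%VS & K != J].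
  apply: NNPP => nK; apply: nmJ; split=> // K lK KJ.
  have [->|K0] := eqVneq K 0%VS; first by left.
  have [->|nKJ] := eqVneq K J; first by right.
  by case: nK; exists K.
have [|M mM MK] := IH K _ lK K0.
  by rewrite -ltnS (leq_trans _ dJ) // ltn_neqAle dimvS // andbT; apply: contra nKJ; rewrite dimv_leqif_eq.
by exists M; rewrite ?(subv_trans MK).
Qed.

Lemma left_ideal_decomposition J : left_ideal J ->
  exists (n : nat) (I : 'I_n -> {vspace H}),
    [/\ forall i, minimal_left_ideal (I i), directv (\sum_(i < n) I i) &
        (\sum_(i < n) I i)%VS = J].
Proof.
move: {2}(\dim J) (leqnn (\dim J)) => n; elim: n J => [|n IH] J dJ lJ.
  exists 0%N, (fun=> 0%VS); split; first by case.
    by rewrite directvE /= !big_ord0 dimv0.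
  by apply/esym/eqP; rewrite big_ord0 -dimv_eq0 -leqn0.
have [J0|J0] := eqVneq J 0%VS.
  by apply: IH => //; rewrite J0 dimv0.
have [M mM MJ] := minimal_left_ideal_exists lJ J0.
have [lM M0 _] := mM.
have [C [lC MC MC0]] := left_ideal_complement lM lJ MJ.
have dMC : (\dim J = \dim M + \dim C)%N by rewrite -MC dimv_disjoint_sum.
have [|m [I [mI dI sI]]] := IH C _ lC.
  rewrite -ltnS (leq_trans _ dJ) // dMC -[X in (X < _)%N]add0n ltn_add2r.
  by rewrite lt0n dimv_eq0.
exists m.+1, (fun i => if unlift ord0 i is Some j then I j else M).
have e (R : Type) (op : R -> R -> R) idx (F : {vspace H} -> R) :
    \big[op/idx]_(i < m.+1) F (if unlift ord0 i is Some j then I j else M) =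
    op (F M) (\big[op/idx]_(i < m) F (I i)).
  rewrite big_ord_recl unlift_none; congr (op _ _).
  by apply: eq_bigr => i _; rewrite liftK.
split.
- by move=> i; case: (unlift ord0 i).
- move: dI; rewrite !directvE /= => /eqP dI; apply/eqP.
  by rewrite (e _ _ _ id) (e _ _ _ (fun V => \dim V)) sI MC dMC -dI sI.
by rewrite (e _ _ _ id) sI.
Qed.

Theorem maschke : semisimple_algebra H.
Proof. by apply: left_ideal_decomposition => h x _; rewrite memvf. Qed.

End Maschke.

(** * Idempotents of a grouplike element *)

Section GroupIdempotents.

Variable (k : fieldType).
Hypothesis hk : [pchar k] =i pred0.
Variable H : hopfAlgType k.
Implicit Types x y h : H.
Local Notation S := (@antipode k H).
Local Notation eps x := (@counit k H x : k).
Local Notation N := (dim H).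

Lemma lin_mul (a : H) : linear ( *%R a).
Proof. exact: (@lin_mulr _ _ _ id). Qed.

Lemma emx_mul (a b : H) : emx ( *%R (a * b)) = emx ( *%R b) * emx ( *%R a).
Proof.
rewrite -[RHS]/(emx ( *%R b) *m emx ( *%R a)) -emx_comp; last exact: lin_mul.
by apply: eq_emx => x /=; rewrite mulrA.
Qed.

Lemma emx_mul_inj (a b : H) : emx ( *%R a) = emx ( *%R b) -> a = b.
Proof. by move=> /(emx_inj (lin_mul a) (lin_mul b))/(_ 1); rewrite !mulr1. Qed.

Lemma emxZ (c : k) (a : H) : emx ( *%R (c *: a)) = c *: emx ( *%R a).
Proof. by apply/row_matrixP => i; rewrite linearZ /= !rowK -scalerAl linearZ. Qed.

Section Idempotents.

Variables (g : H) (n : nat) (z : k).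
Hypotheses (gg : grouplike g) (pz : n.-primitive_root z) (gn : g ^+ n = 1).

(** The idempotent in the group algebra of g on which g acts as z^j; [gidem 0] averages the powers
    of g. *)
Definition gidem (j : nat) : H := n%:R^-1 *: \sum_(i < n) z^-1 ^+ (i * j) *: g ^+ i.
Local Notation e := gidem.

Lemma emx_gidem j : emx ( *%R (e j)) = eigproj n (emx ( *%R g)) z j.
Proof.
apply/row_matrixP => i; rewrite rowK rowE.
have -> : delta_mx 0 i = v2r (vb i) :> 'rV[k]_N by rewrite /vb r2vK.
rewrite eigproj_apply //; last exact: lin_mul.
congr v2r; rewrite /gidem -scalerAl mulr_suml; congr (_ *: _).
apply: eq_bigr => a _; rewrite -scalerAl; congr (_ *: _).
by elim: (nat_of_ord a) => [|m IH] /=; rewrite ?mul1r // -IH exprS mulrA.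
Qed.

Let iterg i x : iter i ( *%R g) x = g ^+ i * x.
Proof. by elim: i => [|i IH] /=; rewrite ?mul1r // IH exprS mulrA. Qed.

Let Xn : emx ( *%R g) ^+ n = 1.
Proof.
rewrite -emx_iter; last exact: lin_mul.
by rewrite -[1]/(1%:M) -emx_id; apply: eq_emx => x; rewrite iterg gn mul1r.
Qed.

Lemma gidem_idem j : e j * e j = e j.
Proof. by apply: emx_mul_inj; rewrite emx_mul emx_gidem (eigproj_idem hk pz Xn). Qed.

Lemma gidem_comm j : g * e j = e j * g.
Proof.
rewrite /e -scalerAr -scalerAl mulr_sumr mulr_suml; congr (_ *: _).
by apply: eq_bigr => i _; rewrite -scalerAr -scalerAl -exprS -exprSr.
Qed.

Lemma gidem_mulg j : e j * g = z ^+ j *: e j.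
Proof.
apply: emx_mul_inj; rewrite emx_mul [RHS]emxZ emx_gidem; apply: (eigproj_mulX pz Xn j).
Qed.

Lemma mulg_gidem j : g * e j = z ^+ j *: e j.
Proof. by rewrite gidem_comm gidem_mulg. Qed.

Lemma gidem_sum : \sum_(j < n) e j = 1.
Proof.
apply: (can_inj v2rK); rewrite linear_sum /=.
have es : (1%:M : 'M[k]_N) = \sum_(j < n) eigproj n (emx ( *%R g)) z j.
  rewrite -[LHS](expr0 (emx ( *%R g))) (eigproj_sum hk pz Xn); apply: eq_bigr => j _.
  by rewrite mul0n expr0 scale1r.
rewrite -[RHS]mulmx1 es mulmx_sumr; apply: eq_bigr => j _.
by rewrite -emx_gidem -emxE ?mulr1 //; apply: lin_mul.
Qed.

Lemma antipode2_gidem j : antipode2 (e j) = e j.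
Proof.
rewrite /e linearZ linear_sum; congr (_ *: _); apply: eq_bigr => i _.
by rewrite linearZ /= antipode2_grouplike //; apply: grouplikeX.
Qed.

Lemma counit_gidem0 : counit (e 0) = 1.
Proof.
have n0 : n%:R != 0 :> k by rewrite natr_char0 // -lt0n (prim_order_gt0 pz).
rewrite /e linearZ linear_sum (eq_bigr (fun=> 1)) => [|i _].
  by rewrite sumr_const card_ord; apply: mulVf.
by rewrite muln0 expr0 scale1r (grouplikeX i gg).2.
Qed.

Lemma mulg_gidem0 i : g ^+ i * e 0 = e 0.
Proof.
elim: i => [|i IH]; first by rewrite expr0 mul1r.
by rewrite exprSr -mulrA mulg_gidem expr0 scale1r.
Qed.

Lemma antipode_gidem0 : S (e 0) = e 0.
Proof.
have gSi i : S (g ^+ i) * g ^+ i = 1 by apply: grouplikeSl; apply: grouplikeX.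
have Se i : S (g ^+ i) * e 0 = e 0 by rewrite -{1}(mulg_gidem0 i) mulrA gSi mul1r.
have n0 : n%:R != 0 :> k by rewrite natr_char0 // -lt0n (prim_order_gt0 pz).
have SE : S (e 0) = n%:R^-1 *: \sum_(i < n) S (g ^+ i).
  rewrite /e linearZ linear_sum; congr (_ *: _); apply: eq_bigr => i _.
  by rewrite muln0 expr0 scale1r.
have avg (a : H) : n%:R^-1 *: \sum_(i < n) a = a.
  by rewrite sumr_const card_ord -scaler_nat scalerA mulVf // scale1r.
have e1 : S (e 0) * e 0 = e 0.
  by rewrite SE -scalerAl mulr_suml -[RHS]avg; congr (_ *: _); apply: eq_bigr => i _.
by rewrite -{1}e1 antipodeM -/(antipode2 _) antipode2_gidem e1.
Qed.

End Idempotents.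

(* Let e be the average of the powers of g and t0 satisfy f^j (t0) = [j = 0].  A rank
   count shows that the f^j separate e H, hence e t0 is a right integral. *)
Lemma exact_integral (g : H) (f : {linear H -> k^o}) n m (z : k) : n.-primitive_root z ->
  grouplike g -> g ^+ n = 1 -> (forall i, (0 < i < n)%N -> g ^+ i != 1) ->
  character f -> (0 < m)%N ->
  (forall i, (0 < i < m)%N -> exists x, iter i (hitl f) x != x) ->
  (n * m = N)%N -> f g = 1 -> semisimple_algebra H.
Proof.
move=> pz gg gn gi fP m0 fi nm fg.
pose e := gidem g n z 0.
pose Q : 'M[k]_(N, m) := \matrix_(i, j) cpow f j (vb i).
have Qx (x : H) j : (v2r x *m Q) 0 j = cpow f j x.
  rewrite mxE -(vb_expand x (linearP (cpow f j))).
  by apply: eq_bigr => i _; rewrite !mxE.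
have rQ : \rank Q = m.
  rewrite -mxrank_tr; apply/eqP; rewrite -[_ == _]/(row_free Q^T); apply: inj_row_free => w wQ.
  pose c i := if insub i is Some j then w 0 j else 0.
  have cE (j : 'I_m) : c j = w 0 j by rewrite /c valK.
  apply/rowP => j; rewrite [RHS]mxE -cE.
  apply: (@character_free _ _ f m c fP (cpow_sep fP fi)) => // x.
  transitivity ((w *m (v2r x *m Q)^T) 0 0).
    by rewrite mxE; apply: eq_bigr => i _; rewrite cE [in RHS]mxE Qx.
  by rewrite trmx_mul mulmxA wQ mul0mx mxE.
have [n_N rke _] := grouplike_uniform hk pz gg gn gi.
have rP : \rank (emx ( *%R e)) = m.
  rewrite emx_gidem // rke ?(prim_order_gt0 pz) // -nm mulKn //.
  exact: prim_order_gt0 pz.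
have fe j : cpow f j e = 1.
  have n0 : n%:R != 0 :> k by rewrite natr_char0 // -lt0n (prim_order_gt0 pz).
  have cg i : cpow f j (g ^+ i) = 1.
    have ggi := grouplikeX i gg; rewrite /cpow (_ : iter j _ _ = g ^+ i) ?ggi.2 //.
    have fgi : f (g ^+ i) = 1.
      by elim: i {ggi} => [|i IH]; rewrite ?expr0 ?fP.2 // exprS fP.1 IH fg mulr1.
    by elim: j => //= j ->; rewrite hitl_grouplike // fgi scale1r.
  rewrite /e /gidem linearZ linear_sum (eq_bigr (fun=> 1)) => [|i _].
    by rewrite sumr_const card_ord; apply: mulVf.
  by rewrite muln0 expr0 scale1r; apply: cg.
have ee : emx ( *%R e) * emx ( *%R e) = emx ( *%R e).
  by rewrite -emx_mul gidem_idem.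
(* As f^j takes the value 1 at e, (1 - e) H lies in the kernel of [Q]; both have dimension N - m, so
   they agree. *)
have kerQ x : v2r x *m Q = 0 -> e * x = 0.
  move=> xQ; pose A := 1 - emx ( *%R e).
  have AQ : A *m Q = 0.
    apply/row_matrixP => i; rewrite rowE row0.
    have -> : delta_mx 0 i = v2r (vb i) :> 'rV[k]_N by rewrite /vb r2vK.
    apply/rowP => j; rewrite mulmxA mulmxBr mulmx1 -emxE; last exact: lin_mul.
    rewrite mulmxBl [RHS]mxE [LHS]mxE [X in _ + X]mxE !Qx (character_cpow j fP).1 fe mul1r.
    by rewrite subrr.
  have AA : A * A = A.
    by rewrite /A mulrBl mul1r mulrBr mulr1 ee subrr subr0.
  have rA : \rank A = (N - m)%N.
    apply: (natr_char0_inj hk); rewrite -mxtrace_idempotent // /A raddfB /= mxtrace1.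
    by rewrite mxtrace_idempotent // rP natrB // -nm leq_pmull // (prim_order_gt0 pz).
  have sA : (A <= kermx Q)%MS by apply/sub_kermxP.
  have : (kermx Q <= A)%MS.
    by rewrite -(geq_leqif (mxrank_leqif_sup sA)) mxrank_ker rQ rA.
  move=> kA; have /submxP[D xD] : (v2r x <= A)%MS.
    by apply: submx_trans kA; apply/sub_kermxP.
  apply: (can_inj v2rK); rewrite emxE; last exact: lin_mul.
  rewrite xD linear0 -mulmxA (_ : A *m _ = 0) ?mulmx0 //.
  by rewrite -[LHS]/(A * emx ( *%R e)) /A mulrBl mul1r ee subrr.
have [t0 t0P] : exists t0, forall j : 'I_m, cpow f j t0 = (j == 0%N :> nat)%:R.
  have fQ : row_full Q by rewrite /row_full rQ.
  have /submxP[D eD] := submx_full (delta_mx 0 (Ordinal m0) : 'rV[k]_m) fQ.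
  by exists (r2v D) => j; rewrite -Qx r2vK -eD mxE eqxx.
(* Every f^j vanishes on t0 h - eps(h) t0: for j = 0 it is the counit, for the other j it kills
   t0. *)
have right_int h : e * t0 * h = eps h *: (e * t0).
  apply/eqP; rewrite -subr_eq0 -mulrA scalerAr -mulrBr; apply/eqP/kerQ.
  apply/rowP => j; rewrite Qx mxE linearB linearZ /= (character_cpow j fP).1 t0P.
  case: eqP => [-> | _]; last by rewrite mul0r scaler0 subrr.
  by rewrite /cpow /= scaleRE mulr1 mul1r subrr.
have e1 : eps (e * t0) = 1.
  rewrite counitM /e (counit_gidem0 gg pz) mul1r.
  by have := t0P (Ordinal m0).
have [T [lT ST TS]] := antipode_bij H.
apply: (@maschke _ _ (S (e * t0))) => [h|]; last by rewrite counit_antipode e1 oner_neq0.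
by rewrite -[h]TS -antipodeM right_int linearZ /= counit_antipode.
Qed.

End GroupIdempotents.

Lemma iter_comp_comm (T : Type) (f g : T -> T) n x :
  (forall x, f (g x) = g (f x)) -> iter n (fun x => f (g x)) x = iter n f (iter n g x).
Proof.
move=> fg; elim: n => //= n ->; congr (f _).
by elim: n (iter n g x) => //= n IH y; rewrite -fg IH.
Qed.

Lemma iter_comm (T : Type) (f g : T -> T) n x :
  (forall x, f (g x) = g (f x)) -> iter n f (g x) = g (iter n f x).
Proof. by move=> fg; elim: n => //= n ->. Qed.

Section TwistedTraceHopf.

Variable (k : fieldType).
Hypothesis hk : [pchar k] =i pred0.
Variables (V : vectType k) (r p : nat) (E U : V -> V) (b : V -> V -> k^o) (w : k).
Hypotheses (pr : prime r) (r_odd : odd r) (pw : r.-primitive_root w).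
Hypotheses (lE : linear E) (lU : linear U) (lb : bilinear_for *:%R *:%R b).
Hypotheses (EE : forall x, E (E x) = E x) (EU : forall x, E (U x) = U (E x)).
Hypothesis Un : forall x, iter (2 * r) U x = x.
Hypothesis trUE : ltr (fun x => E (U x)) = 0.
Hypothesis b_sym : forall x y, E x = x -> E y = y -> b y x = b x (iter r U y).
Hypothesis b_nd : forall x, E x = x -> (forall y, E y = y -> b x y = 0) -> x = 0.
Hypotheses (pp : prime p) (p_odd : odd p).
Hypotheses (rE : (r * \rank (emx E) = p * (p + 2))%N) (rp : r = p \/ r = (p + 2)%N).

Lemma twisted_trace_vect :
  [/\ r = p,
      forall x y, E x = x -> E y = y -> iter r U x = x -> iter r U y = y ->
        x != 0 -> exists c : k, y = c *: x &
      exists x, [/\ x != 0, E x = x & U x = - x]].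
Proof.
pose B : 'M[k]_(dim V) := \matrix_(i, j) b (vb i) (vb j).
have bE x y : (x *m B *m y^T) 0 0 = b (r2v x) (r2v y).
  have [bl br] := lb; rewrite -(vb_expand (r2v x) (bl (r2v y))) -mulmxA mxE.
  apply: eq_bigr => i _; rewrite /cb r2vK; congr (_ * _).
  rewrite -(vb_expand (r2v y) (br (vb i))) mxE.
  by apply: eq_bigr => j _; rewrite !mxE /cb r2vK mulrC.
have lUn n : linear (iter n U) by apply: lin_iter.
have EP (x : 'rV_(dim V)) : x *m emx E = x <-> E (r2v x) = r2v x.
  split=> e; first by apply: (can_inj v2rK); rewrite emxE // r2vK.
  by rewrite -{1}(@r2vK _ _ x) -emxE // e r2vK.
have UnP n (x : 'rV_(dim V)) : r2v (x *m emx U ^+ n) = iter n U (r2v x).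
  by rewrite -emx_iter // -{1}(@r2vK _ _ x) -emxE // v2rK.
have r2v_eq0 (x : 'rV_(dim V)) : (r2v x == 0) = (x == 0).
  by rewrite -(inj_eq (can_inj v2rK)) r2vK linear0.
have EEm : emx E * emx E = emx E.
  by rewrite -[LHS]/(emx E *m emx E) -emx_comp //; apply: eq_emx => x /=; rewrite EE.
have EUm : emx E * emx U = emx U * emx E.
  rewrite -[LHS]/(emx E *m emx U) -[RHS]/(emx U *m emx E) -!emx_comp //.
  by apply: eq_emx => x /=; rewrite EU.
have Unm : emx U ^+ (2 * r) = 1.
  by rewrite -emx_iter // -[1]/(1%:M) -emx_id; apply: eq_emx.
have trm : \tr (emx U * emx E) = 0.
  by rewrite -[RHS]trUE ltrE -[_ * _]/(emx U *m emx E) -emx_comp.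
have [||r_p one neg] := twisted_trace hk (B := B) pr r_odd pw EEm EUm Unm trm _ _ pp p_odd rE rp.
- by move=> x y /EP xE /EP yE; rewrite !bE UnP b_sym.
- move=> x /EP xE x0; apply/eqP; rewrite -r2v_eq0; apply/eqP; apply: b_nd => // y yE.
  by rewrite -[y]v2rK -bE; apply: x0; apply/EP; rewrite v2rK.
split=> //.
- move=> x y xE yE xT yT x0.
  have [|||||c yc] := one (v2r x) (v2r y).
  + by apply/EP; rewrite v2rK.
  + by apply/EP; rewrite v2rK.
  + by rewrite -[LHS](@r2vK _ _) UnP v2rK xT.
  + by rewrite -[LHS](@r2vK _ _) UnP v2rK yT.
  + by rewrite -r2v_eq0 v2rK.
  by exists c; apply: (can_inj v2rK); rewrite yc linearZ.
have [x [x0 xE xU]] := neg; exists (r2v x); split; rewrite ?r2v_eq0 //; first exact/EP.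
by have := UnP 1%N x; rewrite expr1 /= xU linearN => <-.
Qed.

End TwistedTraceHopf.

(** * Hopf algebras of dimension p (p + 2) with a singular integral *)

Lemma iter_cancel (T : Type) (f h : T -> T) n x : (forall x, f (h x) = x) ->
  iter n f (iter n h x) = x.
Proof. by move=> fK; elim: n => // n IH; rewrite iterSr /= fK IH. Qed.

Lemma addr_even_odd (V : zmodType) (x y z w : V) :
  x + y - (z + w) + (x - y + (z - w)) = x + x - w - w.
Proof.
rewrite opprD !addrA (ACl (1*5*4*8*(2*6)*(3*7))%AC) /= subrr addNr !addr0.
by [].
Qed.
Section TensorIdentity.
Variable k : fieldType.
(** With a', b' the images of a, b under involutions, the left side is four times the odd part of a
    (x) b for the product involution: odd (x) even plus even (x) odd. *)
Lemma tens_even_odd (U V : vectType k) (a a' e : U) (b b' f : V) (c d : k) :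
  a + a' = c *: e -> b + b' = d *: f ->
  2%:R *: tens a b + (-2%:R) *: tens a' b' =
  d *: tens (a - a') f + c *: tens e (b - b').
Proof.
move=> ea eb; rewrite -tensZr -eb -tensZl -ea.
have lt1 w : linear (fun u => tens u w : tensor U V) by exact: (tens_bilinear U V).1.
have Dl u v w : tens (u + v) w = tens u w + tens v w :> tensor U V.
  by rewrite -[LHS]/(linpack (lt1 w) _) linearD.
have Nl u w : tens (- u) w = - tens u w :> tensor U V.
  by rewrite -[LHS]/(linpack (lt1 w) _) linearN.
have Dr u v w : tens w (u + v) = tens w u + tens w v :> tensor U V.
  by rewrite -[LHS]/(linpack (@lin_tens _ U V w) _) linearD.
have Nr u w : tens w (- u) = - tens w u :> tensor U V.
  by rewrite -[LHS]/(linpack (@lin_tens _ U V w) _) linearN.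
rewrite !Dl !Nl !Dr !Nr.
move: (tens a b : tensor U V) (tens a b' : tensor U V) (tens a' b : tensor U V) (tens a' b' : tensor U V) => A B C D.
rewrite [RHS](_ : _ = A + A - D - D); first by rewrite scaleNr !scaler_nat !mulr2n opprD addrA.
exact: addr_even_odd.
Qed.
End TensorIdentity.

Section AntipodePowers.

Variable (k : fieldType) (H : hopfAlgType k).
Implicit Types x y h : H.
Local Notation S := (@antipode k H).
Local Notation S2 := (@antipode2 k H).
Local Notation eps x := (@counit k H x : k).

Lemma iter_antipode2_linear n : linear (iter n S2).
Proof. by apply: lin_iter; apply: linearP. Qed.

Lemma iter_antipode2M n x y : iter n S2 (x * y) = iter n S2 x * iter n S2 y.
Proof. by elim: n => //= n ->; rewrite antipode2M. Qed.

Lemma iter_antipode21 n : iter n S2 (1 : H) = 1.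
Proof. by elim: n => //= n ->; rewrite antipode21. Qed.

Lemma sw_iter_antipode2 n (V : vectType k) x (b : H -> H -> V) : bilinear_for *:%R *:%R b ->
  \sw_(u, v <- iter n S2 x) b u v = \sw_(u, v <- x) b (iter n S2 u) (iter n S2 v).
Proof.
elim: n b => //= n IH b bb; rewrite sw_antipode2 // (IH (fun u v => b (S2 u) (S2 v))) //.
by have [bl br] := bb; split=> [y|y] a u v /=; rewrite linearP ?br ?(bl (S2 y)).
Qed.

Lemma iter_antipode2_fix n x : S2 x = x -> iter n S2 x = x.
Proof. by move=> e; elim: n => //= n ->. Qed.

Lemma iter_antipode2_opp n x : S2 x = - x -> odd n -> iter n S2 x = - x.
Proof.
move=> e n_odd; have -> : iter n S2 x = (-1) ^+ n *: x.
  elim: n {n_odd} => [|n IH] /=; first by rewrite scale1r.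
  by rewrite IH linearZ /= e scalerN -scaleNr exprS mulN1r.
by rewrite -signr_odd n_odd expr1 scaleN1r.
Qed.

End AntipodePowers.

(** * Consequences of Radford's formula when the integral is singular *)

Section Radford.

Variable (k : fieldType).
Hypothesis hk : [pchar k] =i pred0.
Variable H : hopfAlgType k.
Implicit Types x y h : H.
Local Notation S := (@antipode k H).
Local Notation S2 := (@antipode2 k H).
Local Notation eps x := (@counit k H x : k).
Local Notation N := (dim H).

Variable l : {linear H -> k^o}.
Hypothesis lP : left_cointegral l.
Hypothesis l_neq0 : exists x, l x != 0.
Variables (t L : H).
Hypothesis tP : forall x, l (t * x) = counit x.
Hypothesis LP : forall x, l (x * L) = counit x.
Hypothesis eL : eps L = 0.

Local Notation g := (dgrp l t).
Local Notation al := (dchar l t).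
Local Notation ac := (charS al).

Let gg : grouplike g := dgrpP lP l_neq0 tP.
Let aP : character al := dcharP lP l_neq0 tP.

(** Radford's formula says that S^4 composed with C is conjugation by g, where C lets al and its
    inverse act from the two sides. C commutes with S^4, and both C and the conjugation have trivial
    r-th power. *)
Lemma antipode2_power_id r : g ^+ r = 1 -> (forall x, iter r (hitl al) x = x) ->
  forall x, iter (2 * r) S2 x = x.
Proof.
move=> gr ar x.
pose C y := hitl al (hitr ac y).
have C_S2 y : S2 (C y) = C (S2 y).
  by rewrite /C hitr_antipode2 ?hitl_antipode2 //; apply: character_charS.
pose S4 y := S2 (S2 y).
have CS4 y : S4 (C y) = C (S4 y) by rewrite /S4 !C_S2.
have Cr y : iter r C y = y.
  rewrite (@iter_comp_comm _ (hitl al) (hitr ac)) => [|z]; last exact: hitlr.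
  by rewrite ar -[LHS](iter_hitr_id ar) (iter_cancel _ _ (hitr_charSK aP)).
pose ad y := S g * (y * g).
have adE y : ad y = S4 (C y).
  by rewrite /ad (radford_S4 lP l_neq0 tP y) mulrA grouplikeSl // mul1r.
have adr : forall n y, iter n ad y = S (g ^+ n) * (y * g ^+ n).
  elim=> [|n IH] y /=; first by rewrite antipode1 mul1r mulr1.
  by rewrite IH /ad [in RHS]exprSr antipodeM !mulrA.
have e : iter r S4 x = x.
  rewrite -{1}(Cr x) -iter_comp_comm //.
  transitivity (iter r ad x); first by elim: r {gr ar Cr adr} => //= n ->; rewrite adE.
  by rewrite adr gr antipode1 mul1r mulr1.
rewrite -[RHS]e; elim: r {gr ar Cr e adr} => // n IH.
by rewrite mulnS add2n !iterS IH.
Qed.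

Lemma ltr_left_mul a : ltr (fun x => a * S2 x) = 0.
Proof. by rewrite (ltr_left_mul_antipode2 a lP LP) eL mul0r. Qed.

(** The trace is a multiple of f(S L). If that were nonzero, h L = eps(h) L would force [charS f] to
    be the counit, and then f(S L) = eps L = 0. *)
Lemma ltr_hitl_S2 (f : {linear H -> k^o}) : character f -> ltr (fun x => hitl f (S2 x)) = 0.
Proof.
move=> fP; rewrite (ltr_hitl_antipode2 lP LP fP).
have cP := character_charS fP.
suff e : charS f L = 0 by rewrite -[f (S L)]/(charS f L) e mul0r.
apply/eqP; apply: contraT => nz.
have ce h : charS f h = counit h.
  have := left_integralP lP l_neq0 LP h => /(congr1 (charS f)).
  by rewrite cP.1 linearZ => /(mulIf nz).
by rewrite ce eL eqxx in nz.
Qed.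

Lemma dchar_dgrp_power r : g ^+ r = 1 -> (al g : k) ^+ r = 1.
Proof.
move=> gr; rewrite -[RHS](aP.2) -gr; elim: r {gr} => [|r IH]; first by rewrite !expr0 aP.2.
by rewrite !exprS aP.1 IH.
Qed.

Lemma dchar_dgrp_power_dual r : (forall x, iter r (hitl al) x = x) -> (al g : k) ^+ r = 1.
Proof.
move=> /(_ g)/(congr1 counit).
have -> : iter r (hitl al) g = (al g : k) ^+ r *: g.
  elim: r => [|r IH] /=; first by rewrite expr0 scale1r.
  by rewrite IH linearZ /= hitl_grouplike // scalerA -exprSr.
by rewrite linearZ /= gg.2 scaleRE mulr1.
Qed.

(** This is [al] applied to l(z1) z2 = l(z) g. *)
Lemma cointegral_hitl z : l (hitl al z) = (al g : k) * l z.
Proof.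
have := congr1 al (hitr_cointegral lP l_neq0 tP z).
rewrite linearZ /= scaleRE mulrC => <-.
rewrite /hitl /hitr !(linear_tlift _ _ (linearP _)); apply: (@eq_sw k H H k^o) => u v.
by rewrite !linearZ /= !scaleRE mulrC.
Qed.

Lemma cointegral_iter_antipode2 n z : (al g : k) ^+ n * l (iter n S2 z) = l z.
Proof.
elim: n => [|n IH] /=; first by rewrite expr0 mul1r.
by rewrite exprSr -mulrA -[X in _ * X]scaleRE (cointegral_antipode2 lP l_neq0 tP).
Qed.

Section Twin.

Variables (p r : nat) (z : k).
Hypotheses (pp : prime p) (p_odd : odd p) (hN : N = (p * (p + 2))%N).
Hypotheses (pr : prime r) (r_odd : odd r) (rp : r = p \/ r = (p + 2)%N).
Hypothesis pz : r.-primitive_root z.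
Hypothesis ar : forall x, iter r (hitl al) x = x.

Let r2h : r = (r./2 + r./2).+1.
Proof. by rewrite -{1}[r]odd_double_half r_odd -addnn add1n. Qed.

(** * The distinguished grouplike element has prime order *)

Section GrouplikeCase.

Hypotheses (gr : g ^+ r = 1) (gi : forall i, (0 < i < r)%N -> g ^+ i != 1).

Local Notation e := (gidem g r z).
Let h := r./2.
(** A square root of g, as 2 (h + 1) = r + 1. *)
Let a := g ^+ h.+1.
(** That is l(S^r(x) y a), as 2 h + 1 = r. *)
Let form x y : k^o := l (S (iter h S2 x) * y * a).

Let ga : grouplike a. Proof. exact: grouplikeX. Qed.

Let aa : a * a = g.
Proof. by rewrite /a -exprD addSn addnS -r2h exprS gr mulr1. Qed.

(** The identity l(g S z) = l z exchanges the arguments, and applying S^(2 h) under [l] restores S^r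
    on x. The resulting factors al(g)^h and al(a) = al(g)^(h+1) multiply to al(g)^r = 1. *)
Let form_sym x y : form y x = form x (iter r S2 y).
Proof.
have cr := dchar_dgrp_power gr.
rewrite /form -[LHS](cointegral_antipode lP l_neq0 tP) !antipodeM.
rewrite mulrA -{1}aa -[a * a * S a]mulrA grouplikeSr // mulr1.
rewrite -(cointegral_iter_antipode2 h) !iter_antipode2M.
rewrite iter_antipode2_fix; last exact: antipode2_grouplike.
rewrite (cointegral_grouplike lP l_neq0 tP) // scaleRE mulrA.
have -> : (al a : k) = (al g : k) ^+ h.+1.
  by rewrite /a; elim: h.+1 => [|i IH]; rewrite ?expr0 ?(proj2 aP) // !exprS aP.1 IH.
rewrite -exprD addnS -r2h cr mul1r; congr (l (_ * _ * _)).
  by elim: h => //= n ->.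
by rewrite -[S (S _)]/(S2 _) -iterS -iterD addnS -r2h.
Qed.

Let form_nd x : e 0 * x = x -> (forall y, e 0 * y = y -> form x y = 0) -> x = 0.
Proof.
move=> ex x0.
have e00 : e 0 * e 0 = e 0 by rewrite gidem_idem.
have lx y : l (S (iter h S2 x) * y) = 0.
  (* In this test vector S(a) cancels the factor a of the form, and e is absorbed by x because S e =
     e. *)
  have : form x (e 0 * (y * S a)) = 0 by apply: x0; rewrite mulrA e00.
  rewrite /form -ex iter_antipode2M (iter_antipode2_fix _ (antipode2_gidem _ _ gg _)).
  rewrite antipodeM (antipode_gidem0 hk gg pz gr) !mulrA.
  rewrite -[_ * e 0 * e 0]mulrA e00 -[_ * S a * a]mulrA grouplikeSl // mulr1.
  done.
have S0 y : S y = 0 -> y = 0 by move=> y0; apply: (antipode_inj lP tP); rewrite y0 linear0.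
have := S0 _ (cointegral_nondegl lP l_neq0 lx).
by elim: h => //= i IH y0; apply/IH/S0/S0.
Qed.

(** The projection is left multiplication by [e 0], and the line is spanned by [e 0] itself, which
    S^2 fixes and whose counit is 1. *)
Lemma grouplike_case : [/\ r = p,
  forall y, e 0 * y = y -> iter r S2 y = y -> exists c : k, y = c *: e 0 &
  exists x, [/\ x != 0, e 0 * x = x & S2 x = - x]].
Proof.
have e00 : e 0 * e 0 = e 0 by rewrite gidem_idem.
have Se : S2 (e 0) = e 0 by apply: antipode2_gidem.
have [_ rk _] := grouplike_uniform hk pz gg gr gi.
have r0 : (0 < r)%N := prim_order_gt0 pz.
have lform : bilinear_for *:%R *:%R form.
  have lS := iter_antipode2_linear (H := H) h.
  split=> y; rewrite /form; last by lin.
  by move=> c u v /=; rewrite lS linearP !mulrDl -!scalerAl linearP.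
have [|||||||||r_p one neg] := @twisted_trace_vect k hk H r p (fun x => e 0 * x) S2 form z
    pr r_odd pz _ _ lform _ _ _ _ _ _ pp p_odd _ rp.
- exact: lin_mul.
- exact: linearP.
- by move=> x; rewrite mulrA e00.
- by move=> x; rewrite antipode2M Se.
- exact: antipode2_power_id.
- exact: ltr_left_mul.
- by move=> x y _ _; apply: form_sym.
- exact: form_nd.
- rewrite -[emx _]/(emx ( *%R (e 0))) emx_gidem // rk // mulnC divnK //.
  by have [] := grouplike_uniform hk pz gg gr gi.
split=> // y ey Ty; apply: one => //; first exact: iter_antipode2_fix.
apply: contra_eq_neq (counit_gidem0 hk gg pz) => ->.
by rewrite linear0 eq_sym oner_neq0.
Qed.

(* For y odd under S^(2r), x y is even, hence a multiple of e 0 with counit 0; for y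
   even, x y = x e_i y is a multiple of x, and l x = 0.  So l (x y) = 0 for all y. *)
Lemma no_odd_eigenvector i x : x * e i = x -> e 0 * x = x -> S2 x = - x ->
  (forall y, iter r S2 y = y -> exists c : k, e i * y = c *: e i) -> x = 0.
Proof.
move=> xe ex Sx ei; have [_ one _] := grouplike_case.
(* al(g) is an r-th root of unity with r odd, so it is not -1; then l x = al(g) l(S^2 x) = - al(g) l
   x gives l x = 0. *)
have ce : (al g : k) != -1.
  apply/eqP => cN; have := dchar_dgrp_power gr; rewrite cN -signr_odd r_odd expr1 => e1.
  by have := opp_fixed_eq0 hk (esym e1 : 1 = -1 :> k^o) => /eqP; rewrite oner_eq0.
have Tx : iter r S2 x = - x by apply: iter_antipode2_opp.
have epsx : counit x = 0.
  apply: (opp_fixed_eq0 hk); rewrite -{1}(counit_antipode2 x) Sx.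
  by rewrite linearN.
have lx0 : l x = 0.
  have := cointegral_antipode2 lP l_neq0 tP x; rewrite Sx linearN scalerN => /eqP.
  rewrite scaleRE eq_sym -addr_eq0 -{1}[l x]mul1r -mulrDl mulf_eq0.
  by rewrite addrC addr_eq0 (negPf ce) => /eqP.
have TT y : iter r S2 (iter r S2 y) = y.
  by rewrite -iterD addnn -mul2n (antipode2_power_id gr ar).
apply: (cointegral_nondegl lP l_neq0) => y.
pose yp := 2%:R^-1 *: (y + iter r S2 y); pose ym := 2%:R^-1 *: (y - iter r S2 y).
have lT := iter_antipode2_linear (H := H) r.
have lTB u v : iter r S2 (u - v) = iter r S2 u - iter r S2 v.
  by rewrite -[iter r S2]/(linpack lT : H -> H) linearB.
have ysum : y = yp + ym.
  rewrite /yp /ym -scalerDr addrACA subrr addr0 -mulr2n -scaler_nat scalerA mulVf ?scale1r //.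
  by rewrite natr_char0.
have Typ : iter r S2 yp = yp.
  by rewrite /yp (linZ lT) -[iter r S2 (_ + _)]/(linpack lT _) linearD /= TT addrC.
have Tym : iter r S2 ym = - ym by rewrite /ym (linZ lT) lTB TT -scalerN opprB.
have xym : x * ym = 0.
  have [||c xc] := one (x * ym); first by rewrite mulrA ex.
    by rewrite iter_antipode2M Tx Tym mulrNN.
  have := congr1 counit xc; rewrite counitM epsx mul0r linearZ /= (counit_gidem0 hk gg pz).
  by rewrite scaleRE mulr1 => /esym c0; rewrite xc c0 scale0r.
have [c ec] := ei yp Typ.
by rewrite ysum mulrDr xym addr0 -xe -mulrA ec -scalerAr xe linearZ /= lx0 scaler0.
Qed.

(** Here Radford's formula reads x g = g S^4 x = g x = x, so x is also fixed by right multiplication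
    by [e 0]. *)
Lemma grouplike_case_unimodular : (forall x, hitl al x = x) -> False.
Proof.
move=> al1; have [_ one [x [x0 ex Sx]]] := grouplike_case.
move/eqP: x0; apply; apply: (@no_odd_eigenvector 0) => //.
  have ac1 y : hitr ac y = y.
    by have [T [lT ST TS]] := antipode_bij H; rewrite -[y]TS -antipode_hitl // al1.
  have xg : x * g = x.
    rewrite (radford_S4 lP l_neq0 tP) ac1 al1 Sx linearN /= Sx opprK.
    by rewrite -ex mulrA (mulg_gidem pz gr) expr0 scale1r.
  have xgi i : x * g ^+ i = x by elim: i => [|i IH]; rewrite ?mulr1 // exprS mulrA xg.
  have n0 : r%:R != 0 :> k by rewrite natr_char0 // -lt0n (prim_order_gt0 pz).
  rewrite /gidem -scalerAr mulr_sumr (eq_bigr (fun=> x)) => [|i _]; last first.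
    by rewrite muln0 expr0 scale1r.
  by rewrite sumr_const card_ord -scaler_nat scalerA mulVf // scale1r.
move=> y Ty; apply: one; first by rewrite mulrA gidem_idem.
by rewrite iter_antipode2M Ty iter_antipode2_fix //; apply: antipode2_gidem.
Qed.

(** Some x e_i is nonzero. The algebra automorphism [hitl al] commutes with S^2 and maps e_(i+1) to
    e_i, so the condition on even elements required by [no_odd_eigenvector] passes from e_0 to every
    e_i. *)
Lemma grouplike_case_linked : al g = z -> False.
Proof.
move=> alg; have [_ one [x [x0 ex Sx]]] := grouplike_case.
have [i xi] : exists i, x * e i != 0.
  have [/existsP[i xi]|] := boolP [exists i : 'I_r, x * e i != 0]; first by exists i.
  rewrite negb_exists => /forallP x0'; case/eqP: x0.
  rewrite -[x]mulr1 -(gidem_sum hk pz gr) mulr_sumr big1 // => i _.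
  by apply/eqP; have := x0' i; rewrite negbK.
move/eqP: xi; apply; apply: (@no_odd_eigenvector i).
- by rewrite -mulrA gidem_idem.
- by rewrite mulrA ex.
- by rewrite antipode2M Sx antipode2_gidem // mulNr.
move=> y Ty.
have shift j : hitl al (e j.+1) = e j.
  rewrite /gidem linearZ linear_sum; congr (_ *: _); apply: eq_bigr => m _.
  rewrite linearZ /= hitl_grouplike; last exact: grouplikeX.
  have ea : (al (g ^+ m) : k) = z ^+ m.
    by elim: (nat_of_ord m) => [|u IH]; rewrite ?expr0 ?(proj2 aP) // !exprS aP.1 IH alg.
  rewrite /= ea scalerA mulnS addnC exprD -mulrA -exprMn mulVf ?expr1n ?mulr1 //.
  by rewrite (prim_root_eq0 pz) -lt0n (prim_order_gt0 pz).
elim: i y Ty => [|i IH] y Ty.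
  apply: one; first by rewrite mulrA gidem_idem.
  by rewrite iter_antipode2M Ty iter_antipode2_fix //; apply: antipode2_gidem.
have [|c ec] := IH (hitl al y).
  by rewrite (iter_comm r y (g := hitl al)) ?Ty // => u; rewrite hitl_antipode2.
exists c; rewrite -[LHS](hitl_charSK _ aP) hitlM // shift ec linearZ -(shift i) /=.
by rewrite hitl_charSK.
Qed.

(* The projections onto the invariants of g and of al commute, and their product
   has trace p (p + 2) / r^2, which is not an integer. *)
Lemma grouplike_case_unlinked : al g = 1 ->
  (forall i, (0 < i < r)%N -> exists x, iter i (hitl al) x != x) -> False.
Proof.
move=> alg ali; have rr : r%:R != 0 :> k by rewrite natr_char0 // -lt0n (prim_order_gt0 pz).
have r0 := prim_order_gt0 pz.
have lR : linear (hitr al) by apply: linearP.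
pose A := emx ( *%R (e 0)); pose B := eigproj r (emx (hitr al)) z 0.
have Rn : emx (hitr al) ^+ r = 1.
  rewrite -emx_iter // -[1]/(1%:M) -emx_id; apply: eq_emx => x.
  exact: iter_hitr_id.
have AA : A * A = A by rewrite /A -emx_mul gidem_idem.
have BB : B * B = B by apply: eigproj_idem.
have algi i : (al (g ^+ i) : k) = 1.
  by elim: i => [|i IH]; rewrite ?expr0 ?(proj2 aP) // exprS aP.1 IH alg mulr1.
have Re : hitr al (e 0) = e 0.
  rewrite {1}/gidem linearZ linear_sum; congr (_ *: _); apply: eq_bigr => i _.
  rewrite linearZ /= hitr_grouplike /= ?algi ?scale1r //; exact: grouplikeX.
have AB : A * B = B * A.
  apply: eigproj_comm; rewrite -[LHS]/(A *m _) -[RHS]/(_ *m A) -!emx_comp //; last exact: lin_mul.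
  by apply: eq_emx => x /=; rewrite hitrM // Re.
have ABAB : A * B * (A * B) = A * B by rewrite mulrA -[A * B * A]mulrA -AB mulrA AA -mulrA BB.
have [rN _ trg] := grouplike_uniform hk pz gg gr gi.
have [_ _ trR] := character_uniform hk pz aP lR (counit_iter_hitr al) (fun i => ltr_iter_hitr i aP) (iter_hitr_id ar) ali.
(* Multiplication by g^j has trace 0, so [grouplike_trace] says that N times the mixed trace is
   0. *)
have trgR i j : ~~ (r %| j)%N -> ltr (fun x => iter i (hitr al) (g ^+ j * x)) = 0.
  move=> rj; have := grouplike_trace (cpow al i) (grouplikeX j gg).
  rewrite (trg _ rj) mulr0 => /esym/eqP; rewrite mulf_eq0 natr_char0 // hN.
  rewrite muln_eq0 addn2 orbF => /orP[/eqP p0|/eqP <-]; first by move: pp; rewrite p0.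
  by apply: eq_ltr => x; rewrite hitr_cpow.
have trAB : \tr (A * B) = (r%:R * r%:R)^-1 * N%:R.
  have trAi i : \tr (A * emx (hitr al) ^+ i) = r%:R^-1 * ltr (iter i (hitr al)).
    rewrite -emx_iter // -[_ * _]/(_ *m _) -emx_comp; last exact: lin_iter.
    rewrite -ltrE; pose i0 : 'I_r := Ordinal r0.
    transitivity (r%:R^-1 * \sum_(j < r) ltr (fun x => iter i (hitr al) (g ^+ j * x))).
      rewrite /ltr exchange_big mulr_sumr; apply: eq_bigr => m _ /=.
      have lF : linear (fun y => cb m (iter i (hitr al) (y * vb m))).
        by move=> c u v; rewrite mulrDl -scalerAl iter_hitr_linear linearP.
      rewrite -[LHS]/((fun y => cb m (iter i (hitr al) (y * vb m))) (e 0)) /gidem (linZ lF).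
      rewrite -[X in _ *: X]/(linpack lF _) linear_sum scaleRE; congr (_ * _).
      by apply: eq_bigr => j _; rewrite muln0 expr0 scale1r.
    rewrite (bigD1 i0) //= [X in _ + X]big1 ?addr0 => [|j nj].
      by congr (_ * _); apply: eq_ltr => x; rewrite expr0 mul1r.
    by rewrite trgR // gtnNdvd // lt0n; apply: contra nj => /eqP j0; apply/eqP/val_inj.
  rewrite /B /eigproj -mxscalerAr mxtraceZ [A * _]mulr_sumr raddf_sum /= invfM -mulrA; congr (_ * _).
  rewrite (bigD1 (Ordinal r0)) //= [X in _ + X]big1 ?addr0 => [|i ni].
    by rewrite muln0 expr0 scale1r trAi /= ltr_id.
  rewrite muln0 expr0 scale1r trAi trR ?mulr0 // gtnNdvd // lt0n.
  by apply: contra ni => /eqP j0; apply/eqP/val_inj.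
move: trAB; rewrite mxtrace_idempotent // => e1.
have : (\rank (A * B)%R * (r * r) = N)%N.
  apply: (natr_char0_inj hk); rewrite natrM e1 natrM mulrC mulrA mulfV ?mul1r //.
  by rewrite mulf_neq0.
move=> rkN; have := etrans rkN hN; move: (\rank _) => rk e2; have p1 := prime_gt1 pp.
(* For r = p + 2 the rank times p + 2 would be p; for r = p the prime p would divide p + 2, hence
   2. *)
case: rp => er; rewrite er in e2; last first.
  have e3 : (rk * (p + 2) = p)%N.
    by apply/eqP; rewrite -(@eqn_pmul2r (p + 2)) -?mulnA ?e2 // addn2.
  by case: rk e3 {e2} => [|rk]; rewrite ?mul0n ?mulSn; lia.
have : (p %| p + 2)%N by rewrite -(dvdn_pmul2l (prime_gt0 pp)) -e2 dvdn_mull.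
rewrite dvdn_addr // => /dvdn_leq => /(_ isT) p2.
by have ep : p = 2%N by [lia]; move: p_odd; rewrite ep.
Qed.

End GrouplikeCase.

(** * Trivial distinguished grouplike element, modular character of prime order *)

Section CharacterCase.

Hypotheses (g1 : g = 1)
  (ali : forall i, (0 < i < r)%N -> exists x, iter i (hitl al) x != x).

Local Notation M := (hitl al).
(** Chosen so that 2 h + r = 2 r + 1: on the invariants of [M] the Nakayama automorphism is S^2, and
    the twist by (S^2)^h turns it into (S^2)^r. *)
Let h := (r./2).+1.
Let E x : H := r%:R^-1 *: \sum_(i < r) iter i M x.
Let form x y : k^o := l (x * iter h S2 y).

Let r0 : (0 < r)%N := prim_order_gt0 pz.
Let rk : r%:R != 0 :> k. Proof. by rewrite natr_char0 // -lt0n. Qed.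
Let lM : linear M. Proof. exact: linearP. Qed.
Let lE : linear E.
Proof. by apply: lin_scaler; apply: lin_sum => i; apply: iter_hitl_linear. Qed.

Let E_id x : M x = x -> E x = x.
Proof.
move=> Mx; rewrite /E (eq_bigr (fun=> x)) => [|i _].
  by rewrite sumr_const card_ord -scaler_nat scalerA mulVf // scale1r.
by elim: (nat_of_ord i) => //= j ->.
Qed.

Let emxE' : emx E = eigproj r (emx M) z 0.
Proof.
apply/row_matrixP => i; rewrite rowK rowE.
have -> : delta_mx 0 i = v2r (vb i) :> 'rV[k]_N by rewrite /vb r2vK.
rewrite eigproj_apply //; congr (v2r (_ *: _)); apply: eq_bigr => j _.
by rewrite muln0 expr0 scale1r.
Qed.

Let Xn : emx M ^+ r = 1.
Proof.
rewrite -emx_iter // -[1]/(1%:M) -emx_id; apply: eq_emx => x; exact: ar.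
Qed.

Let ME x : M (E x) = E x.
Proof.
move: x; apply: emx_inj => //; first by move=> c u v; rewrite lE linearP.
rewrite -[LHS]/(emx (M \o E)) emx_comp // emxE' -[_ *m _]/(_ * _).
rewrite -(eigproj_comm r z 0 (erefl (emx M * emx M))) (eigproj_mulX pz Xn).
by rewrite expr0 scale1r.
Qed.

Let EE x : E (E x) = E x. Proof. exact/E_id/ME. Qed.

Let ES2 x : E (S2 x) = S2 (E x).
Proof.
rewrite /E [RHS]linearZ /=; congr (_ *: _); rewrite linear_sum; apply: eq_bigr => i _.
by rewrite /= (iter_comm i x (g := S2)) // => y; rewrite hitl_antipode2.
Qed.

Let alg : (al g : k) = 1. Proof. by rewrite g1 aP.2. Qed.

Let lS2 n y : l (iter n S2 y) = l y.
Proof. by have := cointegral_iter_antipode2 n y; rewrite alg expr1n mul1r. Qed.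

Let S2_id : forall x, iter (2 * r) S2 x = x.
Proof. by apply: antipode2_power_id => //; rewrite g1 expr1n. Qed.

Let form_sym x y : E x = x -> E y = y -> form y x = form x (iter r S2 y).
Proof.
move=> Ex Ey; rewrite /form (mul_nakayama lP l_neq0 tP) /nak -Ey ME Ey.
rewrite -[RHS](lS2 h) iter_antipode2M -!iterD; congr (l (_ * _)).
rewrite (_ : h + h + r = 1 + 2 * r)%N; last by rewrite /h; have := r2h; lia.
by rewrite iterD S2_id.
Qed.

(** Both [l] and x are invariant under the algebra automorphism [M], so averaging the second
    argument does not change l(x y). *)
Let form_nd x : E x = x -> (forall y, E y = y -> form x y = 0) -> x = 0.
Proof.
move=> Ex x0; apply: (cointegral_nondegl lP l_neq0) => y.
have Mx : M x = x by rewrite -Ex ME.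
have lMz w : l (M w) = l w by rewrite cointegral_hitl alg mul1r.
have liM i w : l (x * iter i M w) = l (x * w).
  by elim: i => //= i <-; rewrite -[in RHS]lMz hitlM // Mx.
pose y' := iter (2 * r - h) S2 y.
have ey : iter h S2 y' = y.
  by rewrite /y' -iterD subnKC ?S2_id // /h; have := r2h; lia.
have := x0 (E y') (EE y'); rewrite /form.
have -> : iter h S2 (E y') = E y.
  by rewrite (iter_comm h y' (f := S2) (g := E)) ?ey // => u; rewrite ES2.
rewrite /E -scalerAr mulr_sumr linearZ linear_sum (eq_bigr (fun=> l (x * y))) => [|i _].
  by rewrite sumr_const card_ord /= -scaler_nat scalerA mulVf // scale1r.
exact: liM.
Qed.

(** The trace of E S^2 vanishes term by term, each power of [M] being the action of a character; the
    line is spanned by 1. *)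
Lemma character_case : [/\ r = p,
  forall y, E y = y -> iter r S2 y = y -> exists c : k, y = c *: 1 &
  exists x, [/\ x != 0, E x = x & S2 x = - x]].
Proof.
have lform : bilinear_for *:%R *:%R form.
  have lS := iter_antipode2_linear (H := H) h.
  split=> y; rewrite /form; first by lin.
  by move=> c u v; rewrite /form lS mulrDr -scalerAr linearP.
have [rN rkE _] := character_uniform hk pz aP lM (fun i x => erefl) (fun i => ltr_iter_hitl i aP) ar ali.
have tr0 : ltr (fun x => E (S2 x)) = 0.
  transitivity (r%:R^-1 * \sum_(i < r) ltr (fun x => iter i M (S2 x))).
    rewrite /ltr exchange_big mulr_sumr; apply: eq_bigr => m _ /=.
    by rewrite /E cbZ linear_sum.
  rewrite big1 ?mulr0 // => i _.
  rewrite -[RHS](ltr_hitl_S2 (character_cpow i aP)).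
  by apply: eq_ltr => x; rewrite hitl_cpow.
have rkN : (r * \rank (emx E) = p * (p + 2))%N by rewrite emxE' rkE // mulnC divnK.
have [r_p one neg] := @twisted_trace_vect k hk H r p E S2 form z
    pr r_odd pz lE (linearP _) lform EE ES2 S2_id tr0 form_sym form_nd pp p_odd rkN rp.
split=> // y ey Ty; apply: one => //; rewrite ?oner_neq0 //.
  by apply/E_id/hitl1.
exact: iter_antipode21.
Qed.

(* The even part of the invariants is the line of 1, so the coproduct of x is
   y (x) 1 + 1 (x) y'; thus x is primitive, S x = - x and S^2 x = x. *)
Lemma character_case_false : False.
Proof.
have [_ one [x [x0 Ex Sx]]] := character_case; move/eqP: x0; apply.
have Mx : M x = x by rewrite -Ex ME.
have cP := character_charS aP.
pose R := hitr ac; pose E' y := r%:R^-1 *: \sum_(i < r) iter i R y.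
(* With g = 1 and S^4 x = x, Radford's formula makes x invariant under the right action as well. *)
have Rx : R x = x.
  have e := radford_S4 lP l_neq0 tP x; rewrite g1 mulr1 mul1r in e.
  have e2 : S2 (S2 (hitl al (hitr ac x))) = hitr ac x.
    by rewrite hitlr Mx -(hitr_antipode2 cP) -(hitr_antipode2 cP) Sx linearN /= Sx opprK.
  by rewrite /R -e2 -e.
have E'S y : E' (S y) = S (E y).
  rewrite /E' /E [RHS]linearZ /=; congr (_ *: _); rewrite linear_sum; apply: eq_bigr => i _.
  by elim: (nat_of_ord i) => //= j ->; rewrite antipode_hitl.
pose T := iter r S2.
have lT : linear T := iter_antipode2_linear (H := H) r.
have TT y : T (T y) = y by rewrite /T -iterD addnn -mul2n S2_id.
have Tx : T x = - x by apply: iter_antipode2_opp.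
have TS y : T (S y) = S (T y) by rewrite /T; elim: r => //= n ->.
have TE y : T (E y) = E (T y) by rewrite /T; elim: r => //= n ->; rewrite ES2.
have TD u v : T (u + v) = T u + T v by rewrite -[T]/(linpack lT : H -> H) linearD.
have EDD u v : E (u + v) = E u + E v by rewrite -[E]/(linpack lE : H -> H) linearD.
have even y : E y + T (E y) = (counit (E y + T (E y)) : k) *: 1.
  have [||c ec] := one (E y + T (E y)).
  - by rewrite EDD EE -TE EE.
  - by rewrite -/T TD TT addrC.
  by rewrite ec linearZ /= counit1 scaleRE mulr1.
have even' y : E' y + T (E' y) = (counit (E' y + T (E' y)) : k) *: 1.
  have [u ->] := antipode_surj lP tP y.
  rewrite E'S TS -linearD counit_antipode even linearZ /= antipode1; congr (_ *: _).
  by rewrite -even.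
have TE' u : T (E' u) = E' (T u).
  by have [w ->] := antipode_surj lP tP u; rewrite TS !E'S TS TE.
have tl : bilinear_for *:%R *:%R (@tens k H H) := tens_bilinear H H.
have lR : linear R by apply: linearP.
(* Invariance of x under R and M lets the left and right legs of its coproduct be averaged
   separately. *)
have E'D : comul x = \sw_(u, v <- x) tens (E' u) (E v).
  have iR i (W : vectType k) (b : H -> H -> W) : bilinear_for *:%R *:%R b ->
      \sw_(u, v <- x) b (iter i R u) v = \sw_(u, v <- x) b u v.
    elim: i b => //= i IH b [bl br].
    rewrite (IH (fun u v => b (R u) v)); last first.
      by split=> w; [move=> c u v; rewrite lR bl | apply: br].
    by rewrite -sw_hitr // -[hitr _ x]/(R x) Rx.
  have iM i (W : vectType k) (b : H -> H -> W) : bilinear_for *:%R *:%R b ->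
      \sw_(u, v <- x) b u (iter i M v) = \sw_(u, v <- x) b u v.
    elim: i b => //= i IH b [bl br].
    rewrite (IH (fun u v => b u (M v))); last first.
      by split=> w; [apply: bl | move=> c u v; rewrite /= linearP br].
    by rewrite -sw_hitl // Mx.
  have avg (W : vectType k) (X : W) : r%:R^-1 *: \sum_(i < r) X = X.
    by rewrite sumr_const card_ord -scaler_nat scalerA mulVf // scale1r.
  rewrite -[LHS]tlift_id -[LHS]avg.
  under eq_bigr => i _ do rewrite -(iR i) //.
  rewrite -tlift_sum -tliftZ.
  transitivity (\sw_(u, v <- x) tens (E' u) v).
    apply: eq_sw => u v; rewrite /E' tensZl; congr (_ *: _).
    have lt : linear (fun w => tens w v : tensor H H) by exact: tl.1.
    by rewrite -[RHS]/(linpack lt _) linear_sum.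
  have lE' : linear E'.
    apply: lin_scaler; apply: lin_sum => i; apply: iter_hitr_linear.
  have bE' : bilinear_for *:%R *:%R (fun u v => tens (E' u) v : tensor H H).
    by split=> w; [move=> c u v; rewrite /= lE' tl.1 | apply: tl.2].
  rewrite -[LHS]avg; under eq_bigr => i _ do rewrite -(iM i _ _ bE').
  rewrite -tlift_sum -tliftZ; apply: eq_sw => u v.
  rewrite /E tensZr; congr (_ *: _).
  by rewrite -[RHS]/(linpack (@lin_tens _ H H (E' u)) _) linear_sum.
have lE' : linear E'.
  by apply: lin_scaler; apply: lin_sum => i; apply: iter_hitr_linear.
have bEE : bilinear_for *:%R *:%R (fun u v => tens (E' u) (E v) : tensor H H).
  by split=> w; [move=> c u v; rewrite /= lE' tl.1 | move=> c u v; rewrite lE tl.2].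
have ED : \sw_(u, v <- x) tens (T (E' u)) (T (E v)) = - comul x.
  rewrite (eq_sw (b' := fun u v => tens (E' (T u)) (E (T v)))) => [|u v]; last by rewrite TE' TE.
  by rewrite -(sw_iter_antipode2 r x bEE) -/T Tx linearN linearN; congr (- _); rewrite [RHS]E'D.
(* Since T x = - x, four times the coproduct of x is 2 (comul x - (T (x) T) (comul x)). The identity
   [tens_even_odd] splits each term, and the even factors are scalars. *)
have [y [y' eD]] : exists y y', comul x = tens y 1 + tens 1 y'.
  pose c u : k := counit (E' u + T (E' u)); pose d v : k := counit (E v + T (E v)).
  exists (4%:R^-1 *: \sw_(u, v <- x) (d v *: (E' u - T (E' u)))).
  exists (4%:R^-1 *: \sw_(u, v <- x) (c u *: (E v - T (E v)))).
  have lt1 : linear (fun w => tens w 1 : tensor H H) by exact: tl.1.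
  rewrite tensZl tensZr -scalerDr (linear_tlift _ _ lt1) (linear_tlift _ _ (lin_tens _)).
  have k4 : 4%:R != 0 :> k by rewrite natr_char0.
  apply: (scalerI k4); rewrite scalerA mulfV // scale1r.
  transitivity (\sw_(u, v <- x) (2%:R *: tens (E' u) (E v) + (-2%:R) *: tens (T (E' u)) (T (E v)))).
    rewrite tliftD tliftZ -E'D ED scaleNr scalerN opprK -scalerDl.
    by congr (_ *: _); rewrite -natrD.
  rewrite -[X in X + _]scale1r -tliftD; apply: eq_sw => u v.
  rewrite scale1r (tensZl (d v)) (tensZr (c u)).
  exact: tens_even_odd (even' u) (even v).
have epsx : counit x = 0.
  by apply: (opp_fixed_eq0 hk); rewrite -{1}(counit_antipode2 x) Sx linearN.
have Sxx : S x = - x.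
  have e1 := counit_comull x; have e2 := counit_comulr x; have e3 := antipodel x.
  rewrite eD linearD /= !tlift_tens in e1; try by bilin.
  rewrite eD linearD /= !tlift_tens in e2; try by bilin.
  rewrite eD linearD /= !tlift_tens in e3; try by bilin.
  have ey' : y' = x - (counit y : k) *: 1 by rewrite -e1 counit1 scale1r addrC addKr.
  have ey : y = x - (counit y' : k) *: 1 by rewrite -e2 counit1 scale1r addrK.
  have ee : (counit y' : k) = - counit y.
    by rewrite {1}ey' linearB linearZ /= epsx counit1 scaleRE mulr1 sub0r.
  move: e3; rewrite antipode1 mulr1 mul1r epsx scale0r {1}ey linearB linearZ /= antipode1 ee.
  by rewrite scaleNr opprK [in X in _ + X]ey' addrACA subrr addr0 => /eqP; rewrite addr_eq0 => /eqP.
have := Sx; rewrite /antipode2 Sxx linearN /= Sxx opprK; exact: opp_fixed_eq0.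
Qed.

End CharacterCase.

End Twin.

End Radford.

(** * Case analysis on the two orders in dimension p (p + 2) *)

Lemma dvdn_prime_mul p q n : prime p -> prime q -> (n %| p * q)%N ->
  [\/ n = 1%N, n = p, n = q | n = (p * q)%N].
Proof.
move=> pp pq; have [/dvdnP[m ->] | pn] := boolP (p %| n)%N.
  rewrite mulnC dvdn_pmul2l ?prime_gt0 // => /(primeP pq).2/pred2P[] ->.
    by rewrite muln1; constructor 2.
  by constructor 4.
rewrite Gauss_dvdr; last by rewrite coprime_sym prime_coprime.
by move/(primeP pq).2/pred2P => [] ->; [constructor 1 | constructor 3].
Qed.

Lemma prim_root_prime (R : nzRingType) (x : R) r : prime r -> x ^+ r = 1 -> x != 1 ->
  r.-primitive_root x.
Proof.
move=> pr xr x1; have [m mP] := prim_order_exists (prime_gt0 pr) xr.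
by case/(primeP pr).2/pred2P => m1; move: mP; rewrite m1 // => /prim_expr_order/eqP; rewrite expr1 (negPf x1).
Qed.

(** (1 + A) / 2 is an idempotent of trace n / 2, and this trace is its rank. *)
Lemma involution_trace (k : fieldType) (hk : [pchar k] =i pred0) n (A : 'M[k]_n) :
  A *m A = 1%:M -> \tr A = 0 -> ~~ odd n.
Proof.
move=> AA tA; have k2 : 2%:R != 0 :> k by rewrite natr_char0.
pose F := 2%:R^-1 *: (1%:M + A).
have FF : F *m F = F.
  rewrite /F -scalemxAl -scalemxAr mulmxDl !mulmxDr !mul1mx mulmx1 AA.
  rewrite [A + _]addrC -mulr2n -[in LHS]scaler_nat [2^-1 *: (2 *: _)]scalerA mulVf ?scale1r //.
have := mxtrace_idempotent FF.
rewrite /F linearZ /= linearD /= tA addr0 mxtrace1 => /(congr1 ( *%R 2%:R)).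
rewrite mulrA mulfV // mul1r -natrM => /(natr_char0_inj hk) ->.
by rewrite oddM.
Qed.

Section TwinPrimes.

Variables (k : closedFieldType) (hk : [pchar k] =i pred0) (H : hopfAlgType k) (p : nat).
Hypotheses (pp : prime p) (pq : prime (p + 2)) (hN : dim H = (p * (p + 2))%N).

Lemma character_counit : character (@counit k H).
Proof. by split; [exact: counitM | exact: counit1]. Qed.

Lemma twin_odd : odd p.
Proof. by have [p2|//] := even_prime pp; move: pq; rewrite p2. Qed.

Lemma twin_coprime : coprime p (p + 2).
Proof. by rewrite prime_coprime // dvdn_addr // dvdn_prime2 //; apply/eqP => p2; move: twin_odd; rewrite p2. Qed.

Lemma prim_root1 : 1.-primitive_root (1 : k).
Proof. by apply/andP; split=> //; apply/forallP => i; rewrite ord1 unity_rootE expr1n !eqxx. Qed.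

Section SingularIntegral.

Variables (l : {linear H -> k^o}) (t L : H).
Hypotheses (lP : left_cointegral l) (l_neq0 : exists x, l x != 0).
Hypotheses (tP : forall x, l (t * x) = counit x) (LP : forall x, l (x * L) = counit x).
Hypothesis eL : (counit L : k) = 0.

Local Notation g := (dgrp l t).
Local Notation al := (dchar l t).

Let gg : grouplike g := dgrpP lP l_neq0 tP.
Let aP : character al := dcharP lP l_neq0 tP.

Lemma order1_case : g = 1 -> (forall x, hitl al x = x) -> False.
Proof.
move=> g1 al1; have e : forall x, iter (2 * 1) (@antipode2 k H) x = x.
  by apply: (antipode2_power_id lP l_neq0 tP) => //; rewrite g1 expr1n.
have : ~~ odd (dim H).
  apply: (involution_trace hk (A := emx (@antipode2 k H))).
    by rewrite -emx_comp; [rewrite -emx_id; apply: eq_emx => x; exact: e | exact: linearP].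
  rewrite -ltrE -[RHS](ltr_left_mul lP LP eL 1).
  by apply: eq_ltr => x; rewrite mul1r.
by rewrite hN oddM oddD twin_odd.
Qed.

Lemma grouplike_order_case r m : prime r -> odd r -> r = p \/ r = (p + 2)%N ->
  g ^+ r = 1 -> (forall i, (0 < i < r)%N -> g ^+ i != 1) ->
  (forall x, iter m (hitl al) x = x) ->
  (forall i, (0 < i < m)%N -> exists x, iter i (hitl al) x != x) ->
  m = 1%N \/ m = r -> False.
Proof.
move=> pr r_odd rp gr gi am ai [m1 | mr].
  have [z pz] := prim_root_exists hk (prime_gt0 pr).
  have al1 x : hitl al x = x by have := am x; rewrite m1.
  apply: (grouplike_case_unimodular hk lP l_neq0 tP LP eL pp twin_odd hN pr r_odd rp pz) => //.
  by move=> x; elim: r {pr r_odd rp gr gi pz} => //= r ->.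
rewrite mr in am ai; have ar := am.
have [a1|a1] := eqVneq (al g : k) 1.
  have [z pz] := prim_root_exists hk (prime_gt0 pr).
  exact: (grouplike_case_unlinked hk lP l_neq0 tP pp twin_odd hN pr r_odd rp pz ar gr gi a1 ai).
(* al(g) is an r-th root of unity other than 1, so it can itself serve as the primitive root in the
   spectral idempotents. *)
have pz := prim_root_prime pr (dchar_dgrp_power lP l_neq0 tP gr) a1.
exact: (grouplike_case_linked hk lP l_neq0 tP LP eL pp twin_odd hN pr r_odd rp pz ar gr gi (erefl _)).
Qed.

Lemma character_order_case r : prime r -> odd r -> r = p \/ r = (p + 2)%N -> g = 1 ->
  (forall x, iter r (hitl al) x = x) ->
  (forall i, (0 < i < r)%N -> exists x, iter i (hitl al) x != x) -> False.
Proof.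
move=> pr r_odd rp g1 ar ai; have [z pz] := prim_root_exists hk (prime_gt0 pr).
exact: (character_case_false hk lP l_neq0 tP LP eL pp twin_odd hN pr r_odd rp pz ar g1 ai).
Qed.

Lemma singular_semisimple : semisimple_algebra H.
Proof.
have [n n0 [gn gi]] := grouplike_order gg.
have [m m0 [am ai]] := character_order aP.
have [z pz] := prim_root_exists hk n0.
have [w pw] := prim_root_exists hk m0.
have [nN _ _] := grouplike_uniform hk pz gg gn gi.
have [mN _ _] := character_uniform hk pw aP (linearP (hitl al)) (fun i x => erefl)
  (fun i => ltr_iter_hitl i aP) am ai.
have q_odd : odd (p + 2) by rewrite oddD twin_odd.
have exact_case : (n * m = dim H)%N -> (al g : k) = 1 -> semisimple_algebra H.
  by move=> nm ag; apply: (exact_integral hk pz gg gn gi aP m0 ai nm ag).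
(* The order of al(g) divides both n and m. *)
have ag1 : coprime n m -> (al g : k) = 1.
  move=> co; have an := dchar_dgrp_power lP l_neq0 tP gn; have am' := dchar_dgrp_power_dual lP l_neq0 tP am.
  case: (egcdnP m n0) co => u v e _ /eqP co.
  by have := congr1 (GRing.exp (al g : k)) e; rewrite co addn1 exprS ![(_ * n)%N]mulnC ![(_ * m)%N]mulnC !exprM an am' !expr1n mulr1.
have cop := twin_coprime; have cop' : coprime (p + 2) p by rewrite coprime_sym.
rewrite hN in nN mN exact_case.
have n1 : n = 1%N -> g = 1 by move=> n1; move: gn; rewrite n1 expr1.
(* When one order is already the full dimension, that element alone gives the integral; its partner
   is replaced by the unit or by the counit, of order 1. *)
have [em|em] := eqVneq m (p * (p + 2))%N.
  apply: (exact_integral hk prim_root1 (grouplike1 H) (expr1n _ _) _ aP m0 ai) => //.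
  - by case.
  - by rewrite mul1n em hN.
  - exact: aP.2.
have [en|en] := eqVneq n (p * (p + 2))%N.
  apply: (exact_integral hk pz gg gn gi character_counit (ltn0Sn 0)) => //.
  - by case.
  - by rewrite muln1 en hN.
  - exact: gg.2.
have grp r : prime r -> odd r -> r = p \/ r = (p + 2)%N -> n = r -> m = 1%N \/ m = r -> semisimple_algebra H.
  by move=> pr od rp nr mr; case: (grouplike_order_case pr od rp _ _ am ai mr); rewrite -nr.
have chr r : prime r -> odd r -> r = p \/ r = (p + 2)%N -> m = r -> n = 1%N -> semisimple_algebra H.
  by move=> pr od rp mr /n1 g1; case: (character_order_case pr od rp g1); rewrite -mr.
have [en1|en1|en1|/eqP] := dvdn_prime_mul pp pq nN; last by rewrite (negPf en).
- have [em1|em1|em1|/eqP] := dvdn_prime_mul pp pq mN; last by rewrite (negPf em).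
  + by case: (order1_case (n1 en1)) => x; have := am x; rewrite em1.
  + by apply: (chr p) => //; [exact: twin_odd | left].
  + by apply: (chr (p + 2)%N) => //; right.
- have [em1|em1|em1|/eqP] := dvdn_prime_mul pp pq mN; last by rewrite (negPf em).
  + by apply: (grp p) => //; [exact: twin_odd | left | left].
  + by apply: (grp p) => //; [exact: twin_odd | left | right].
  + by apply: exact_case; [rewrite en1 em1 | rewrite ag1 // en1 em1].
- have [em1|em1|em1|/eqP] := dvdn_prime_mul pp pq mN; last by rewrite (negPf em).
  + by apply: (grp (p + 2)%N) => //; [right | left].
  + by apply: exact_case; [rewrite en1 em1 mulnC | rewrite ag1 // en1 em1].
  + by apply: (grp (p + 2)%N) => //; [right | right].
Qed.

End SingularIntegral.

End TwinPrimes.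

Local Close Scope ring_scope.

Theorem theorem3p4 (k : closedFieldType) (hk : [pchar k]%R =i pred0)
  (p q : nat) (hp : prime p) (hq : prime q) (hpq : q = p + 2)
  (H : hopfAlgType k) (hH : \dim {:H} = p * q) :
  semisimple_algebra H.
Proof.
rewrite hpq in hq hH; rewrite dimvf in hH.
have [l [lP l_neq0]] := left_cointegral_exists H.
have [t tP] := cointegral_right_integral lP l_neq0.
have [L LP] := cointegral_left_integral lP l_neq0.
have [eL|eL] := eqVneq (counit L : k) 0%R.
  exact: (singular_semisimple hk hp hq hH lP l_neq0 tP LP eL).
exact: (maschke (left_integralP lP l_neq0 LP) eL).
Qed.
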